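(* Let $v\in C^1\big([r_{\min},r_{\max}],H^{\tau+1}(\mathfrak D)\cap\tilde H_0^1(\mathfrak D)\big)$. Then, for all $r\in[r_{\min},r_{\max}]$ and $h\in(0,h_\star]$, $$\big\|\partial_r\big(R_h(r)v(r)-v(r)\big)\big\|_1\le C\,h^{\tau}\big(\|v(r)\|_{\tau+1}+\|\partial_rv(r)\|_{\tau+1}\big),$$ with a constant $C$ independent of $h$, $r$ and $v$.
   Context: Let $r_{\min}<r_{\max}$, $\theta_{\min}<\theta_{\max}$, $\mathfrak{D}=(0,1)\times(\theta_{\min},\theta_{\max})$ with points $(y,\theta)$, and $\nabla v=(v_y,v_\theta)^t$. $(u,v)=\int_{\mathfrak D}u\bar v$, $\|\cdot\|$ is the $L^2(\mathfrak D)$ norm, $\|\cdot\|_m$ the norm of the complex Sobolev space $H^m(\mathfrak D)$. $\tilde H_0^1(\mathfrak D)$ is the space of $v\in H^1(\mathfrak D)$ vanishing on $y=0$, $\theta=\theta_{\min}$ and $\theta=\theta_{\max}$. Coefficients (smooth on $[r_{\min},r_{\max}]\times\overline{\mathfrak D}$): $D=D(r,y,\theta)$ is a $2\times2$ real symmetric matrix with $\det D>0$ everywhere (so $D$ is everywhere positive definite or everywhere negative definite; put $\sigma=1$ or $\sigma=-1$ respectively); $b=(b_1,b_2)(r,y,\theta)$ is real, with $b\nabla v=b_1v_y+b_2v_\theta$; $\lambda=\lambda(r,\theta)$ is complex-valued; and $b_1(r,1,\theta)-2\,\mathrm{Re}\,\lambda(r,\theta)\le0$ for all $r,\theta$. Form: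 for $v,w\in\tilde H_0^1(\mathfrak D)$, $$\mathcal B(r;v,w)=\sigma\Big[(D(r)\nabla v,\nabla w)-\mathrm i\Big(\int_{\theta_{\min}}^{\theta_{\max}}\lambda(r,\theta)v(1,\theta)\overline{w}(1,\theta)\,d\theta-(b(r)\nabla v,w)\Big)\Big]+\delta(v,w),$$ where $\delta>0$ is a fixed constant large enough that $\mathrm{Re}\,\mathcal B(r;v,v)\ge C\|v\|_1^2$ for some $C>0$, all $r$ and all $v\in\tilde H_0^1(\mathfrak D)$. Finite elements: $\tau\ge1$ is an integer; for $h\in(0,h_\star]$, $S_h\subset\tilde H_0^1(\mathfrak D)$ is a finite-dimensional space of complex-valued functions that are piecewise polynomials of degree $\le\tau$ over a partition of $\mathfrak D$ of mesh size $h$, such that, with constants independent of $h$, $\inf_{\chi\in S_h}\{\|v-\chi\|+h\|v-\chi\|_1\}\le Ch^{s+1}\|v\|_{s+1}$ for all $v\in H^{s+1}(\mathfrak D)\cap\tilde H_0^1(\mathfrak D)$, $s=0,\dots,\tau$, and $\|\phi\|_1\le Ch^{-1}\|\phi\|$ for all $\phi\in S_h$. The projection $R_h(r):\tilde H_0^1(\mathfrak D)\to S_h$ is defined by $\mathcal B(r;R_h(r)v,\phi)=\mathcal B(r;v,\phi)$ for all $\phi\in S_h$. *)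

(* Defs.v *)
From HB Require Import structures.
From mathcomp Require Import all_boot all_order all_algebra.
From mathcomp Require Import all_classical all_reals all_analysis.
From mathcomp.real_closed Require Import complex.
Set Implicit Arguments.
Unset Strict Implicit.
Unset Printing Implicit Defensive.
Import Order.TTheory GRing.Theory Num.Theory numFieldNormedType.Exports.
Local Open Scope classical_set_scope.
Local Open Scope complex_scope.
Local Open Scope ring_scope.

(* Functions on a plane domain are represented by total functions
   R * R -> R[i]; their values outside the domain are irrelevant, and elements
   of L^2 and H^m are such functions, taken up to a.e. equality. *)

Notation area := (lebesgue_measure \x lebesgue_measure)%E.

(* In finite dimension this is C^infinity: every iterated directional
   derivative exists and is (Frechet) differentiable, hence continuous. *)
Definition smooth (R : realType) (V : normedModType R) (f : V -> R) : Prop :=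
  forall (s : seq V) (x : V), differentiable (foldr (fun e g => 'D_e g) f s) x.

Definition csmooth (R : realType) (V : normedModType R) (f : V -> R[i]) : Prop :=
  smooth (fun x => complex.Re (f x)) /\ smooth (fun x => complex.Im (f x)).

(* Smoothness on a closed set, up to the boundary. *)
Definition smooth_on (R : realType) (V : normedModType R) (A : set V)
    (f : V -> R) : Prop :=
  exists2 g : V -> R, smooth g & forall x, A x -> f x = g x.

(** * Complex-valued L^2 *)

Definition cintegral (d : measure_display) (T : measurableType d)
    (R : realType) (mu : {measure set T -> \bar R}) (A : set T)
    (f : T -> R[i]) : R[i] :=
  (\int[mu]_(x in A) complex.Re (f x)) +i* (\int[mu]_(x in A) complex.Im (f x)).

Definition sqmod (R : realType) (z : R[i]) : R :=
  complex.Re z ^+ 2 + complex.Im z ^+ 2.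

Definition in_L2 (d : measure_display) (T : measurableType d)
    (R : realType) (mu : {measure set T -> \bar R}) (A : set T)
    (f : T -> R[i]) : Prop :=
  [/\ measurable_fun A (fun x => complex.Re (f x)),
      measurable_fun A (fun x => complex.Im (f x))
    & mu.-integrable A (fun x => (sqmod (f x))%:E)].

Definition L2norm (d : measure_display) (T : measurableType d)
    (R : realType) (mu : {measure set T -> \bar R}) (A : set T)
    (f : T -> R[i]) : R :=
  Num.sqrt (\int[mu]_(x in A) sqmod (f x)).

(** * Complex Sobolev spaces H^m on an open subset of the plane *)

Definition pderiv (R : realType) (i j : nat) (phi : R * R -> R) : R * R -> R :=
  iter i (fun g => 'D_((1, 0) : R * R) g)
    (iter j (fun g => 'D_((0, 1) : R * R) g) phi).

Definition test_fun (R : realType) (Om : set (R * R)) (phi : R * R -> R) : Prop :=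
  smooth phi /\
  exists K : set (R * R),
    [/\ compact K, K `<=` Om & forall p, ~ K p -> phi p = 0].

Definition is_weak_deriv (R : realType) (Om : set (R * R)) (i j : nat)
    (v g : R * R -> R[i]) : Prop :=
  in_L2 area Om g /\
  forall phi, test_fun Om phi ->
    cintegral area Om (fun p => v p * (pderiv i j phi p)%:C) =
    (-1) ^+ (i + j) * cintegral area Om (fun p => g p * (phi p)%:C).

(* The weak derivative of v of order i in y and j in theta; it is meaningful
   (and unique up to a.e. equality) only if v has one in L^2. *)
Definition wderiv (R : realType) (Om : set (R * R)) (i j : nat)
    (v : R * R -> R[i]) : R * R -> R[i] :=
  xget (fun=> 0) [set g | is_weak_deriv Om i j v g].

Definition in_H (R : realType) (Om : set (R * R)) (m : nat)
    (v : R * R -> R[i]) : Prop :=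
  in_L2 area Om v /\
  forall i j, (i + j <= m)%N -> exists g, is_weak_deriv Om i j v g.

(* To be used on elements of H^m only. *)
Definition Hnorm (R : realType) (Om : set (R * R)) (m : nat)
    (v : R * R -> R[i]) : R :=
  Num.sqrt (\sum_(i < m.+1) \sum_(j < m.+1 | (i + j <= m)%N)
              L2norm area Om (wderiv Om i j v) ^+ 2).

(** * Traces *)

(* The trace of v on the boundary segment t |-> gam t, t in J, is the value at v
   of the continuous extension to H^1 of the restriction of smooth functions. *)
Definition is_trace (R : realType) (Om : set (R * R)) (gam : R -> R * R)
    (J : set R) (v : R * R -> R[i]) (g : R -> R[i]) : Prop :=
  [/\ in_H Om 1 v, in_L2 lebesgue_measure J g
    & exists phi : nat -> R * R -> R[i],
      [/\ forall n, csmooth (phi n),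
          Hnorm Om 1 (fun p => phi n p - v p) @[n --> \oo] --> (0 : R)
        & L2norm lebesgue_measure J (fun t => phi n (gam t) - g t)
            @[n --> \oo] --> (0 : R)]].

Definition trace (R : realType) (Om : set (R * R)) (gam : R -> R * R)
    (J : set R) (v : R * R -> R[i]) : R -> R[i] :=
  xget (fun=> 0) [set g | is_trace Om gam J v g].

(** * The rectangle (0,1) x (tmin,tmax) *)

Definition rect (R : realType) (tmin tmax : R) : set (R * R) :=
  [set p | 0 < p.1 < 1 /\ tmin < p.2 < tmax].

Definition crect (R : realType) (tmin tmax : R) : set (R * R) :=
  [set p | 0 <= p.1 <= 1 /\ tmin <= p.2 <= tmax].

(* The space written H~^1_0: no condition on the side y = 1. *)
Definition in_H10 (R : realType) (tmin tmax : R) (v : R * R -> R[i]) : Prop :=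
  let Om := rect tmin tmax in
  [/\ in_H Om 1 v,
      is_trace Om (fun t => (0, t)) `]tmin, tmax[ v (fun=> 0),
      is_trace Om (fun y => (y, tmin)) `]0, 1[ v (fun=> 0)
    & is_trace Om (fun y => (y, tmax)) `]0, 1[ v (fun=> 0)].

(* The boundary value theta |-> v(1, theta). *)
Definition trace1 (R : realType) (tmin tmax : R) (v : R * R -> R[i]) :
    R -> R[i] :=
  trace (rect tmin tmax) (fun t => (1, t)) `]tmin, tmax[ v.

Definition ip (R : realType) (tmin tmax : R) (v w : R * R -> R[i]) : R[i] :=
  cintegral area (rect tmin tmax) (fun p => v p * (w p)^*%C).

(** * The sesquilinear form *)

Definition posdef (R : realType) (M : 'M[R]_2) : Prop :=
  forall x : 'cV[R]_2, x != 0 -> 0 < (x^T *m M *m x) 0 0.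

(* For D symmetric with positive determinant on a connected set, "not
   everywhere positive definite" means "everywhere negative definite". *)
Definition sigma (R : realType) (rmin rmax tmin tmax : R)
    (D : R -> R * R -> 'M[R]_2) : R :=
  if `[< forall r p, rmin <= r <= rmax -> crect tmin tmax p -> posdef (D r p) >]
  then 1 else -1.

Definition grad (R : realType) (tmin tmax : R) (v : R * R -> R[i])
    (p : R * R) : 'cV[R[i]]_2 :=
  let Om := rect tmin tmax in
  \col_(k < 2) if k == 0 then wderiv Om 1 0 v p else wderiv Om 0 1 v p.

Definition Bform (R : realType) (rmin rmax tmin tmax : R)
    (D : R -> R * R -> 'M[R]_2) (b1 b2 : R -> R * R -> R)
    (lam : R -> R -> R[i]) (delta : R) (r : R) (v w : R * R -> R[i]) : R[i] :=
  let Om := rect tmin tmax in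
  let gv := grad tmin tmax v in
  let gw := grad tmin tmax w in
  (sigma rmin rmax tmin tmax D)%:C *
    (cintegral area Om (fun p =>
       ((map_mx conjc (gw p))^T *m (map_mx (real_complex R) (D r p) *m gv p)) 0 0)
     - 'i%C * (cintegral lebesgue_measure `]tmin, tmax[
               (fun t => lam r t * trace1 tmin tmax v t
                         * (trace1 tmin tmax w t)^*%C)
             - ip tmin tmax
                 (fun p => (b1 r p)%:C * gv p 0 0 + (b2 r p)%:C * gv p 1 0) w))
  + delta%:C * ip tmin tmax v w.

(** * Finite element spaces *)

Definition diam (R : realType) (K : set (R * R)) : R :=
  sup [set Num.sqrt ((p.1 - q.1) ^+ 2 + (p.2 - q.2) ^+ 2) | p in K & q in K].

(* A partition into finitely many open elements (up to the null set formed by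
   the interfaces), of mesh size h = max diam. *)
Definition is_partition (R : realType) (Om : set (R * R)) (h : R) (n : nat)
    (K : 'I_n -> set (R * R)) : Prop :=
  [/\ forall i, [/\ open (K i), K i !=set0 & K i `<=` Om],
      trivIset setT K,
      area.-negligible (Om `\` \bigcup_i K i),
      forall i, diam (K i) <= h
    & exists i, diam (K i) = h].

Definition poly_on (R : realType) (tau : nat) (K : set (R * R))
    (f : R * R -> R[i]) : Prop :=
  exists c : nat -> nat -> R[i], forall p, K p ->
    f p = \sum_(i < tau.+1) \sum_(j < tau.+1 | (i + j <= tau)%N)
            c i j * (p.1 ^+ i * p.2 ^+ j)%:C.

Definition is_fe_space (R : realType) (tmin tmax : R) (tau : nat) (h : R)
    (S : set (R * R -> R[i])) : Prop :=
  let Om := rect tmin tmax in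
  [/\ S `<=` in_H10 tmin tmax,
      S (fun=> 0) /\
        (forall (a : R[i]) u w, S u -> S w -> S (fun p => a * u p + w p)),
      exists (N : nat) (e : 'I_N -> R * R -> R[i]), forall u, S u ->
        exists c : 'I_N -> R[i],
          {ae area, forall p, Om p -> u p = \sum_k c k * e k p}
    & exists (n : nat) (K : 'I_n -> set (R * R)),
        is_partition Om h K /\ forall u, S u -> forall i, poly_on tau (K i) u].

Definition approx_property (R : realType) (tmin tmax : R) (tau : nat)
    (hstar : R) (S : R -> set (R * R -> R[i])) : Prop :=
  let Om := rect tmin tmax in
  exists C : R, forall h, 0 < h <= hstar -> forall s, (s <= tau)%N ->
    forall v, in_H Om s.+1 v -> in_H10 tmin tmax v ->
    inf [set L2norm area Om (fun p => v p - chi p)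
             + h * Hnorm Om 1 (fun p => v p - chi p) | chi in S h]
      <= C * h ^+ s.+1 * Hnorm Om s.+1 v.

Definition inverse_property (R : realType) (tmin tmax : R)
    (hstar : R) (S : R -> set (R * R -> R[i])) : Prop :=
  let Om := rect tmin tmax in
  exists C : R, forall h, 0 < h <= hstar -> forall phi, S h phi ->
    Hnorm Om 1 phi <= C * h^-1 * L2norm area Om phi.

(* The element of S having the same image as v under the form B, tested
   on S. *)
Definition galerkin_proj (R : realType)
    (B : (R * R -> R[i]) -> (R * R -> R[i]) -> R[i])
    (S : set (R * R -> R[i])) (v : R * R -> R[i]) : R * R -> R[i] :=
  xget (fun=> 0) [set u | S u /\ forall phi, S phi -> B u phi = B v phi].

(** * Differentiability of curves with values in H^m *)

(* F : I -> H^m has derivative w at r, relative to I (one-sided at the end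
   points of an interval I). *)
Definition has_deriv_H (R : realType) (Om : set (R * R)) (m : nat) (I : set R)
    (F : R -> R * R -> R[i]) (r : R) (w : R * R -> R[i]) : Prop :=
  [/\ forall s, I s -> in_H Om m (F s),
      in_H Om m w
    & Hnorm Om m (fun p => ((s - r)^-1)%:C * (F s p - F r p) - w p)
        @[s --> within I (r^')] --> (0 : R)].

(* F is in C^1(I, H^m cap H~^1_0), with derivative dF. *)
Definition C1_H_H10 (R : realType) (tmin tmax : R) (m : nat) (I : set R)
    (F dF : R -> R * R -> R[i]) : Prop :=
  let Om := rect tmin tmax in
  [/\ forall r, I r -> in_H10 tmin tmax (F r) /\ in_H10 tmin tmax (dF r),
      forall r, I r -> has_deriv_H Om m I F r (dF r)
    & forall r, I r ->
        Hnorm Om m (fun p => dF s p - dF r p)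
          @[s --> within I (nbhs r)] --> (0 : R)].

(* Main.v *)
Require Import Defs.
From HB Require Import structures.
From mathcomp Require Import all_boot all_order all_algebra.
From mathcomp Require Import all_classical all_reals all_analysis.
From mathcomp.real_closed Require Import complex.
From mathcomp Require Import measurable_realfun ring lra.
Set Implicit Arguments.
Unset Strict Implicit.
Unset Printing Implicit Defensive.
Import Order.TTheory GRing.Theory Num.Theory numFieldNormedType.Exports.
Local Open Scope classical_set_scope.
Local Open Scope complex_scope.
Local Open Scope ring_scope.

(** For fixed h, write e(s) = R_h(s) v(s) - v(s).  The definition of R_h says
    that B(s; e(s), phi) = 0 for phi in S_h; differentiation in s gives
      B(r; e'(r), phi) = - B'(r; e(r), phi),  phi in S_h,
    where B' is the form whose coefficients are the r-derivatives of those of B.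
    Since e'(r) + v'(r) lies in S_h, coercivity bounds e'(r) in H^1, as in
    Cea's lemma, by the distance of v'(r) to S_h plus the norm of e(r), and
    Cea's lemma bounds e(r) by the distance of v(r) to S_h.  The approximation
    property bounds both distances by C h^tau.

    This argument is carried out in galerkin_deriv for abstract sesquilinear
    forms: the equation above is solved in S_h by galerkin_solve, its solution
    gives a candidate for e'(r), and coercivity at s bounds the distance from
    the difference quotient of e to the candidate by the corresponding
    distance for v, plus a multiple of |s - r|.  This requires that B be
    bounded on H^1 and differentiable in r with a uniform quadratic remainder.
    A form with a weight c(r, .) inherits both properties from c
    (weighted_form_family), and a smooth weight on a compact set has them by
    Taylor's formula (coefficient_bounds); Bform_family assembles the terms
    of B.

    The forms are defined through chosen representatives of weak derivatives
    and traces, so two classical facts carry the linearity and the boundedness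
    of these choices.  Weak derivatives are unique almost everywhere by the
    fundamental lemma of the calculus of variations (fundamental_lemma), proved
    with bump functions built from exp(-1/x) and a Dynkin argument.  The trace
    on y = 1 is given by the formula
      v(1, t) = int_0^1 (v + y v_y)(y, t) dy,
    which holds for smooth v and is continuous from H^1 to L^2 (trace_op); it
    yields existence, uniqueness, linearity and the trace inequality at
    once. *)

(** * Real and imaginary parts *)

Section complex_parts.
Variable R : rcfType.
Implicit Types x y : R[i].

Lemma cReD x y : complex.Re (x + y) = complex.Re x + complex.Re y.
Proof. by case: x y => [? ?] [? ?]. Qed.

Lemma cImD x y : complex.Im (x + y) = complex.Im x + complex.Im y.
Proof. by case: x y => [? ?] [? ?]. Qed.

Lemma cReN x : complex.Re (- x) = - complex.Re x.
Proof. by case: x. Qed.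

Lemma cReM x y : complex.Re (x * y) =
  complex.Re x * complex.Re y - complex.Im x * complex.Im y.
Proof. by case: x y => [? ?] [? ?]. Qed.

Lemma cImM x y : complex.Im (x * y) =
  complex.Re x * complex.Im y + complex.Im x * complex.Re y.
Proof. by case: x y => [? ?] [? ?]. Qed.

Lemma complex_eqP x y :
  complex.Re x = complex.Re y -> complex.Im x = complex.Im y -> x = y.
Proof. by case: x y => [? ?] [? ?] /= -> ->. Qed.

End complex_parts.

(** * Galerkin approximation for a parameter-dependent coercive form *)

Section Galerkin.
Variables (R : realType) (V : lmodType R[i]).

Definition subspace (H : set V) : Prop :=
  H 0 /\ forall (a : R[i]) u w, H u -> H w -> H (a *: u + w).

Definition sesquilinear_on (H : set V) (B : V -> V -> R[i]) : Prop :=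
  (forall a u v w, H u -> H v -> H w -> B (a *: u + v) w = a * B u w + B v w) /\
  (forall a u v w, H u -> H v -> H w ->
     B w (a *: u + v) = a^*%C * B w u + B w v).

Definition antilinear_on (H : set V) (F : V -> R[i]) : Prop :=
  forall a u v, H u -> H v -> F (a *: u + v) = a^*%C * F u + F v.

(** A seminorm up to the factor 2 in the triangle inequality, which costs
    nothing in estimates whose constants are unspecified. *)
Definition quasinorm_on (H : set V) (N : V -> R) : Prop :=
  [/\ forall v, H v -> 0 <= N v,
      forall a v, H v -> N (a *: v) = Num.sqrt (sqmod a) * N v
    & forall u v, H u -> H v -> N (u + v) <= 2 * (N u + N v)].

(** Only real parts are bounded: replacing v by a unimodular multiple of v
    recovers a bound on the modulus. *)
Definition bounded_on (H : set V) (N : V -> R) (M : R) (B : V -> V -> R[i]) :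
    Prop :=
  forall v w, H v -> H w -> complex.Re (B v w) <= M * N v * N w.

(** Finite dimension modulo the null vectors of N. *)
Definition findim_on (S : set V) (N : V -> R) : Prop :=
  exists n, forall u : 'I_n.+1 -> V, (forall i, S (u i)) ->
    exists2 c : 'I_n.+1 -> R[i],
      exists i, c i != 0 & N (\sum_i c i *: u i) = 0.

Lemma subspaceZ H (a : R[i]) u : subspace H -> H u -> H (a *: u).
Proof. by move=> [H0 HD] Hu; rewrite -[_ *: _]addr0; apply: HD. Qed.

Lemma subspaceD H u v : subspace H -> H u -> H v -> H (u + v).
Proof. by move=> [H0 HD] Hu Hv; rewrite -[u]scale1r; apply: HD. Qed.

Lemma subspaceN H u : subspace H -> H u -> H (- u).
Proof. by move=> sH Hu; rewrite -scaleN1r; apply: subspaceZ. Qed.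

Lemma subspaceB H u v : subspace H -> H u -> H v -> H (u - v).
Proof. by move=> sH Hu Hv; apply: subspaceD => //; apply: subspaceN. Qed.

Lemma subspace_sum H (I : Type) (r : seq I) (c : I -> R[i]) (u : I -> V) :
  subspace H -> (forall i, H (u i)) -> H (\sum_(i <- r) c i *: u i).
Proof.
move=> sH Hu; elim/big_ind : _ => [|x y Hx Hy|i _]; first by case: sH.
- exact: subspaceD.
- exact: subspaceZ.
Qed.

Lemma antilinear_onZ H F a u : subspace H -> antilinear_on H F -> H u ->
  F (a *: u) = a^*%C * F u.
Proof.
move=> sH aF Hu; have H0 : H 0 by case: sH.
have F0 : F 0 = 0.
  have := aF 1 _ _ H0 H0; rewrite scaler0 addr0 conjc1 mul1r.
  by move/eqP; rewrite -subr_eq subrr eq_sym => /eqP.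
by rewrite -[_ *: _]addr0 aF// F0 addr0.
Qed.

Lemma antilinear_on_sum H F (I : Type) (r : seq I) (c : I -> R[i]) (u : I -> V) :
  subspace H -> antilinear_on H F -> (forall i, H (u i)) ->
  F (\sum_(i <- r) c i *: u i) = \sum_(i <- r) (c i)^*%C * F (u i).
Proof.
move=> sH aF Hu; have H0 : H 0 by case: sH.
elim: r => [|i r IH].
  by rewrite !big_nil -(scale0r (0 : V)) (antilinear_onZ _ sH)// conjc0 mul0r.
by rewrite !big_cons aF ?IH//; apply: subspace_sum.
Qed.

Lemma sesquilinear_onZ H B a u w : subspace H -> sesquilinear_on H B ->
  H u -> H w -> B (a *: u) w = a * B u w.
Proof.
move=> sH [lB _] Hu Hw; have H0 : H 0 by case: sH.
have B0 : B 0 w = 0.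
  have := lB 1 _ _ _ H0 H0 Hw; rewrite scaler0 addr0 mul1r.
  by move/eqP; rewrite -subr_eq subrr eq_sym => /eqP.
by rewrite -[_ *: _]addr0 lB// B0 addr0.
Qed.

Lemma sesquilinear_onN H B u w : subspace H -> sesquilinear_on H B ->
  H u -> H w -> B (- u) w = - B u w.
Proof.
by move=> sH sB Hu Hw; rewrite -scaleN1r (sesquilinear_onZ _ sH)// mulN1r.
Qed.

Lemma sesquilinear_onB H B u v w : subspace H -> sesquilinear_on H B ->
  H u -> H v -> H w -> B (u - v) w = B u w - B v w.
Proof.
move=> sH sB Hu Hv Hw.
rewrite -[u in LHS]scale1r sB.1//; last exact: subspaceN.
by rewrite mul1r (sesquilinear_onN sH sB).
Qed.

Lemma sesquilinear_on_sum H B (I : Type) (r : seq I) (c : I -> R[i])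
    (u : I -> V) w :
  subspace H -> sesquilinear_on H B -> (forall i, H (u i)) -> H w ->
  B (\sum_(i <- r) c i *: u i) w = \sum_(i <- r) c i * B (u i) w.
Proof.
move=> sH sB Hu Hw; have H0 : H 0 by case: sH.
elim: r => [|i r IH].
  by rewrite !big_nil -(scale0r (0 : V)) (sesquilinear_onZ _ sH)// mul0r.
by rewrite !big_cons sB.1 ?IH//; apply: subspace_sum.
Qed.

Lemma sesquilinear_antilinear H B v : sesquilinear_on H B -> H v ->
  antilinear_on H (B v).
Proof. by move=> [_ aB] Hv a u w Hu Hw; rewrite aB. Qed.

Lemma quasinormN H N v : quasinorm_on H N -> H v -> N (- v) = N v.
Proof.
move=> [_ NZ _] Hv; rewrite -scaleN1r NZ// /sqmod /=.
by rewrite oppr0 sqrrN expr1n expr0n addr0 sqrtr1 mul1r.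
Qed.

Lemma quasinormB H N u v : subspace H -> quasinorm_on H N -> H u -> H v ->
  N (u - v) <= 2 * (N u + N v).
Proof.
move=> sH qN Hu Hv; rewrite -[in X in _ <= X](quasinormN qN Hv).
by case: qN => _ _; apply => //; apply: subspaceN.
Qed.

Lemma conjc_i : ('i%C)^*%C = - 'i%C :> R[i].
Proof. by rewrite -[RHS]/(- 0 +i* - 1) oppr0. Qed.

Lemma eq0_Re_le0 (z : R[i]) : complex.Re z <= 0 -> complex.Re (- z) <= 0 ->
  complex.Re ('i%C * z) <= 0 -> complex.Re (- ('i%C * z)) <= 0 -> z = 0.
Proof.
case: z => a b /=; rewrite !mul0r !mul1r !sub0r opprK => a0 Na0 b0 Nb0.
by congr Complex; lra.
Qed.

(** The one-sided bound on real parts, applied to the multiples of v by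
    1, -1, i and -i, forces both parts of F v to vanish. *)
Lemma antilinear_null H N F M v : subspace H -> quasinorm_on H N ->
  antilinear_on H F -> (forall w, H w -> complex.Re (F w) <= M * N w) ->
  H v -> N v = 0 -> F v = 0.
Proof.
move=> sH qN aF FM Hv Nv0.
have NZ a : N (a *: v) = 0 by case: qN => _ + _ => ->//; rewrite Nv0 mulr0.
have FZ a : complex.Re (a^*%C * F v) <= 0.
  rewrite -(antilinear_onZ _ sH)//; apply: le_trans (FM _ _) _.
    exact: subspaceZ.
  by rewrite NZ mulr0.
apply: eq0_Re_le0.
- by have := FZ 1; rewrite rmorph1 mul1r.
- by have := FZ (-1); rewrite rmorphN rmorph1 mulN1r.
- by have := FZ (- 'i%C); rewrite -conjc_i conjcK.
- by have := FZ ('i%C); rewrite conjc_i mulNr.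
Qed.

(** The discrete Lax-Milgram lemma.  In a maximal family of elements of S that
    is free modulo null vectors, the Gram matrix of the form is invertible by
    coercivity, and the family spans S modulo null vectors by maximality. *)
Lemma galerkin_solve (H S : set V) N B F M MF c :
  subspace H -> subspace S -> S `<=` H -> quasinorm_on H N ->
  findim_on S N -> sesquilinear_on H B -> bounded_on H N M B ->
  0 < c -> (forall v, S v -> c * N v ^+ 2 <= complex.Re (B v v)) ->
  antilinear_on S F -> (forall w, S w -> complex.Re (F w) <= MF * N w) ->
  exists2 u, S u & forall phi, S phi -> B u phi = F phi.
Proof.
move=> sH sS SH qN [n0 fin] sB bB c0 coer aF bF.
have qNS : quasinorm_on S N.
  case: qN => N0 NZ ND; split => [v /SH/N0//|a v /SH/NZ//|u v /SH Hu /SH].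
  exact: ND.
have coer0 v : S v -> B v v = 0 -> N v = 0.
  move=> Sv Bv0; have := coer v Sv; rewrite Bv0 /= => h.
  have : N v ^+ 2 <= 0 by rewrite -(ler_pM2l c0) mulr0.
  by rewrite le_eqVlt ltNge sqr_ge0 orbF sqrf_eq0 => /eqP.
pose free n := exists2 u : 'I_n -> V, forall i, S (u i) &
  forall a : 'I_n -> R[i], N (\sum_i a i *: u i) = 0 -> forall i, a i = 0.
have free0 : exists n, `[< free n >].
  by exists 0%N; apply/asboolP; exists (fun=> 0) => [i|a _ i]; case: i.
have freeM n : `[< free n >] -> (n <= n0)%N.
  move/asboolP => [u Su fu]; rewrite leqNgt; apply/negP => nn0.
  have [a [i ai0] Na] := fin (fun i => u (widen_ord nn0 i)) (fun i => Su _).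
  pose a' (j : 'I_n) := if insub (val j) is Some k then a k else 0.
  have a'E (k : 'I_n0.+1) : a' (widen_ord nn0 k) = a k.
    rewrite /a'; case: insubP => [k' _ /= kk'|/=]; last by rewrite ltn_ord.
    by congr a; apply: val_inj.
  have : N (\sum_j a' j *: u j) = 0.
    rewrite -Na; congr N.
    rewrite (bigID (fun j : 'I_n => (j < n0.+1)%N)) /= [X in _ + X]big1 ?addr0.
      rewrite (big_ord_narrow nn0); apply: eq_bigr => k _.
      by rewrite a'E.
    by move=> j jn; rewrite /a' insubF ?scale0r//; apply/negbTE.
  move/fu => /(_ (widen_ord nn0 i)); rewrite a'E => ai.
  by rewrite ai eqxx in ai0.
case: (ex_maxnP free0 freeM) => n /asboolP[u Su fu] maxn {free0 freeM}.
have Hu i : H (u i) by apply: SH.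
pose G : 'M[R[i]]_n := \matrix_(j, i) B (u j) (u i).
have BuE (x : 'rV_n) i : B (\sum_j x 0 j *: u j) (u i) = (x *m G) 0 i.
  rewrite (sesquilinear_on_sum _ _ sH)// !mxE; apply: eq_bigr => j _.
  by rewrite !mxE.
have Gu : row_free G.
  apply/inj_row_free => x xG; apply/rowP => i; rewrite mxE.
  apply: (fu (fun j => x 0 j)); apply: coer0.
    exact: subspace_sum.
  have Hx : H (\sum_j x 0 j *: u j) by exact: subspace_sum.
  rewrite (antilinear_on_sum _ _ sH (sesquilinear_antilinear sB Hx))//.
  by rewrite big1// => j _; rewrite BuE xG mxE mulr0.
have Gunit : G \in unitmx by rewrite -row_free_unit.
pose x := (\row_i F (u i)) *m invmx G.
exists (\sum_j x 0 j *: u j); first exact: subspace_sum.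
move=> phi Sphi; have Hphi := SH _ Sphi.
have Bu i : B (\sum_j x 0 j *: u j) (u i) = F (u i).
  by rewrite BuE /x mulmxKV// mxE.
set U := \sum_j _ in Bu *.
have HU : H U by exact: subspace_sum.
have SU : S U by exact: subspace_sum.
(* maximality expresses phi in terms of the family *)
have [d Nd] : exists d : 'I_n -> R[i], N (phi - \sum_j d j *: u j) = 0.
  apply: contrapT => nod.
  have : `[< free n.+1 >]; last by move/maxn; rewrite ltnn.
  apply/asboolP; exists (fun i => oapp u phi (unlift ord0 i)).
    by move=> i; case: unliftP => [j _ /=|_ /=]; [exact: Su|].
  move=> a; rewrite big_ord_recl unlift_none /=.
  under eq_bigr do rewrite liftK /=.
  move=> Na; have [a0|a0] := eqVneq (a ord0) 0.
    rewrite a0 scale0r add0r in Na.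
    have al := fu _ Na.
    by move=> i; case: (unliftP ord0 i) => [j ->|->].
  exfalso; apply: nod; exists (fun j => - (a ord0)^-1 * a (lift ord0 j)).
  set T := \sum_j _ in Na.
  have ST : S T by exact: subspace_sum.
  have -> : phi - \sum_j (- (a ord0)^-1 * a (lift ord0 j)) *: u j =
            (a ord0)^-1 *: (a ord0 *: phi + T).
    rewrite scalerDr scalerA mulVf// scale1r; congr (_ + _).
    rewrite scaler_sumr -sumrN; apply: eq_bigr => j _.
    by rewrite scalerA mulNr scaleNr opprK.
  have SaT : S (a ord0 *: phi + T).
    by apply: (subspaceD sS) => //; apply: subspaceZ.
  by case: qNS => _ NZ _; rewrite NZ// Na mulr0.
set W := \sum_j _ in Nd.
have SW : S W by exact: subspace_sum.
have kill K M' : antilinear_on S K ->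
    (forall w, S w -> complex.Re (K w) <= M' * N w) -> K phi = K W.
  move=> aK bK; have SpW : S (phi - W) by exact: subspaceB.
  have := antilinear_null sS qNS aK bK SpW Nd.
  rewrite addrC -[X in X + _]scaleN1r aK// rmorphN rmorph1 mulN1r addrC.
  by move/eqP; rewrite subr_eq0 => /eqP.
have aBU : antilinear_on S (B U).
  by move=> a v w Sv Sw; rewrite sB.2//; apply: SH.
rewrite (kill (B U) (M * N U))//; last by move=> w /SH Hw; apply: bB.
rewrite (kill F MF)// !(antilinear_on_sum _ _ sS)//.
by apply: eq_bigr => j _; rewrite Bu.
Qed.

Lemma absorb (c a x : R) : 0 < c -> 0 <= a -> 0 <= x ->
  c * x ^+ 2 <= a * x -> x <= a / c.
Proof.
move=> c0 a0; rewrite le_eqVlt => /orP[/eqP <- _|x0].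
  by rewrite divr_ge0// ltW.
by rewrite expr2 mulrA ler_pM2r// mulrC -ler_pdivlMr.
Qed.

Section cea.
Variables (H S : set V) (N : V -> R) (M c : R).
Hypotheses (sH : subspace H) (sS : subspace S) (SH : S `<=` H).
Hypothesis qN : quasinorm_on H N.
Hypotheses (M0 : 0 <= M) (c0 : 0 < c).

(** Coercivity is applied to u - chi, which lies in S, where the forms of u and
    of v agree. *)
Lemma cea (B : V -> V -> R[i]) u v chi :
  sesquilinear_on H B -> bounded_on H N M B ->
  (forall v, H v -> c * N v ^+ 2 <= complex.Re (B v v)) ->
  S u -> H v -> (forall phi, S phi -> B u phi = B v phi) -> S chi ->
  N (u - v) <= 2 * (M / c + 1) * N (v - chi).
Proof.
move=> sB bB cB Su Hv Buv Schi; have Hu := SH Su; have Hchi := SH Schi.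
have Hvc : H (v - chi) by exact: subspaceB.
have Huc : H (u - chi) by exact: subspaceB.
have [N0 _ _] := qN.
have h : N (u - chi) <= M * N (v - chi) / c.
  apply: absorb => //; [exact/mulr_ge0/N0|exact: N0|].
  apply: le_trans (cB _ Huc) _.
  rewrite (sesquilinear_onB sH)// Buv; last exact: subspaceB.
  by rewrite -(sesquilinear_onB sH)//; exact: bB.
have -> : u - v = (u - chi) - (v - chi) by rewrite opprB addrA subrK.
apply: le_trans (quasinormB sH qN Huc Hvc) _.
rewrite -mulrA ler_pM2l// mulrDl mul1r lerD2r; apply: le_trans h _.
by rewrite mulrAC.
Qed.

(** The error e(s) = P(s) - v(s) satisfies B(s; e(s), phi) = 0 on S, and
    differentiating in s gives the equation
    B(r; w, phi) = - Bd(r; e(r), phi) for w = e'(r); the part wS of w in S is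
    defined by this equation.  Coercivity then bounds w as in Cea's lemma, and
    bounds the difference quotients of e minus w by those of v minus dv. *)
Lemma galerkin_deriv (I : set R) (B : R -> V -> V -> R[i])
    (Bd : V -> V -> R[i]) (Md K : R) (ell : R) (v P : R -> V) (dv : V) (r : R) :
  findim_on S N -> 0 <= Md -> 0 <= K -> I r ->
  (forall s, I s -> `|s - r| <= ell) ->
  (forall s, I s -> sesquilinear_on H (B s)) ->
  (forall s, I s -> bounded_on H N M (B s)) ->
  (forall s v, I s -> H v -> c * N v ^+ 2 <= complex.Re (B s v v)) ->
  sesquilinear_on H Bd -> bounded_on H N Md Bd ->
  (forall s, I s -> s != r -> bounded_on H N (K * `|s - r|)
     (fun v w => ((s - r)^-1)%:C * (B s v w - B r v w) - Bd v w)) ->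
  (forall s, I s -> H (v s)) -> H dv ->
  (forall s, I s -> S (P s)) ->
  (forall s, I s -> forall phi, S phi -> B s (P s) phi = B s (v s) phi) ->
  exists wS, [/\ S wS,
    exists2 K', 0 <= K' & forall s, I s -> s != r ->
      N (((s - r)^-1)%:C *: ((P s - v s) - (P r - v r)) - (wS - dv)) <=
      K' * (`|s - r| + N (((s - r)^-1)%:C *: (v s - v r) - dv))
    & forall chi chi', S chi -> S chi' ->
      N (wS - dv) <= 2 * (M / c + 1) * N (dv - chi) +
        2 * (Md * (2 * (M / c + 1)) / c) * N (v r - chi')].
Proof.
move=> fin Md0 K0 Ir Iell sB bB cB sBd bBd dB Hv Hdv SP PB.
have N0 : forall v, H v -> 0 <= N v by case: qN.
have HP s : I s -> H (P s) by move=> /SP/SH.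
have Her : H (P r - v r) by apply: subspaceB => //; [exact: HP|exact: Hv].
have Ber phi : S phi -> B r (P r - v r) phi = 0.
  move=> Sphi; have Hphi := SH Sphi.
  by rewrite (sesquilinear_onB sH (sB _ Ir) (HP _ Ir) (Hv _ Ir))// PB// subrr.
have [wS SwS wSE] : exists2 wS, S wS &
    forall phi, S phi -> B r wS phi = B r dv phi - Bd (P r - v r) phi.
  apply: (galerkin_solve (M := M) (MF := M * N dv + Md * N (P r - v r)) sH sS
    SH qN fin (sB _ Ir) (bB _ Ir) c0).
  - by move=> u /SH; exact: cB.
  - move=> a u w /SH Hu /SH Hw; rewrite (sB _ Ir).2// sBd.2//; ring.
  - move=> w /SH Hw; rewrite cReD cReN mulrDl; apply: lerD; first exact: bB.
    have := bBd _ _ (subspaceN sH Her) Hw.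
    by rewrite (sesquilinear_onN sH)// cReN (quasinormN qN).
exists wS; have HwS := SH SwS; split => //; last first.
  move=> chi chi' Schi Schi'; have Hchi := SH Schi.
  have Hc : H (wS - chi) by exact: subspaceB.
  have Hdc : H (dv - chi) by exact: subspaceB.
  have ceae := cea (sB _ Ir) (bB _ Ir) (fun v => @cB r v Ir) (SP _ Ir) (Hv _ Ir)
    (PB _ Ir) Schi'.
  have Hvc' : H (v r - chi') by apply: subspaceB (SH _) => //; apply: Hv.
  have h : N (wS - chi) <= (M * N (dv - chi) + Md * N (P r - v r)) / c.
    apply: absorb => //; [|exact: N0|].
      by rewrite addr_ge0// mulr_ge0//; exact: N0.
    apply: le_trans (cB _ _ Ir Hc) _.
    rewrite (sesquilinear_onB sH (sB _ Ir))// wSE; last exact: subspaceB.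
    rewrite addrAC -(sesquilinear_onB sH (sB _ Ir))//.
    rewrite cReD cReN mulrDl; apply: lerD; first exact: bB.
    have := bBd _ _ (subspaceN sH Her) Hc.
    by rewrite (sesquilinear_onN sH)// cReN (quasinormN qN).
  have -> : wS - dv = (wS - chi) - (dv - chi) by rewrite opprB addrA subrK.
  apply: le_trans (quasinormB sH qN Hc Hdc) _.
  have {}h : N (wS - chi) <= M / c * N (dv - chi) +
      Md * (2 * (M / c + 1)) / c * N (v r - chi').
    apply: le_trans h _; rewrite mulrDl lerD//; first by rewrite mulrAC.
    rewrite -2!mulrA (mulrC _ (c^-1)) (mulrA _ (c^-1)) [leRHS]mulrA.
    rewrite (_ : Md * _ / c * _ = Md / c * (2 * (M / c + 1) * N (v r - chi'))).
      by rewrite ler_wpM2l// divr_ge0// ltW.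
    by ring.
  lra.
(* E - w splits into phi, which lies in S and is controlled by coercivity, and
   the error x of the difference quotient of v.  Since the error e(s) is
   orthogonal to S for the form at s, only increments of the form in its
   parameter remain. *)
set w := wS - dv; have Hw : H w by exact: subspaceB.
pose L := K * N (P r - v r) + (K * ell + Md) * N w + M.
have L0 : 0 <= L.
  by rewrite !addr_ge0 ?mulr_ge0 ?addr_ge0 ?N0// mulr_ge0// (le_trans _ (Iell _ Ir)).
exists (2 * (L / c + 1)).
  by rewrite mulr_ge0// addr_ge0// divr_ge0// ltW.
move=> s Is sr; have sr0 : s - r != 0 by rewrite subr_eq0.
set rho := ((s - r)^-1)%:C; set x := rho *: (v s - v r) - dv.
have rhoK : rho * (s - r)%:C = 1.
  by rewrite /rho -rmorphM mulVf//= rmorph1.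
have Hx : H x.
  apply: subspaceB => //; apply: subspaceZ => //.
  by apply: subspaceB => //; exact: Hv.
have Hes : H (P s - v s) by apply: subspaceB; [|exact: HP|exact: Hv].
set E := rho *: _.
have HE : H E by apply: subspaceZ => //; apply: subspaceB.
pose phi := rho *: (P s - P r) - wS.
have Sphi : S phi.
  apply: subspaceB => //; apply: subspaceZ => //.
  by apply: subspaceB => //; exact: SP.
have Hphi := SH Sphi.
have EwE : E - w = phi - x.
  have subACA (a b d e : V) : a - b - (d - e) = a - d - (b - e).
    by rewrite !opprD addrACA.
  by rewrite /E /w /phi /x subACA scalerBr subACA.
have Nphi : N phi <= L * (`|s - r| + N x) / c.
  apply: absorb => //; [by rewrite mulr_ge0// addr_ge0// N0|exact: N0|].
  apply: le_trans (cB _ _ Is Hphi) _.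
  (* with this u, the increment of the form at (w, phi) is Df u + Bd u *)
  pose u := (- (s - r)%:C) *: w.
  have Hu : H u by exact: subspaceZ.
  have Nu : N u = `|s - r| * N w.
    case: qN => _ -> // _; congr (_ * _).
    by rewrite /sqmod /= oppr0 expr0n addr0 sqrrN sqrtr_sqr.
  pose Df v w := rho * (B s v w - B r v w) - Bd v w.
  have -> : B s phi phi = Df (- (P r - v r)) phi + (Df u phi + Bd u phi) +
                          B s x phi.
    have -> : B s phi phi = B s (E - w) phi + B s x phi.
      have Hphx : H (phi - x) by exact: subspaceB.
      by rewrite EwE (sesquilinear_onB (u := phi) (v := x) sH (sB _ Is))// subrK.
    congr (_ + _).
    rewrite (sesquilinear_onB (u := E) (v := w) sH (sB _ Is))// /Df.
    have -> : B s E phi = - rho * B s (P r - v r) phi.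
      rewrite (sesquilinear_onZ _ sH (sB _ Is))//; last exact: subspaceB.
      rewrite (sesquilinear_onB sH (sB _ Is))//.
      rewrite [X in X - _](_ : _ = 0) ?sub0r ?mulrN ?mulNr//.
      rewrite (sesquilinear_onB sH (sB _ Is))// ?PB ?subrr//.
        exact: HP.
      exact: Hv.
    rewrite [in RHS]/u (sesquilinear_onN sH (sB _ Is) Her)//.
    rewrite (sesquilinear_onN sH (sB _ Ir) Her)// Ber// (sesquilinear_onN sH sBd)//.
    rewrite (sesquilinear_onZ _ sH (sB _ Is) Hw)//.
    rewrite (sesquilinear_onZ _ sH (sB _ Ir) Hw)//.
    have -> : B r w phi = - Bd (P r - v r) phi.
      by rewrite (sesquilinear_onB sH (sB _ Ir))// wSE// addrAC subrr sub0r.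
    rewrite subrK -mulrBr mulrA mulrN rhoK; ring.
  have h1 := dB _ Is sr _ _ (subspaceN sH Her) Hphi.
  have h2 := dB _ Is sr _ _ Hu Hphi.
  have h3 := bBd _ _ Hu Hphi.
  have h4 := bB _ Is _ _ Hx Hphi.
  rewrite !cReD.
  rewrite (quasinormN qN Her) in h1; rewrite Nu in h2 h3.
  have a0 : 0 <= `|s - r| by [].
  have a1 := Iell _ Is.
  have Nw0 := N0 _ Hw; have Nx0 := N0 _ Hx; have Ne0 := N0 _ Her.
  have Np0 := N0 _ Hphi.
  have := lerD (lerD h1 (lerD h2 h3)) h4.
  rewrite -!cReD => /le_trans; apply.
  rewrite -!mulrDl ler_wpM2r//.
  have p1 : 0 <= K * N (P r - v r) * N x by rewrite !mulr_ge0.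
  have p2 : 0 <= (K * ell + Md) * N w * N x.
    by rewrite !mulr_ge0// addr_ge0// mulr_ge0// (le_trans _ a1).
  have p3 : 0 <= M * `|s - r| by rewrite mulr_ge0.
  have p4 : K * `|s - r| * (`|s - r| * N w) <= K * ell * (`|s - r| * N w).
    by rewrite ler_wpM2r ?mulr_ge0// ler_wpM2l.
  rewrite /L; lra.
rewrite EwE; apply: le_trans (quasinormB sH qN Hphi Hx) _.
rewrite -[leRHS]mulrA ler_pM2l// mulrDl mul1r lerD//.
  by apply: le_trans Nphi _; rewrite mulrAC.
by rewrite lerDr.
Qed.

End cea.
End Galerkin.

(** * Complex-valued square-integrable functions *)

Section sqmod_theory.
Variable R : realType.
Implicit Types (x y : R[i]) (a b t k : R).

Lemma sqmod_ge0 x : 0 <= sqmod x.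
Proof. by rewrite addr_ge0// sqr_ge0. Qed.

Lemma sqmodM x y : sqmod (x * y) = sqmod x * sqmod y.
Proof. by rewrite /sqmod cReM cImM; ring. Qed.

Lemma sqmodJ x : sqmod x^*%C = sqmod x.
Proof. by case: x => a b; rewrite /sqmod /= sqrrN. Qed.

Lemma sqmodD_le x y : sqmod (x + y) <= 2 * (sqmod x + sqmod y).
Proof.
rewrite /sqmod cReD cImD.
have := sqr_ge0 (complex.Re x - complex.Re y).
have := sqr_ge0 (complex.Im x - complex.Im y).
nra.
Qed.

Lemma sqmod_real a : sqmod a%:C = a ^+ 2.
Proof. by rewrite /sqmod /= expr0n addr0. Qed.

Lemma Re_sqr_le x : complex.Re x ^+ 2 <= sqmod x.
Proof. by rewrite lerDl sqr_ge0. Qed.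

Lemma Im_sqr_le x : complex.Im x ^+ 2 <= sqmod x.
Proof. by rewrite lerDr sqr_ge0. Qed.

Lemma ler_sqr_imp a b : 0 <= b -> a ^+ 2 <= b ^+ 2 -> a <= b.
Proof.
move=> b0 ab; rewrite (le_trans (ler_norm _))//.
by rewrite -ler_sqr ?nnegrE// real_normK// num_real.
Qed.

Lemma young (t k a b z : R) : 0 < t -> 0 <= k -> 0 <= a -> 0 <= b ->
  z ^+ 2 <= k ^+ 2 * a * b -> 2 * `|z| <= k * (t * a + t^-1 * b).
Proof.
move=> t0 k0 a0 b0 h.
have ti0 : 0 < t^-1 by rewrite invr_gt0.
apply: ler_sqr_imp.
  by rewrite mulr_ge0// addr_ge0// mulr_ge0// ltW.
rewrite !exprMn real_normK ?num_real//.
have -> : (t * a + t^-1 * b) ^+ 2 = (t * a - t^-1 * b) ^+ 2 + 4 * (t / t) * a * b.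
  by ring.
rewrite divff ?gt_eqF// mulr1.
have := mulr_ge0 (sqr_ge0 k) (sqr_ge0 (t * a - t^-1 * b)).
lra.
Qed.

(** The choice t = b/a would give the product; adding s to both covers a = 0
    and b = 0. *)
Lemma young_mul (X k a b : R) : 0 <= k -> 0 <= a -> 0 <= b ->
  (forall t, 0 < t -> 2 * X <= k * (t * a ^+ 2 + t^-1 * b ^+ 2)) ->
  X <= k * a * b.
Proof.
move=> k0 a0 b0 h; apply/ler_addgt0Pr => e e0.
pose s := e / (1 + k * (a + b)).
have d0 : 0 < 1 + k * (a + b) by rewrite ltr_wpDr// mulr_ge0// addr_ge0.
have s0 : 0 < s by rewrite divr_gt0.
have as0 : 0 < a + s by rewrite ltr_wpDl.
have bs0 : 0 < b + s by rewrite ltr_wpDl.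
have := h _ (divr_gt0 bs0 as0); rewrite invf_div => {}h.
have h1 : (b + s) / (a + s) * a ^+ 2 <= (b + s) * a.
  rewrite -mulrA ler_pM2l// mulrC ler_pdivrMr// expr2 ler_wpM2l// lerDl.
  exact: ltW.
have h2 : (a + s) / (b + s) * b ^+ 2 <= (a + s) * b.
  rewrite -mulrA ler_pM2l// mulrC ler_pdivrMr// expr2 ler_wpM2l// lerDl.
  exact: ltW.
have h3 := ler_wpM2l k0 (lerD h1 h2).
have h4 : k * (a + b) * s <= e.
  rewrite /s mulrA ler_pdivrMr// mulrC ler_pM2l// lerDr//.
nra.
Qed.

End sqmod_theory.

Section L2.
Context d (T : measurableType d) (R : realType).
Variable mu : {measure set T -> \bar R}.
Variables (A : set T) (mA : measurable A).
Implicit Types (f g c u w : T -> R[i]) (k : R).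

Definition cmeasurable f :=
  measurable_fun A (fun x => complex.Re (f x)) /\
  measurable_fun A (fun x => complex.Im (f x)).

Definition cintegrable f :=
  mu.-integrable A (fun x => (complex.Re (f x))%:E) /\
  mu.-integrable A (fun x => (complex.Im (f x))%:E).

Lemma cmeasurableD f g : cmeasurable f -> cmeasurable g ->
  cmeasurable (fun x => f x + g x).
Proof.
move=> [rf jf] [rg jg]; split.
- under eq_fun do rewrite cReD; exact: measurable_funD.
- under eq_fun do rewrite cImD; exact: measurable_funD.
Qed.

Lemma cmeasurableM f g : cmeasurable f -> cmeasurable g ->
  cmeasurable (fun x => f x * g x).
Proof.
move=> [rf jf] [rg jg]; split.
- under eq_fun do rewrite cReM.
  by apply: measurable_funB; apply: measurable_funM.
- under eq_fun do rewrite cImM.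
  by apply: measurable_funD; apply: measurable_funM.
Qed.

Lemma cmeasurable_cst a : cmeasurable (fun=> a).
Proof. by split; exact: measurable_cst. Qed.

Lemma cmeasurableJ f : cmeasurable f -> cmeasurable (fun x => (f x)^*%C).
Proof.
move=> [rf jf]; split.
- by apply: eq_measurable_fun rf => x _; case: (f x).
- apply: (eq_measurable_fun (fun x => - complex.Im (f x))).
    by move=> x _; case: (f x).
  exact: measurable_funN.
Qed.

Lemma cmeasurable_sqmod f : cmeasurable f -> measurable_fun A (fun x => sqmod (f x)).
Proof. by move=> [rf jf]; apply: measurable_funD; apply: measurable_funX. Qed.

Lemma in_L2P f : in_L2 mu A f <->
  cmeasurable f /\ mu.-integrable A (fun x => (sqmod (f x))%:E).
Proof. by split=> [[]|[[]]]. Qed.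

Lemma le_integrable_real (f g : T -> R) : measurable_fun A f ->
  (forall x, A x -> `|f x| <= g x) -> mu.-integrable A (EFin \o g) ->
  mu.-integrable A (EFin \o f).
Proof.
move=> mf fg; apply: le_integrable => //; first exact/measurable_EFinP.
move=> x Ax /=; rewrite lee_fin; apply: le_trans (fg _ Ax) _.
exact: ler_norm.
Qed.

Lemma in_L2_le f (g : T -> R) : cmeasurable f ->
  (forall x, A x -> sqmod (f x) <= g x) -> mu.-integrable A (EFin \o g) ->
  in_L2 mu A f.
Proof.
move=> mf fg ig; apply/in_L2P; split => //.
apply: le_integrable_real ig; first exact: cmeasurable_sqmod.
by move=> x Ax; rewrite ger0_norm ?sqmod_ge0//; exact: fg.
Qed.

Lemma integrableD_real (f g : T -> R) : mu.-integrable A (EFin \o f) ->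
  mu.-integrable A (EFin \o g) -> mu.-integrable A (EFin \o (fun x => f x + g x)).
Proof. by move=> If Ig; apply: eq_integrable (integrableD mA If Ig). Qed.

Lemma integrableZ_real (k : R) (f : T -> R) : mu.-integrable A (EFin \o f) ->
  mu.-integrable A (EFin \o (fun x => k * f x)).
Proof. by move=> If; apply: eq_integrable (integrableZl mA k If). Qed.

Lemma in_L2_lin a u w : in_L2 mu A u -> in_L2 mu A w ->
  in_L2 mu A (fun x => a * u x + w x).
Proof.
move=> /in_L2P[mu' iu] /in_L2P[mw iw].
apply: (in_L2_le (g := fun x => 2 * (sqmod a * sqmod (u x) + sqmod (w x)))).
- apply: cmeasurableD => //; apply: cmeasurableM => //; exact: cmeasurable_cst.
- by move=> x Ax; rewrite -sqmodM sqmodD_le.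
- apply: integrableZ_real; apply: integrableD_real => //.
  exact: integrableZ_real.
Qed.

Lemma in_L2_0 : in_L2 mu A (fun=> 0).
Proof.
apply: (in_L2_le (g := fun=> 0)); first exact: cmeasurable_cst.
- by move=> x _; rewrite /sqmod /= expr0n addr0.
- exact: integrable0.
Qed.

Lemma in_L2Z a u : in_L2 mu A u -> in_L2 mu A (fun x => a * u x).
Proof.
move=> iu; have := in_L2_lin a iu in_L2_0.
by congr in_L2; apply/funext => x; rewrite addr0.
Qed.

Lemma in_L2D u w : in_L2 mu A u -> in_L2 mu A w -> in_L2 mu A (fun x => u x + w x).
Proof.
move=> iu iw; have := in_L2_lin 1 iu iw.
by congr in_L2; apply/funext => x; rewrite mul1r.
Qed.

Lemma in_L2B u w : in_L2 mu A u -> in_L2 mu A w -> in_L2 mu A (fun x => u x - w x).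
Proof.
move=> iu iw; have := in_L2_lin (-1) iw iu.
by congr in_L2; apply/funext => x; rewrite mulN1r addrC.
Qed.

Lemma L2norm_ge0 f : 0 <= L2norm mu A f.
Proof. exact: sqrtr_ge0. Qed.

Lemma L2norm_sqr f : L2norm mu A f ^+ 2 = \int[mu]_(x in A) sqmod (f x).
Proof. by rewrite sqr_sqrtr// Rintegral_ge0// => x _; exact: sqmod_ge0. Qed.

Lemma L2norm0 : L2norm mu A (fun=> 0) = 0.
Proof.
rewrite /L2norm; under eq_Rintegral do rewrite /sqmod /= expr0n addr0.
by rewrite /Rintegral integral0 sqrtr0.
Qed.

Lemma L2norm_sqrD u w : in_L2 mu A u -> in_L2 mu A w ->
  L2norm mu A (fun x => u x + w x) ^+ 2 <=
  2 * (L2norm mu A u ^+ 2 + L2norm mu A w ^+ 2).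
Proof.
move=> iu iw; rewrite !L2norm_sqr; case: (iu) (iw) => _ _ iu2 [_ _ iw2].
rewrite -RintegralD// -RintegralZl//; last exact: integrableD_real.
apply: le_Rintegral => //; first by case: (in_L2D iu iw).
- by apply: integrableZ_real; apply: integrableD_real.
- by move=> x Ax; exact: sqmodD_le.
Qed.

Lemma L2norm_sqrZ a u : in_L2 mu A u ->
  L2norm mu A (fun x => a * u x) ^+ 2 = sqmod a * L2norm mu A u ^+ 2.
Proof.
move=> [_ _ iu]; rewrite !L2norm_sqr -RintegralZl//.
by apply: eq_Rintegral => x _; rewrite sqmodM.
Qed.

Lemma cintegrable_lin a f g : cintegrable f -> cintegrable g ->
  cintegrable (fun x => a * f x + g x).
Proof.
move=> [rf jf] [rg jg]; split.
- under eq_fun do rewrite cReD cReM -mulNr; apply: integrableD_real => //.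
  by apply: integrableD_real; apply: integrableZ_real.
- under eq_fun do rewrite cImD cImM; apply: integrableD_real => //.
  by apply: integrableD_real; apply: integrableZ_real.
Qed.

Lemma cintegral_lin a f g : cintegrable f -> cintegrable g ->
  cintegral mu A (fun x => a * f x + g x) = a * cintegral mu A f + cintegral mu A g.
Proof.
move=> [rf jf] [rg jg]; apply: complex_eqP.
- rewrite cReD cReM /= -!RintegralZl// -RintegralB//; try exact: integrableZ_real.
  rewrite -RintegralD//; last first.
    under eq_fun do rewrite -mulNr.
    by apply: integrableD_real; apply: integrableZ_real.
  by apply: eq_Rintegral => x _; rewrite cReD cReM.
- rewrite cImD cImM /= -!RintegralZl// -RintegralD//; try exact: integrableZ_real.
  rewrite -RintegralD//; last by apply: integrableD_real; apply: integrableZ_real.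
  by apply: eq_Rintegral => x _; rewrite cImD cImM.
Qed.

Lemma eq_cintegral f g : (forall x, A x -> f x = g x) ->
  cintegral mu A f = cintegral mu A g.
Proof.
by move=> fg; congr Complex; apply: eq_Rintegral => x /set_mem Ax; rewrite fg.
Qed.

Lemma cintegralD f g : cintegrable f -> cintegrable g ->
  cintegral mu A (fun x => f x + g x) = cintegral mu A f + cintegral mu A g.
Proof.
move=> If Ig; rewrite -[in RHS](mul1r (cintegral mu A f)) -cintegral_lin//.
by apply: eq_cintegral => x _; rewrite mul1r.
Qed.

Lemma cintegrableD f g : cintegrable f -> cintegrable g ->
  cintegrable (fun x => f x + g x).
Proof.
move=> If Ig; have := cintegrable_lin 1 If Ig.
by congr cintegrable; apply/funext => x; rewrite mul1r.
Qed.

Lemma ae_Rintegral (f g : T -> R) : measurable_fun A f -> measurable_fun A g ->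
  {ae mu, forall x, A x -> f x = g x} ->
  \int[mu]_(x in A) f x = \int[mu]_(x in A) g x.
Proof.
move=> mf mg fg; congr fine; apply: ae_eq_integral => //.
- exact/measurable_EFinP.
- exact/measurable_EFinP.
- by apply: filterS fg => x + Ax => ->.
Qed.

Lemma ae_L2norm f g : cmeasurable f -> cmeasurable g ->
  {ae mu, forall x, A x -> f x = g x} -> L2norm mu A f = L2norm mu A g.
Proof.
move=> mf mg fg; congr Num.sqrt; apply: ae_Rintegral.
- exact: cmeasurable_sqmod.
- exact: cmeasurable_sqmod.
- by apply: filterS fg => x + Ax => ->.
Qed.

Lemma ae_cintegral f g : cmeasurable f -> cmeasurable g ->
  {ae mu, forall x, A x -> f x = g x} -> cintegral mu A f = cintegral mu A g.
Proof.
move=> [rf jf] [rg jg] fg; congr Complex; apply: ae_Rintegral => //.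
- by apply: filterS fg => x + Ax => ->.
- by apply: filterS fg => x + Ax => ->.
Qed.

Lemma L2norm_eq0 f : in_L2 mu A f -> L2norm mu A f = 0 ->
  {ae mu, forall x, A x -> f x = 0}.
Proof.
move=> [mr mi If] /eqP; rewrite -sqrf_eq0 L2norm_sqr => /eqP f0.
have m2 : measurable_fun A (fun x => (sqmod (f x))%:E).
  exact/measurable_EFinP/cmeasurable_sqmod.
have : (\int[mu]_(x in A) `|(sqmod (f x))%:E| = 0)%E.
  under eq_integral do rewrite gee0_abs ?lee_fin ?sqmod_ge0//.
  by rewrite -[LHS]fineK ?integrable_fin_num//; congr EFin.
move/(ae_eq_integral_abs mu mA m2); apply: filterS => x /[apply] -[] /eqP.
rewrite /sqmod paddr_eq0 ?sqr_ge0// !sqrf_eq0 => /andP[/eqP r0 /eqP i0].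
exact: complex_eqP.
Qed.

Lemma in_L2_cintegrable f : (mu A < +oo)%E -> in_L2 mu A f -> cintegrable f.
Proof.
move=> Afin [mr mi If].
have I1 : mu.-integrable A (EFin \o (fun p => 1 + sqmod (f p))).
  apply: integrableD_real If; apply: (measurable_bounded_integrable mA Afin).
    exact: measurable_cst.
  exact: bounded_cst.
have bnd (x y : R) : x ^+ 2 <= y -> `|x| <= 1 + y.
  rewrite -real_normK ?num_real// => xy.
  by have := sqr_ge0 (`|x| - 1); have := normr_ge0 x; nra.
split; apply: (le_integrable_real _ _ I1) => // p _.
- by apply: bnd; exact: Re_sqr_le.
- by apply: bnd; exact: Im_sqr_le.
Qed.

(** ** Bounded weights *)

Section weighted.
Variables (c f g : T -> R[i]) (k : R).
Hypotheses (k0 : 0 <= k) (mc : cmeasurable c).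
Hypothesis ck : forall x, A x -> sqmod (c x) <= k ^+ 2.
Hypotheses (L2f : in_L2 mu A f) (L2g : in_L2 mu A g).

Let sqmod_le x : A x ->
  sqmod (c x * f x * (g x)^*%C) <= k ^+ 2 * sqmod (f x) * sqmod (g x).
Proof.
move=> Ax; rewrite !sqmodM sqmodJ ler_wpM2r ?sqmod_ge0//.
by rewrite ler_wpM2r ?sqmod_ge0// ck.
Qed.

Let young_le (t : R) x (z : R) : 0 < t -> A x ->
  z ^+ 2 <= sqmod (c x * f x * (g x)^*%C) ->
  2 * `|z| <= k * (t * sqmod (f x) + t^-1 * sqmod (g x)).
Proof.
move=> t0 Ax zx; apply: young; rewrite ?sqmod_ge0//.
exact: le_trans zx (sqmod_le Ax).
Qed.

Let major (t : R) :
  mu.-integrable A (EFin \o (fun x => k * (t * sqmod (f x) + t^-1 * sqmod (g x)))).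
Proof.
case: L2f L2g => _ _ If [_ _ Ig]; apply: integrableZ_real.
by apply: integrableD_real; apply: integrableZ_real.
Qed.

Let mcfg : cmeasurable (fun x => c x * f x * (g x)^*%C).
Proof.
have /in_L2P[mf _] := L2f; have /in_L2P[mg _] := L2g.
by apply: cmeasurableM; [exact: cmeasurableM|exact: cmeasurableJ].
Qed.

Lemma cintegrable_weighted : cintegrable (fun x => c x * f x * (g x)^*%C).
Proof.
have [mr mi] := mcfg.
have half z y : 2 * `|z| <= y -> `|z| <= y :> R.
  by move=> h; have : 0 <= `|z| by []; lra.
split; apply: le_integrable_real (major 1) => // x Ax; apply: half.
- by apply: young_le => //; exact: Re_sqr_le.
- by apply: young_le => //; exact: Im_sqr_le.
Qed.

(** Cauchy-Schwarz, from the pointwise Young inequality with a free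
    parameter. *)
Lemma cintegral_weighted_le :
  complex.Re (cintegral mu A (fun x => c x * f x * (g x)^*%C)) <=
  k * L2norm mu A f * L2norm mu A g.
Proof.
apply: young_mul => //; rewrite ?L2norm_ge0// => t t0.
case: L2f L2g => _ _ If [_ _ Ig]; have [Ir _] := cintegrable_weighted.
rewrite !L2norm_sqr -!RintegralZl// -RintegralD//; try exact: integrableZ_real.
rewrite -RintegralZl//; last by apply: integrableD_real; apply: integrableZ_real.
apply: le_Rintegral => //; first exact: integrableZ_real.
move=> x Ax; apply: (@le_trans _ _ (2 * `|complex.Re (c x * f x * (g x)^*%C)|)).
  by rewrite ler_pM2l// ler_norm.
by apply: young_le => //; exact: Re_sqr_le.
Qed.

End weighted.
End L2.

(** * Smooth bump functions *)

Section flat.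
Variable R : realType.
Implicit Types (n : nat) (x : R).

(** The functions t^n exp(-t), t = 1/x, extended by 0 to x <= 0: their linear
    span is stable under differentiation, which makes exp(-1/x) smooth. *)
Definition flat n x : R := if 0 < x then x^-1 ^+ n * expR (- x^-1) else 0.

Lemma flat_ge0 n x : 0 <= flat n x.
Proof.
rewrite /flat; case: ifPn => // x0.
by rewrite mulr_ge0 ?expR_ge0// exprn_ge0// invr_ge0 ltW.
Qed.

Lemma flat_le n x : flat n x <= n.+1`!%:R * `|x|.
Proof.
rewrite /flat; case: ifPn => x0; last by rewrite mulr_ge0.
have t0 : 0 < x^-1 by rewrite invr_gt0.
have := expR_ge1Dxn n (ltW t0) => h.
have {}h : x^-1 ^+ n.+1 <= n.+1`!%:R * expR x^-1.
  rewrite mulrC -ler_pdivrMr ?ltr0n ?fact_gt0//.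
  by apply: le_trans h; rewrite lerDr.
rewrite gtr0_norm// expRN ler_pdivrMr ?expR_gt0//.
rewrite mulrAC -ler_pdivrMr// mulrC -exprS; exact: h.
Qed.

Lemma is_derive_flat n x :
  is_derive x 1 (flat n) (flat n.+2 x - n%:R * flat n.+1 x).
Proof.
have [x0|x0|->] := ltgtP x 0.
- have -> : flat n.+2 x - n%:R * flat n.+1 x = 0.
    by rewrite /flat ltNge (ltW x0) /= mulr0 subrr.
  apply: near_eq_is_derive (is_derive_cst 0 x 1).
  near=> y; rewrite /flat ifF//; apply/negbTE; rewrite -leNgt ltW//.
  by near: y; exact: lt_nbhsl.
- apply: (@near_eq_is_derive _ _ _ (fun y : R => y^-1 ^+ n * expR (- y^-1) : R)).
    by near=> y; rewrite /flat ifT//; near: y; exact: lt_nbhsr.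
  have xn0 : x != 0 by rewrite gt_eqF.
  have dV : is_derive x 1 (fun y : R => y^-1) (- x ^- 2).
    have := @is_deriveV R id x 1 1 xn0 _.
    by rewrite [_ *: _]mulr1; apply.
  have dX := is_deriveX n dV; rewrite exprfctE in dX.
  have dE := @is_derive1_comp _ (expR \o -%R) (fun y : R => y^-1) x _ _
    (@is_derive1_comp _ expR -%R x^-1 _ _ (is_derive_expR _) (is_deriveNid (_ : R) (1 : R))) dV.
  apply: (is_derive_eq (is_deriveM dX dE)).
  rewrite /flat x0 -exprVn.
  case: n {dX} => [|n]; rewrite /GRing.scale /= ?exprS ?expr0; ring.
- have -> : flat n.+2 0 - n%:R * flat n.+1 0 = 0.
    by rewrite /flat ltxx mulr0 subrr.
  suff h : h^-1 *: (flat n (h *: 1 + 0) - flat n 0) @[h --> 0^'] --> 0.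
    apply: DeriveDef; first by apply/cvg_ex; exists 0.
    exact/cvg_lim.
  apply: norm_cvg0; apply: (@squeeze_cvgr _ _ _ _ (cst 0)
    (fun h : R => (n.+2)`!%:R * `|h|)).
  + near=> h; rewrite normr_ge0 /= addr0 [h *: 1]mulr1 /flat ltxx subr0.
    have [h0|h0] := ltP 0 h; last by rewrite scaler0 normr0 mulr_ge0.
    have := flat_le n.+1 h; rewrite /flat h0 => {}h1.
    rewrite ger0_norm; last by rewrite mulr_ge0 ?invr_ge0 ?mulr_ge0 ?expR_ge0
      ?exprn_ge0 ?invr_ge0 ?ltW.
    by apply: le_trans h1; rewrite exprS -mulrA.
  + exact: cvg_cst.
  + have lim0 : `|h| @[h --> (0 : R)^'] --> `|0 : R|.
      by apply: cvg_within_filter; apply: cvg_norm; exact: cvg_id.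
    have : n.+2`!%:R * `|h| @[h --> (0 : R)^'] --> n.+2`!%:R * `|0 : R|.
      by apply: cvgM lim0; exact: cvg_cst.
    by rewrite normr0 mulr0.
Unshelve. all: by end_near. Qed.

Lemma flat0_le1 x : flat 0 x <= 1.
Proof.
rewrite /flat; case: ifPn => // x0.
by rewrite expr0 mul1r -expR0 ler_expR oppr_le0 invr_ge0 ltW.
Qed.

(** The shifts 1/(n+1) let the support of the approximant of ]a, +oo[ lie in
    [a + 1/(n+1), +oo[. *)
Definition flat_step (a : R) (n : nat) x : R :=
  flat 0 (n.+1%:R ^+ 2 * (x - a) - n.+1%:R).

Lemma flat_step_eq0 a n x : x <= a + n.+1%:R^-1 -> flat_step a n x = 0.
Proof.
move=> xa; rewrite /flat_step /flat ifF//; apply/negbTE; rewrite -leNgt.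
have n0' : 0 < n.+1%:R :> R by rewrite ltr0n.
rewrite subr_le0 expr2 -mulrA -ler_pdivlMl// mulVf ?gt_eqF//.
by rewrite -ler_pdivlMl// mulr1 lerBlDl.
Qed.

Lemma cvg_flat_step a x :
  flat_step a n x @[n --> \oo] --> ((a < x)%R%:R : R).
Proof.
have [ax|ax] := ltP a x; last first.
  apply: cvg_near_cst; near=> n; apply: flat_step_eq0.
  by apply: le_trans ax _; rewrite lerDl invr_ge0 ler0n.
have xa0 : 0 < x - a by rewrite subr_gt0.
apply: (@squeeze_cvgr _ _ _ _ (fun n => expR (- n.+1%:R^-1)) (cst 1)).
- near=> n.
  have n0 : 0 < n.+1%:R :> R by rewrite ltr0n.
  have h : n.+1%:R <= n.+1%:R ^+ 2 * (x - a) - n.+1%:R :> R.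
    rewrite lerBrDl -mulr2n -[X in X *+ 2]mulr1 -mulrnAr expr2 -mulrA ler_pM2l//.
    rewrite -ler_pdivrMr// ltW//; apply: (@lt_le_trans _ _ n%:R).
      by near: n; exact: nbhs_infty_gtr.
    by rewrite ler_nat.
  rewrite flat0_le1 andbT /flat_step /flat ifT; last exact: lt_le_trans h.
  rewrite expr0 mul1r ler_expR lerN2 lef_pV2// posrE//.
  exact: lt_le_trans h.
- have lim0 : - n.+1%:R^-1 @[n --> \oo] --> (- 0 : R).
    by apply: cvgN; exact: cvg_harmonic.
  have : expR (- n.+1%:R^-1) @[n --> \oo] --> expR (- 0 : R).
    by apply: continuous_cvg lim0; exact: continuous_expR.
  by rewrite oppr0 expR0.
- exact: cvg_cst.
Unshelve. all: by end_near. Qed.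

End flat.

Section smooth.
Variable R : realType.
Implicit Types V : normedModType R.

Lemma smooth_differentiable V (f : V -> R) x : smooth f -> differentiable f x.
Proof. by move=> /(_ [::]). Qed.

Lemma smooth_continuous V (f : V -> R) : smooth f -> continuous f.
Proof.
by move=> sf x; apply: differentiable_continuous; exact: smooth_differentiable.
Qed.

Lemma smooth_derive V (f : V -> R) e : smooth f -> smooth ('D_e f).
Proof. by move=> sf s x; have := sf (rcons s e) x; rewrite foldr_rcons. Qed.

(** Smoothness asks for all iterated directional derivatives.  This algebra
    contains the bumps and is stable under directional differentiation, so that
    differentiability of its members suffices. *)
Inductive bump_algebra : (R * R -> R) -> Prop :=
| Bump_cst c : bump_algebra (fun=> c)
| Bump_flat n (a b c : R) : bump_algebra (fun p => flat n (a * p.1 + b * p.2 + c))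
| Bump_add f g : bump_algebra f -> bump_algebra g ->
    bump_algebra (fun p => f p + g p)
| Bump_mul f g : bump_algebra f -> bump_algebra g ->
    bump_algebra (fun p => f p * g p).

Lemma differentiable_affine (a b c : R) p :
  differentiable (fun q : R * R => a * q.1 + b * q.2 + c) p.
Proof.
have d1 : differentiable (fst : R * R -> R) p.
  apply: (@linear_differentiable R (R * R)%type R (fst : {linear (R * R)%type -> R})).
  by move=> q; exact: cvg_fst.
have d2 : differentiable (snd : R * R -> R) p.
  apply: (@linear_differentiable R (R * R)%type R (snd : {linear (R * R)%type -> R})).
  by move=> q; exact: cvg_snd.
apply: (@differentiableD _ _ _ (fun q : R * R => a * q.1 + b * q.2) (cst c)) => //.
by apply: (@differentiableD _ _ _ (fun q : R * R => a * q.1)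
  (fun q : R * R => b * q.2)); apply: differentiableM.
Qed.

Lemma bump_algebra_differentiable f p : bump_algebra f -> differentiable f p.
Proof.
elim=> [c|n a b c|{}f g _ df _ dg|{}f g _ df _ dg].
- exact: differentiable_cst.
- apply: (@differentiable_comp _ _ _ _ (fun q : R * R => a * q.1 + b * q.2 + c) (flat n)).
    exact: differentiable_affine.
  by apply/derivable1_diffP; have [] := is_derive_flat n (a * p.1 + b * p.2 + c).
- exact: (@differentiableD _ _ _ f g).
- exact: (@differentiableM _ _ f g).
Qed.

Lemma derive_affine_comp (f df : R -> R) (a b c : R) (e p : R * R) :
  (forall x : R, is_derive x (1 : R) f (df x)) ->
  'D_e (fun q : R * R => f (a * q.1 + b * q.2 + c)) p =
  (a * e.1 + b * e.2) * df (a * p.1 + b * p.2 + c).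
Proof.
move=> fdf; set y := a * p.1 + _ + _; set k := a * e.1 + _.
have -> : 'D_e (fun q : R * R => f (a * q.1 + b * q.2 + c)) p =
          'D_k f y.
  rewrite /derive.
  have -> // : (fun h : R => h^-1 *: (((fun q : R * R =>
      f (a * q.1 + b * q.2 + c)) \o shift p) (h *: e) - f y)) =
    (fun h : R => h^-1 *: ((f \o shift y) (h *: k) - f y)).
  apply/funext => h /=; congr (h^-1 *: (f _ - f y)).
  by rewrite /y /k /GRing.scale /=; ring.
have dfy : differentiable f y by apply/derivable1_diffP; have [] := fdf y.
rewrite deriveE// -[k in LHS]mulr1 -[k * 1]/(k *: 1) linearZ /= -deriveE//.
by have [_ ->] := fdf y.
Qed.

Lemma bump_algebra_derive f e : bump_algebra f -> bump_algebra ('D_e f).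
Proof.
elim=> [c|n a b c|{}f g bf bdf bg bdg|{}f g bf bdf bg bdg].
- have -> : 'D_e (fun=> c) = (fun=> 0) :> (R * R -> R).
    by apply/funext => p; rewrite derive_cst.
  exact: Bump_cst.
- have -> : 'D_e (fun q : R * R => flat n (a * q.1 + b * q.2 + c)) =
      (fun p => (a * e.1 + b * e.2) * (flat n.+2 (a * p.1 + b * p.2 + c) +
        (- n%:R) * flat n.+1 (a * p.1 + b * p.2 + c))).
    apply/funext => p; rewrite (derive_affine_comp _ _ _ _ _ (is_derive_flat n)).
    by rewrite mulNr.
  apply: Bump_mul; first exact: Bump_cst.
  apply: Bump_add; first exact: Bump_flat.
  by apply: Bump_mul; [exact: Bump_cst|exact: Bump_flat].
- have -> : 'D_e (fun q => f q + g q) = (fun p => 'D_e f p + 'D_e g p).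
    apply/funext => p; apply: (@deriveD _ _ _ f g);
      apply: diff_derivable; exact: bump_algebra_differentiable.
  exact: Bump_add.
- have -> : 'D_e (fun q => f q * g q) =
            (fun p => f p * 'D_e g p + g p * 'D_e f p).
    apply/funext => p; apply: (@deriveM _ _ f g);
      apply: diff_derivable; exact: bump_algebra_differentiable.
  by apply: Bump_add; exact: Bump_mul.
Qed.

Lemma bump_algebra_smooth f : bump_algebra f -> smooth f.
Proof.
move=> bf s x; apply: bump_algebra_differentiable.
by elim: s => //= e s; exact: bump_algebra_derive.
Qed.

End smooth.

(** * The fundamental lemma of the calculus of variations *)

(** The type carrying the product sigma-algebra with respect to which the
    plane Lebesgue measure is defined. *)
Notation plane R := (measurableTypeR R * measurableTypeR R)%type.

Section measurable_plane.
Variable R : realType.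

(** An open set is a countable union of products of balls with rational
    centres. *)
Lemma open_measurable_plane (U : set (R * R)) :
  open U -> measurable (U : set (plane R)).
Proof.
move=> oU.
pose box (q s : rat) (n : nat) : set (R * R) :=
  ball (ratr q : R) n.+1%:R^-1 `*` ball (ratr s : R) n.+1%:R^-1.
have -> : U = \bigcup_(q : rat) \bigcup_(s : rat) \bigcup_n
    (if `[< box q s n `<=` U >] then box q s n else set0).
  apply/seteqP; split=> [[x y] Uxy|p [q _ [s _ [n _]]]]; last first.
    by case: ifP => // /asboolP; apply.
  have /nbhs_ballP[e /= e0 xyU] := open_nbhs_nbhs (conj oU Uxy).
  have [n ne] : exists n, n.+1%:R^-1 < e / 2.
    have e2 : 0 < e / 2 by rewrite divr_gt0.
    have [n _ /(_ n (leqnn n))] := near_infty_natSinv_lt (PosNum e2).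
    by exists n.
  have rational_near (z : R) : exists q : rat, `|ratr q - z| < n.+1%:R^-1.
    have n0 : 0 < n.+1%:R^-1 :> R by rewrite invr_gt0 ltr0n.
    move: n0; set e' := _^-1 => n0.
    have : z - e' < z + e' by lra.
    move=> /rat_in_itvoo[q]; rewrite in_itv /= => /andP[h1 h2].
    by exists q; rewrite ltr_distl h1.
  have [q qx] := rational_near x; have [s sy] := rational_near y.
  exists q => //; exists s => //; exists n => //.
  rewrite ifT; first by split; rewrite /= -ball_normE.
  apply/asboolP => -[x' y'] []; rewrite -!ball_normE /= => qx' sy'.
  apply: xyU; split; rewrite -ball_normE /=.
    apply: le_lt_trans (ler_distD (ratr q) _ _) _; rewrite distrC.
    by apply: lt_trans (ltrD qx qx') _; rewrite [ltRHS]splitr ltrD.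
  apply: le_lt_trans (ler_distD (ratr s) _ _) _; rewrite distrC.
  by apply: lt_trans (ltrD sy sy') _; rewrite [ltRHS]splitr ltrD.
apply: bigcupT_measurable_rat => q; apply: bigcupT_measurable_rat => s.
apply: bigcupT_measurable => n; case: ifP => // _.
by apply: measurableX; exact: measurable_ball.
Qed.

Lemma continuous_measurable_plane (f : R * R -> R) :
  continuous f -> measurable_fun [set: plane R] f.
Proof.
move=> /continuousP cf; apply: (measurability _ (RGenOpens.measurableE R)).
move=> _ [_ [a [b ->] <-]]; rewrite setTI; apply: open_measurable_plane.
by apply: cf; exact: interval_open.
Qed.

End measurable_plane.

Section vanishing_integrals.
Local Open Scope ereal_scope.

(** Sets over which an integrable function has integral 0 form a Dynkin
    system. *)
Lemma vanish_induction d d' (T : measurableType d) (T' : measurableType d')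
    (R : realType) (mu : {measure set T -> \bar R}) (S : set T)
    (g : T -> \bar R) (F : T -> T') (G : set (set T')) :
  measurable S -> mu.-integrable S g -> measurable_fun setT F ->
  d'.-measurable = <<s G >> -> setI_closed G ->
  \int[mu]_(x in S) g x = 0 ->
  (forall A, G A -> \int[mu]_(x in S `&` F @^-1` A) g x = 0) ->
  forall A, measurable A -> \int[mu]_(x in S `&` F @^-1` A) g x = 0.
Proof.
move=> mS ig mF GE GI gS gG A.
have mFI B : measurable B -> measurable (S `&` F @^-1` B).
  by move=> mB; apply: measurableI => //; rewrite -[X in measurable X]setTI; apply: mF.
rewrite {1}GE; apply: (@dynkin_induction _ _ G
  (fun A => \int[mu]_(x in S `&` F @^-1` A) g x = 0)) => //.
- by rewrite preimage_setT setIT.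
- move=> B mB gB; rewrite preimage_setC -[LHS]add0e -{1}gB -integral_setU//.
  + by rewrite -setIUr setUv setIT.
  + exact: mFI.
  + by rewrite -preimage_setC; apply/mFI/measurableC.
  + by rewrite -setIUr setUv setIT; exact: measurable_int ig.
  + by apply/disj_setPS => x [[_ ?] [_]].
- move=> B mB tB gB; rewrite preimage_bigcup setI_bigcupr integral_bigcup//.
  + by rewrite eseries0// => n _ _; exact: gB.
  + apply: trivIset_setIl => i j _ _ [x [Bix Bjx]].
    by apply: tB => //; exists (F x).
  + by move=> k; exact: mFI.
  + apply: integrableS ig => //; last by apply: bigcup_sub => ? _; exact: subIsetl.
    by apply: bigcup_measurable => k _; exact: mFI.
Qed.

End vanishing_integrals.

Section fundamental_lemma.
Variables (R : realType) (tmin tmax : R).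
Let Om := rect tmin tmax.
Implicit Types (a b c d : R) (n : nat) (p : R * R).

Lemma rectE : Om = `]0, 1[ `*` `]tmin, tmax[.
Proof. by apply/seteqP; split=> [[x y]|[x y]]; rewrite /= !in_itv. Qed.

Lemma measurable_rect :
  measurable (Om : set (plane R)).
Proof. by rewrite rectE; apply: measurableX. Qed.

Lemma area_rect_lty : (area Om < +oo)%E.
Proof.
rewrite rectE product_measure1E//= !lebesgue_measure_itv /=.
by case: ifP; case: ifP => _ _; rewrite ?mule0 ?mul0e// -!EFinB -EFinM ltry.
Qed.

Definition bump a b c d n p : R :=
  (flat_step a n p.1 * flat_step (- b) n (- p.1)) *
  (flat_step c n p.2 * flat_step (- d) n (- p.2)).

Lemma bump_smooth a b c d n : smooth (bump a b c d n).
Proof.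
apply: bump_algebra_smooth.
have aff (e s t : R) :
    bump_algebra (fun p => flat_step e n (s * p.1 + t * p.2)).
  rewrite [X in bump_algebra X](_ : _ = (fun p : R * R => flat 0
    (n.+1%:R ^+ 2 * s * p.1 + n.+1%:R ^+ 2 * t * p.2
      + (- n.+1%:R ^+ 2 * e - n.+1%:R)))); first exact: Bump_flat.
  by apply/funext => p; rewrite /flat_step; congr flat; ring.
have E : bump a b c d n = (fun p => (flat_step a n (1 * p.1 + 0 * p.2) *
    flat_step (- b) n (- 1 * p.1 + 0 * p.2)) *
    (flat_step c n (0 * p.1 + 1 * p.2) *
     flat_step (- d) n (0 * p.1 + - 1 * p.2))).
  by apply/funext => p; rewrite /bump !mul1r !mulN1r !mul0r !addr0 !add0r.
by rewrite E; apply: Bump_mul; apply: Bump_mul.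
Qed.

Lemma bump_test_fun a b c d n : 0 <= a -> b <= 1 -> tmin <= c -> d <= tmax ->
  test_fun Om (bump a b c d n).
Proof.
move=> a0 b1 ct dt; split; first exact: bump_smooth.
have n0 : 0 < n.+1%:R^-1 :> R by rewrite invr_gt0 ltr0n.
set e := _^-1 in n0.
exists (`[a + e, b - e] `*` `[c + e, d - e]); split.
- by apply: compact_setX; exact: segment_compact.
- move=> [x y] []; rewrite /= !in_itv /= => /andP[x1 x2] /andP[y1 y2].
  by split; apply/andP; split; rewrite /=; lra.
- move=> [x y] /= K; rewrite /bump /=.
  have [xa|xa] := leP x (a + e); first by rewrite flat_step_eq0// !mul0r.
  have [xb|xb] := leP (- x) (- b + e).
    by rewrite (flat_step_eq0 (a := - b))// mulr0 mul0r.
  have [yc|yc] := leP y (c + e).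
    by rewrite (flat_step_eq0 (a := c))// mul0r mulr0.
  have [yd|yd] := leP (- y) (- d + e).
    by rewrite (flat_step_eq0 (a := - d))// !mulr0.
  by exfalso; apply: K; rewrite !in_itv /=; split; apply/andP; split; lra.
Qed.

Lemma bump_norm_le1 a b c d n p : `|bump a b c d n p| <= 1.
Proof.
have f0 (e x : R) : 0 <= flat_step e n x by exact: flat_ge0.
have f1 (e x : R) : flat_step e n x <= 1 by exact: flat0_le1.
rewrite ger0_norm /bump ?mulr_ge0//.
by rewrite mulr_ile1 ?mulr_ge0// mulr_ile1.
Qed.

Lemma cvg_bump a b c d p : bump a b c d n p @[n --> \oo] -->
  (\1_(`]a, b[ `*` `]c, d[) p : R).
Proof.
have -> : \1_(`]a, b[ `*` `]c, d[) p = ((a < p.1)%R%:R * (- b < - p.1)%R%:R) *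
    ((c < p.2)%R%:R * (- d < - p.2)%R%:R) :> R.
  rewrite indicE !ltrN2 -!natrM !mulnb; congr (_%:R); congr nat_of_bool.
  by rewrite in_setX !mem_setE /= !in_itv /= ?andbA. 
by apply: cvgM; apply: cvgM; exact: cvg_flat_step.
Qed.

Section vanish.
Variable g : R * R -> R.
Hypothesis ig : area.-integrable Om (EFin \o g).
Hypothesis g0 : forall phi, test_fun Om phi ->
  \int[area]_(p in Om) (g p * phi p) = 0.

(* the bumps converge boundedly to the indicator of the box *)
Let integral_box_inside a b c d : 0 <= a -> b <= 1 -> tmin <= c -> d <= tmax ->
  (\int[area]_(p in Om `&` (`]a, b[ `*` `]c, d[)) (g p)%:E = 0)%E.
Proof.
move=> a0 b1 ct dt.
have mg : measurable_fun (Om : set (plane R)) g by apply/measurable_EFinP; exact: measurable_int ig.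
have mb n : measurable_fun (Om : set (plane R)) (bump a b c d n).
  apply: measurable_funTS; apply: continuous_measurable_plane.
  by apply: smooth_continuous; exact: bump_smooth.
have ib n : area.-integrable Om (EFin \o (fun p => g p * bump a b c d n p)).
  apply: (le_integrable_real measurable_rect (g := fun p => `|g p|)).
  - exact: measurable_funM.
  - by move=> p _ /=; rewrite normrM ler_piMr// bump_norm_le1.
  - exact: integrable_norm.
have lim := @dominated_cvg _ _ _ area Om measurable_rect
  (fun n p => (g p * bump a b c d n p)%:E)
  (fun p => (g p * \1_(`]a, b[ `*` `]c, d[) p)%:E) (fun p => `|g p|%:E).
rewrite integral_mkcondr.
transitivity (\int[area]_(p in Om) (g p * \1_(`]a, b[ `*` `]c, d[) p)%:E)%E.
  apply: eq_integral => p _; rewrite patchE indicE.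
  by case: ifP; rewrite ?mulr1 ?mulr0.
apply: cvg_unique (lim _ _ _ _ _) _ => //.
- by move=> n; apply/measurable_EFinP; exact: (measurable_funM mg (mb n)).
- move=> p _; apply: cvg_EFin; first exact: nearW.
  by apply: cvgM; [exact: cvg_cst|exact: cvg_bump].
- exact: integrable_norm.
- by move=> n p _; rewrite lee_fin normrM ler_piMr// bump_norm_le1.
- apply: cvg_near_cst; apply: nearW => n.
  rewrite -[LHS]fineK; last exact: (integrable_fin_num measurable_rect (ib n)).
  by congr EFin; apply: g0; exact: bump_test_fun.
Qed.

Let integral_box a b c d :
  (\int[area]_(p in Om `&` (`]a, b[ `*` `]c, d[)) (g p)%:E = 0)%E.
Proof.
have := @integral_box_inside (Num.max 0 a) (Num.min 1 b) (Num.max tmin c)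
  (Num.min tmax d).
rewrite !le_max !ge_min !lexx /= => /(_ isT isT isT isT) <-.
congr integral; apply/seteqP; split=> -[x y] [[/= /andP[x0 x1] /andP[y0 y1]]].
  rewrite !in_itv /= => -[/andP[xa xb] /andP[yc yd]].
  split; first by split; apply/andP.
  rewrite !gt_max !lt_min.
  by rewrite x0 x1 y0 y1 xa xb yc yd.
rewrite /= !in_itv /= !gt_max !lt_min.
move=> [/andP[/andP[_ xa] /andP[_ xb]] /andP[/andP[_ yc] /andP[_ yd]]].
by split; split; apply/andP.
Qed.

Let intervals_setI_closed : setI_closed (@RGenOpens.G R).
Proof.
move=> _ _ [a [b ->]] [c [d ->]]; exists (Num.max a c), (Num.min b d).
apply/seteqP; split=> x; rewrite /= !in_itv /= gt_max lt_min.
  by move=> [/andP[-> ->] /andP[-> ->]].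
by move=> /andP[/andP[-> ->] /andP[-> ->]].
Qed.

(* open intervals generate the Borel sets: the first factor is extended with
   the second one fixed, then the second one *)
Let integral_rectangle (A B : set R) : measurable A -> measurable B ->
  (\int[area]_(p in Om `&` (A `*` B)) (g p)%:E = 0)%E.
Proof.
move=> mA mB.
have strip c d : (\int[area]_(p in (Om `&` snd @^-1` `]c, d[) `&` fst @^-1` A)
    (g p)%:E = 0)%E.
  have mS : measurable ((Om : set (plane R)) `&` snd @^-1` `]c, d[).
    apply: measurableI; first exact: measurable_rect.
    by rewrite -[X in measurable X]setTI; exact: measurable_snd.
  apply: (@vanish_induction _ _ _ _ _ _ _ _ fst _ mS _ _ (RGenOpens.measurableE R)
    intervals_setI_closed) => //.
  - by apply: integrableS ig => //; exact: measurable_rect.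
  - rewrite -[RHS](integral_box 0 1 c d); congr integral.
    rewrite rectE; apply/seteqP; split=> -[x y] /=.
      by move=> [[]].
    by move=> [[? ?] []].
  - move=> _ [a [b ->]]; rewrite -[RHS](integral_box a b c d); congr integral.
    by apply/seteqP; split=> -[x y] /=; [move=> [[? ?] ?]|move=> [? [? ?]]].
have mS : measurable ((Om : set (plane R)) `&` fst @^-1` A).
  apply: measurableI; first exact: measurable_rect.
  by rewrite -[X in measurable X]setTI; exact: measurable_fst.
have -> : Om `&` (A `*` B) = (Om `&` fst @^-1` A) `&` snd @^-1` B.
  by apply/seteqP; split=> -[x y] /=; [move=> [? [? ?]]|move=> [[? ?] ?]].
apply: (@vanish_induction _ _ _ _ _ _ _ _ snd _ mS _ _ (RGenOpens.measurableE R)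
    intervals_setI_closed) => //.
- by apply: integrableS ig => //; exact: measurable_rect.
- rewrite -[RHS](strip tmin tmax); congr integral.
  rewrite rectE; apply/seteqP; split=> -[x y] /=.
    by move=> [[]].
  by move=> [[[]]].
- by move=> _ [c [d ->]]; rewrite setIAC; exact: strip.
Qed.

(** The integral of g vanishes over boxes because their indicators are limits
    of test functions, hence over all measurable sets by three Dynkin
    arguments: in each factor, then from rectangles to the product
    sigma-algebra. *)
Lemma fundamental_lemma_real : {ae area, forall p, Om p -> g p = 0}.
Proof.
have : ae_eq area Om (EFin \o g) (cst 0%E).
  apply: integral_ae_eq => //; first exact: measurable_rect.
  move=> E EOm mE; rewrite integral0.
  rewrite -(setIidr EOm) -[E in X in integral _ X]/(id @^-1` E).
  apply: (@vanish_induction _ _ _ _ _ area _ _ id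
    _ measurable_rect ig _ (measurable_prod_measurableType _ _)) => //.
  - move=> _ _ [A mA [B mB <-]] [A' mA' [B' mB' <-]].
    exists (A `&` A'); first exact: measurableI.
    by exists (B `&` B'); [exact: measurableI|rewrite setXI].
  - rewrite -[RHS](integral_rectangle (A := setT) (B := setT))//.
    by rewrite setXTT setIT.
  - by move=> _ [A mA [B mB <-]]; exact: integral_rectangle.
by apply: filterS => p /= /[apply] -[].
Qed.

End vanish.

Lemma fundamental_lemma (f : R * R -> R[i]) : in_L2 area Om f ->
  (forall phi, test_fun Om phi ->
     cintegral area Om (fun p => f p * (phi p)%:C) = 0) ->
  {ae area, forall p, Om p -> f p = 0}.
Proof.
move=> L2f f0; have [ir ii] := in_L2_cintegrable measurable_rect area_rect_lty L2f.
have r0 : {ae area, forall p, Om p -> complex.Re (f p) = 0}.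
  apply: fundamental_lemma_real => // phi tphi.
  have := congr1 (@complex.Re R) (f0 _ tphi) => /= <-; apply: eq_Rintegral => p _.
  by rewrite cReM /= mulr0 subr0.
have i0 : {ae area, forall p, Om p -> complex.Im (f p) = 0}.
  apply: fundamental_lemma_real => // phi tphi.
  have := congr1 (@complex.Im R) (f0 _ tphi) => /= <-; apply: eq_Rintegral => p _.
  by rewrite cImM /= mulr0 add0r.
apply: (@filterS2 _ _ (ae_filter_ringOfSetsType area) _ _ _ _ r0 i0) => p r i Omp.
by apply: complex_eqP; [exact: r|exact: i].
Qed.

End fundamental_lemma.

(** * Weak derivatives and Sobolev norms on the rectangle *)

Section sobolev.
Variables (R : realType) (tmin tmax : R).
Let Om := rect tmin tmax.
Implicit Types (u v w g : R * R -> R[i]) (phi : R * R -> R) (m i j : nat).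

Let mOm := @measurable_rect R tmin tmax.
Let Omoo := @area_rect_lty R tmin tmax.
Let ae_filter := ae_filter_ringOfSetsType (area : {measure set (plane R) -> \bar R}).

Lemma compact_crect : compact (crect tmin tmax).
Proof.
have -> : crect tmin tmax = `[0, 1] `*` `[tmin, tmax].
  by apply/seteqP; split=> [[x y]|[x y]]; rewrite /= !in_itv.
by apply: compact_setX; exact: segment_compact.
Qed.

Lemma sub_rect_crect : Om `<=` crect tmin tmax.
Proof. by move=> p [/andP[? ?] /andP[? ?]]; split; apply/andP; split; apply: ltW. Qed.

Lemma compact_bounded (T : topologicalType) (A : set T) (f : T -> R) :
  compact A -> continuous f ->
  exists2 M, 0 <= M & forall p, A p -> `|f p| <= M.
Proof.
move=> cA cf; have [->|/set0P A0] := eqVneq A set0; first by exists 0.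
have cnf : {within A, continuous (fun p => `|f p|)}.
  apply: continuous_subspaceT => p; apply: continuous_comp; first exact: cf.
  exact: norm_continuous.
have [c Ac cmax] := compact_EVT_max A0 cA cnf.
by exists `|f c| => // p Ap; apply: cmax; rewrite inE.
Qed.

Lemma continuous_bounded_rect (f : R * R -> R) : continuous f ->
  exists2 M, 0 <= M & forall p, Om p -> `|f p| <= M.
Proof.
move=> cf; have [M M0 fM] := compact_bounded compact_crect cf.
by exists M => // p /sub_rect_crect; exact: fM.
Qed.

Lemma smooth_pderiv i j phi : smooth phi -> smooth (pderiv i j phi).
Proof.
move=> sphi; rewrite /pderiv.
have : smooth (iter j (fun f : R * R -> R => 'D_((0, 1) : R * R) f) phi).
  by elim: j => //= k IH; apply: smooth_derive.
by elim: i => //= k IH h; apply: smooth_derive; exact: IH.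
Qed.

Lemma in_L2_cst (a : R[i]) : in_L2 area Om (fun=> a).
Proof.
apply: (in_L2_le mOm (g := cst (sqmod a))) => //.
apply: (measurable_bounded_integrable mOm Omoo); first exact: measurable_cst.
exact: bounded_cst.
Qed.

Lemma cmeasurable_real (f : R * R -> R) : continuous f ->
  cmeasurable (Om : set (plane R)) (fun p => (f p)%:C).
Proof.
move=> cf; split; last exact: measurable_cst.
by apply: measurable_funTS; exact: continuous_measurable_plane.
Qed.

Lemma in_L2_mul_continuous (f : R * R -> R) g : continuous f -> in_L2 area Om g ->
  in_L2 area Om (fun p => g p * (f p)%:C).
Proof.
move=> cf L2g; have [M M0 fM] := continuous_bounded_rect cf.
have /in_L2P[mg ig] := L2g.
apply: (in_L2_le mOm (g := fun p => M ^+ 2 * sqmod (g p))).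
- exact: cmeasurableM mg (cmeasurable_real cf).
- move=> p Omp; rewrite sqmodM mulrC sqmod_real ler_wpM2r ?sqmod_ge0//.
  by rewrite -real_normK ?num_real// ler_pXn2r// ?nnegrE// fM.
- exact: (integrableZ_real mOm).
Qed.

Lemma cintegrable_mul_continuous (f : R * R -> R) g : continuous f -> in_L2 area Om g ->
  cintegrable area Om (fun p => g p * (f p)%:C).
Proof.
by move=> cf L2g; apply: (in_L2_cintegrable mOm Omoo); exact: in_L2_mul_continuous.
Qed.

Lemma cintegral_mul_lin (f : R * R -> R) (a : R[i]) u w : continuous f ->
  in_L2 area Om u -> in_L2 area Om w ->
  cintegral area Om (fun p => (a * u p + w p) * (f p)%:C) =
  a * cintegral area Om (fun p => u p * (f p)%:C) +
  cintegral area Om (fun p => w p * (f p)%:C).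
Proof.
move=> cf L2u L2w; rewrite -(cintegral_lin mOm); last 2 first.
- exact: cintegrable_mul_continuous.
- exact: cintegrable_mul_continuous.
by apply: eq_cintegral => p _; rewrite mulrDl mulrA.
Qed.

Lemma is_weak_deriv_lin i j a u w gu gw :
  in_L2 area Om u -> in_L2 area Om w ->
  is_weak_deriv Om i j u gu -> is_weak_deriv Om i j w gw ->
  is_weak_deriv Om i j (fun p => a * u p + w p) (fun p => a * gu p + gw p).
Proof.
move=> L2u L2w [L2gu du] [L2gw dw]; split; first exact: (in_L2_lin mOm).
move=> phi tphi; have sphi := tphi.1.
rewrite !cintegral_mul_lin//.
- by rewrite du// dw// mulrDr; congr (_ + _); rewrite mulrCA.
- exact: smooth_continuous.
- exact/smooth_continuous/smooth_pderiv.
Qed.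

Lemma ae_cintegral_mul (f : R * R -> R) u w : continuous f ->
  in_L2 area Om u -> in_L2 area Om w ->
  {ae area, forall p, Om p -> u p = w p} ->
  cintegral area Om (fun p => u p * (f p)%:C) =
  cintegral area Om (fun p => w p * (f p)%:C).
Proof.
move=> cf /in_L2P[mu _] /in_L2P[mw _] uw; apply: (ae_cintegral mOm).
- exact: cmeasurableM mu (cmeasurable_real cf).
- exact: cmeasurableM mw (cmeasurable_real cf).
- by apply: (@filterS _ _ ae_filter) uw => p + Omp => ->.
Qed.

Lemma is_weak_deriv_ae i j u w g :
  in_L2 area Om u -> in_L2 area Om w ->
  {ae area, forall p, Om p -> u p = w p} ->
  is_weak_deriv Om i j u g -> is_weak_deriv Om i j w g.
Proof.
move=> L2u L2w uw [L2g du]; split => // phi tphi.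
rewrite -du//; apply/esym; apply: ae_cintegral_mul => //.
exact/smooth_continuous/smooth_pderiv/tphi.1.
Qed.

(** Uniqueness is what makes the chosen weak derivative linear. *)
Lemma weak_deriv_unique i j v g g' :
  is_weak_deriv Om i j v g -> is_weak_deriv Om i j v g' ->
  {ae area, forall p, Om p -> g p = g' p}.
Proof.
move=> [L2g dg] [L2g' dg'].
have L2d : in_L2 area Om (fun p => -1 * g' p + g p) by exact: (in_L2_lin mOm).
have := @fundamental_lemma R tmin tmax _ L2d.
have d0 phi : test_fun Om phi ->
    cintegral area Om (fun p => (-1 * g' p + g p) * (phi p)%:C) = 0.
  move=> tphi; rewrite cintegral_mul_lin//.
  - have := dg _ tphi; rewrite dg'// => e.
    have sgn0 : (-1) ^+ (i + j) != 0 :> R[i] by rewrite signr_eq0.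
    by rewrite (mulfI sgn0 e) mulN1r addNr.
  - exact/smooth_continuous/tphi.1.
move=> /(_ d0); apply: (@filterS _ _ ae_filter) => p + Omp => /(_ Omp).
by rewrite mulN1r addrC => /eqP; rewrite subr_eq0 => /eqP.
Qed.

Lemma wderivP m i j v : in_H Om m v -> (i + j <= m)%N ->
  is_weak_deriv Om i j v (wderiv Om i j v).
Proof. by move=> [_ +] ijm => /(_ i j ijm) [g dg]; apply: (@xgetI _ _ _ g). Qed.

Lemma wderivE m i j v g : in_H Om m v -> (i + j <= m)%N ->
  is_weak_deriv Om i j v g ->
  {ae area, forall p, Om p -> wderiv Om i j v p = g p}.
Proof. by move=> Hv ijm; apply: weak_deriv_unique; exact: wderivP ijm. Qed.

Lemma wderiv_in_L2 m i j v : in_H Om m v -> (i + j <= m)%N ->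
  in_L2 area Om (wderiv Om i j v).
Proof. by move=> Hv ijm; case: (wderivP Hv ijm). Qed.

Lemma in_H_lin m a u w : in_H Om m u -> in_H Om m w ->
  in_H Om m (fun p => a * u p + w p).
Proof.
move=> [L2u du] [L2w dw]; split; first exact: (in_L2_lin mOm).
move=> i j ijm; have [gu dgu] := du _ _ ijm; have [gw dgw] := dw _ _ ijm.
by exists (fun p => a * gu p + gw p); exact: is_weak_deriv_lin.
Qed.

Lemma wderiv_lin m i j a u w : in_H Om m u -> in_H Om m w -> (i + j <= m)%N ->
  {ae area, forall p, Om p ->
    wderiv Om i j (fun p => a * u p + w p) p =
    a * wderiv Om i j u p + wderiv Om i j w p}.
Proof.
move=> Hu Hw ijm; apply: (wderivE (in_H_lin a Hu Hw) ijm).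
apply: is_weak_deriv_lin; rewrite ?Hu.1 ?Hw.1//.
- by case: Hu.
- by case: Hw.
- exact: wderivP ijm.
- exact: wderivP ijm.
Qed.

Lemma is_weak_deriv00 v : in_L2 area Om v -> is_weak_deriv Om 0 0 v v.
Proof. by move=> L2v; split => // phi _; rewrite mul1r. Qed.

Lemma wderiv00 m v : in_H Om m v ->
  {ae area, forall p, Om p -> wderiv Om 0 0 v p = v p}.
Proof.
by move=> Hv; apply: (wderivE Hv) => //; apply: is_weak_deriv00; case: Hv.
Qed.

Lemma L2norm_ae u w : in_L2 area Om u -> in_L2 area Om w ->
  {ae area, forall p, Om p -> u p = w p} -> L2norm area Om u = L2norm area Om w.
Proof. by move=> /in_L2P[mu _] /in_L2P[mw _]; exact: (ae_L2norm mOm). Qed.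

(** ** The Sobolev norms *)

Lemma Hnorm_ge0 m v : 0 <= Hnorm Om m v.
Proof. exact: sqrtr_ge0. Qed.

Lemma Hnorm_sqr m v : Hnorm Om m v ^+ 2 =
  \sum_(i < m.+1) \sum_(j < m.+1 | (i + j <= m)%N)
    L2norm area Om (wderiv Om i j v) ^+ 2.
Proof.
rewrite sqr_sqrtr// sumr_ge0// => i _; rewrite sumr_ge0// => j _.
exact: sqr_ge0.
Qed.

Lemma triangle_sum_ge (F : nat -> nat -> R) m i j :
  (forall k l, 0 <= F k l) -> (i + j <= m)%N ->
  F i j <= \sum_(k < m.+1) \sum_(l < m.+1 | (k + l <= m)%N) F k l.
Proof.
move=> F0 ijm.
have im : (i < m.+1)%N by rewrite ltnS (leq_trans _ ijm)// leq_addr.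
have jm : (j < m.+1)%N by rewrite ltnS (leq_trans _ ijm)// leq_addl.
apply: (@le_trans _ _ (\sum_(l < m.+1 | (i + l <= m)%N) F i l)).
  by rewrite (bigD1 (Ordinal jm))//= lerDl sumr_ge0.
rewrite [leRHS](bigD1 (Ordinal im))//= lerDl sumr_ge0// => k _.
exact: sumr_ge0.
Qed.

Lemma triangle_sum_le (F : nat -> nat -> R) m m' :
  (forall k l, 0 <= F k l) -> (m <= m')%N ->
  \sum_(k < m.+1) \sum_(l < m.+1 | (k + l <= m)%N) F k l <=
  \sum_(k < m'.+1) \sum_(l < m'.+1 | (k + l <= m')%N) F k l.
Proof.
move=> F0 mm'; have mm1 : (m.+1 <= m'.+1)%N by [].
rewrite (big_ord_widen _ (fun k => \sum_(l < m.+1 | (k + l <= m)%N) F k l) mm1).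
rewrite [leRHS](bigID (fun i : 'I_m'.+1 => (i < m.+1)%N)) /= -[leLHS]addr0.
apply: lerD; last by rewrite sumr_ge0// => i _; rewrite sumr_ge0.
apply: ler_sum => i _.
rewrite (big_ord_widen_cond _ (fun j => (i + j <= m)%N) (F i) mm1).
rewrite [leRHS]big_mkcond [leLHS]big_mkcond /=.
apply: ler_sum => j _; case: ifP => [/andP[ijm _]|_].
  by rewrite (leq_trans ijm mm').
by case: ifP.
Qed.

Lemma triangle_sum_lin (F G H : nat -> nat -> R) m (a : R) :
  (forall k l, (k + l <= m)%N -> F k l <= 2 * (a * G k l + H k l)) ->
  \sum_(k < m.+1) \sum_(l < m.+1 | (k + l <= m)%N) F k l <=
  2 * (a * (\sum_(k < m.+1) \sum_(l < m.+1 | (k + l <= m)%N) G k l) +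
       \sum_(k < m.+1) \sum_(l < m.+1 | (k + l <= m)%N) H k l).
Proof.
move=> FGH; rewrite mulr_sumr -big_split /= mulr_sumr.
apply: ler_sum => i _; rewrite mulr_sumr -big_split /= mulr_sumr.
by apply: ler_sum => j; exact: FGH.
Qed.

Lemma triangle_sumZ (F G : nat -> nat -> R) m (a : R) :
  (forall k l, (k + l <= m)%N -> F k l = a * G k l) ->
  \sum_(k < m.+1) \sum_(l < m.+1 | (k + l <= m)%N) F k l =
  a * \sum_(k < m.+1) \sum_(l < m.+1 | (k + l <= m)%N) G k l.
Proof.
move=> FG; rewrite mulr_sumr; apply: eq_bigr => i _.
by rewrite mulr_sumr; apply: eq_bigr => j; exact: FG.
Qed.

Lemma L2norm_wderiv_le m i j v : (i + j <= m)%N ->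
  L2norm area Om (wderiv Om i j v) <= Hnorm Om m v.
Proof.
move=> ijm; rewrite -ler_sqr ?nnegrE ?L2norm_ge0 ?Hnorm_ge0// Hnorm_sqr.
apply: (@triangle_sum_ge (fun i j => L2norm area Om (wderiv Om i j v) ^+ 2)) => //.
by move=> k l; exact: sqr_ge0.
Qed.

Lemma L2norm_le_Hnorm m v : in_H Om m v -> L2norm area Om v <= Hnorm Om m v.
Proof.
move=> Hv; have L2d : in_L2 area Om (wderiv Om 0 0 v) by exact: wderiv_in_L2 Hv _.
rewrite -(L2norm_ae L2d Hv.1 (wderiv00 Hv)); exact: L2norm_wderiv_le.
Qed.

Lemma Hnorm_le m m' v : (m <= m')%N -> Hnorm Om m v <= Hnorm Om m' v.
Proof.
move=> mm'; rewrite -ler_sqr ?nnegrE ?Hnorm_ge0// !Hnorm_sqr.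
apply: (@triangle_sum_le (fun i j => L2norm area Om (wderiv Om i j v) ^+ 2)) => //.
by move=> k l; exact: sqr_ge0.
Qed.

Lemma Hnorm_sqr_le_lin m (a : R) v u w :
  (forall i j, (i + j <= m)%N -> L2norm area Om (wderiv Om i j v) ^+ 2 <=
     2 * (a * L2norm area Om (wderiv Om i j u) ^+ 2 +
          L2norm area Om (wderiv Om i j w) ^+ 2)) ->
  Hnorm Om m v ^+ 2 <= 2 * (a * Hnorm Om m u ^+ 2 + Hnorm Om m w ^+ 2).
Proof.
move=> h.
have subst3 (x x' y y' z z' : R) : x = x' -> y = y' -> z = z' ->
  x' <= 2 * (a * y' + z') -> x <= 2 * (a * y + z) by move=> -> -> ->.
apply: (subst3 _ _ _ _ _ _ (Hnorm_sqr m v) (Hnorm_sqr m u) (Hnorm_sqr m w)).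
apply: (@triangle_sum_lin
  (fun i j => L2norm area Om (wderiv Om i j v) ^+ 2)
  (fun i j => L2norm area Om (wderiv Om i j u) ^+ 2)
  (fun i j => L2norm area Om (wderiv Om i j w) ^+ 2)).
exact: h.
Qed.

Lemma Hnorm_sqr_eqZ m (a : R) v u :
  (forall i j, (i + j <= m)%N -> L2norm area Om (wderiv Om i j v) ^+ 2 =
     a * L2norm area Om (wderiv Om i j u) ^+ 2) ->
  Hnorm Om m v ^+ 2 = a * Hnorm Om m u ^+ 2.
Proof.
move=> h.
have subst2 (x x' y y' : R) : x = x' -> y = y' -> x' = a * y' -> x = a * y.
  by move=> -> ->.
apply: (subst2 _ _ _ _ (Hnorm_sqr m v) (Hnorm_sqr m u)).
apply: (@triangle_sumZ
  (fun i j => L2norm area Om (wderiv Om i j v) ^+ 2)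
  (fun i j => L2norm area Om (wderiv Om i j u) ^+ 2)).
exact: h.
Qed.

Lemma Hnorm_sqr_lin m (a : R[i]) u w : in_H Om m u -> in_H Om m w ->
  Hnorm Om m (fun p => a * u p + w p) ^+ 2 <=
  2 * (sqmod a * Hnorm Om m u ^+ 2 + Hnorm Om m w ^+ 2).
Proof.
move=> Hu Hw; apply: Hnorm_sqr_le_lin => i j ijm.
have L2u := wderiv_in_L2 Hu ijm; have L2w := wderiv_in_L2 Hw ijm.
have L2l := in_L2_lin mOm a L2u L2w.
rewrite (L2norm_ae (wderiv_in_L2 (in_H_lin a Hu Hw) ijm) L2l (wderiv_lin a Hu Hw ijm)).
rewrite -(L2norm_sqrZ mOm a L2u); apply: (L2norm_sqrD mOm) => //.
exact: (in_L2Z mOm).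
Qed.

Lemma is_weak_deriv0 i j : is_weak_deriv Om i j (fun=> 0) (fun=> 0).
Proof.
split; first exact: in_L2_cst.
have E (f : R * R -> R) : cintegral area Om (fun p => 0 * (f p)%:C) = 0 :> R[i].
  under eq_cintegral do rewrite mul0r.
  by rewrite /cintegral /= /Rintegral integral0.
by move=> phi _; rewrite !E mulr0.
Qed.

Lemma in_H0 m : in_H Om m (fun=> 0).
Proof.
split; first exact: in_L2_cst.
by move=> i j _; exists (fun=> 0); exact: is_weak_deriv0.
Qed.

Lemma Hnorm_null m v : in_H Om m v -> {ae area, forall p, Om p -> v p = 0} ->
  Hnorm Om m v = 0.
Proof.
move=> Hv v0; apply/eqP; rewrite -sqrf_eq0 Hnorm_sqr; apply/eqP.
apply: big1 => i _; apply: big1 => j ijm.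
have [L20 d0] := in_H0 m.
have d0v : is_weak_deriv Om i j v (fun=> 0).
  apply: is_weak_deriv_ae (is_weak_deriv0 i j) => //; first by case: Hv.
  by apply: (@filterS _ _ ae_filter) v0 => p + Omp => ->.
rewrite (L2norm_ae (wderiv_in_L2 Hv ijm) L20 (wderivE Hv ijm d0v)).
by rewrite L2norm0 expr0n.
Qed.

Lemma sqr_eq_sqrt (s x y : R) : 0 <= s -> 0 <= x -> 0 <= y ->
  x ^+ 2 = s * y ^+ 2 -> x = Num.sqrt s * y.
Proof.
move=> s0 x0 y0 xy; apply/eqP; rewrite -(eqrXn2 (n := 2))//; last first.
  by rewrite mulr_ge0 ?sqrtr_ge0.
by rewrite exprMn sqr_sqrtr// xy.
Qed.

Lemma HnormZ m (a : R[i]) v : in_H Om m v ->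
  Hnorm Om m (fun p => a * v p) = Num.sqrt (sqmod a) * Hnorm Om m v.
Proof.
move=> Hv; apply: sqr_eq_sqrt; [exact: sqmod_ge0|exact: Hnorm_ge0|exact: Hnorm_ge0|].
apply: Hnorm_sqr_eqZ => i j ijm.
have Hav : in_H Om m (fun p => a * v p).
  have := in_H_lin a Hv (in_H0 m).
  by congr in_H; apply/funext => p; rewrite addr0.
have L2v := wderiv_in_L2 Hv ijm.
rewrite -(L2norm_sqrZ mOm a L2v); congr (_ ^+ 2).
apply: L2norm_ae; [exact: wderiv_in_L2 ijm|exact: (in_L2Z mOm)|].
have [L20 _] := in_H0 m.
apply: (wderivE Hav ijm).
have := is_weak_deriv_lin a Hv.1 L20 (wderivP Hv ijm)
  (is_weak_deriv0 i j).
by congr is_weak_deriv; apply/funext => p; rewrite addr0.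
Qed.

Lemma sqr_le_quasi (x y z : R) : 0 <= y -> 0 <= z ->
  x ^+ 2 <= 2 * (y ^+ 2 + z ^+ 2) -> x <= 2 * (y + z).
Proof.
move=> y0 z0 h; apply: ler_sqr_imp; first by rewrite mulr_ge0// addr_ge0.
by apply: le_trans h _; have := mulr_ge0 y0 z0; nra.
Qed.

Lemma HnormD m u w : in_H Om m u -> in_H Om m w ->
  Hnorm Om m (fun p => u p + w p) <= 2 * (Hnorm Om m u + Hnorm Om m w).
Proof.
move=> Hu Hw; have := Hnorm_sqr_lin 1 Hu Hw.
have -> : (fun p => 1 * u p + w p) = (fun p => u p + w p).
  by apply/funext => p; rewrite mul1r.
rewrite [sqmod 1]sqmod_real expr1n mul1r => h.
by apply: sqr_le_quasi h; exact: Hnorm_ge0.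
Qed.

Lemma in_HB m u w : in_H Om m u -> in_H Om m w -> in_H Om m (fun p => u p - w p).
Proof.
move=> Hu Hw; have := in_H_lin (-1) Hw Hu.
by congr in_H; apply/funext => p; rewrite mulN1r addrC.
Qed.

End sobolev.

(** * Fubini on products and weak derivatives of smooth functions *)

Section fubini_product.
Local Open Scope ereal_scope.
Variables (R : realType) (A B : set R).
Hypotheses (mA : measurable (A : set (measurableTypeR R)))
  (mB : measurable (B : set (measurableTypeR R))).
Implicit Types h : R * R -> \bar R.
Let AB : set (plane R) := A `*` B.

Lemma measurable_setXAB : measurable AB.
Proof. exact: measurableX. Qed.
Let mAB := measurable_setXAB.

Lemma patch_section_y h t : (fun y => (h \_ AB) (y, t)) =
  (if t \in B then (fun y => h (y, t)) \_ A else (fun=> 0)).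
Proof.
apply/funext => y; rewrite patchE in_setX /=.
by case: ifPn => [/andP[yA ->]|]; [rewrite patchE yA|
  case: (t \in B) => /=; rewrite ?andbT ?andbF// patchE => /negbTE ->].
Qed.

Lemma patch_section_t h y : (fun t => (h \_ AB) (y, t)) =
  (if y \in A then (fun t => h (y, t)) \_ B else (fun=> 0)).
Proof.
apply/funext => t; rewrite patchE in_setX /=.
by case: ifPn => [/andP[-> tB]|]; [rewrite patchE tB|
  case: (y \in A) => //= /negbTE tB; rewrite patchE tB].
Qed.

Lemma fubini_GE h : fubini_G (@lebesgue_measure R) (h \_ AB) =
  (fun t => \int[lebesgue_measure]_(y in A) h (y, t)) \_ B.
Proof.
apply/funext => t; rewrite /fubini_G patch_section_y patchE.
case: ifP => _; first by rewrite -integral_mkcond.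
by rewrite integral0.
Qed.

Lemma fubini_FE h : fubini_F (@lebesgue_measure R) (h \_ AB) =
  (fun y => \int[lebesgue_measure]_(t in B) h (y, t)) \_ A.
Proof.
apply/funext => y; rewrite /fubini_F patch_section_t patchE.
case: ifP => _; first by rewrite -integral_mkcond.
by rewrite integral0.
Qed.

Lemma fubini_y h : area.-integrable AB h -> \int[area]_(p in AB) h p =
  \int[lebesgue_measure]_(t in B) \int[lebesgue_measure]_(y in A) h (y, t).
Proof.
move=> ih; rewrite integral_mkcond -integral21_prod_meas1; last first.
  exact: (@integrable_mkcond _ _ _ area AB h mAB).1 ih.
by rewrite fubini_GE -integral_mkcond.
Qed.

Lemma fubini_t h : area.-integrable AB h -> \int[area]_(p in AB) h p =
  \int[lebesgue_measure]_(y in A) \int[lebesgue_measure]_(t in B) h (y, t).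
Proof.
move=> ih; rewrite integral_mkcond -integral12_prod_meas1; last first.
  exact: (@integrable_mkcond _ _ _ area AB h mAB).1 ih.
by rewrite fubini_FE -integral_mkcond.
Qed.

Let measurable_patch h : measurable_fun AB h -> measurable_fun setT (h \_ AB).
Proof. by move=> mh; exact: (measurable_restrictT h mAB).1 mh. Qed.

Lemma tonelli_y h : measurable_fun AB h -> (forall p, 0 <= h p) ->
  \int[area]_(p in AB) h p =
  \int[lebesgue_measure]_(t in B) \int[lebesgue_measure]_(y in A) h (y, t).
Proof.
move=> mh h0; rewrite integral_mkcond fubini_tonelli2.
- by rewrite fubini_GE -integral_mkcond.
- exact: measurable_patch.
- by move=> p; rewrite patchE; case: ifP.
Qed.

Lemma measurable_tonelli_y h : measurable_fun AB h -> (forall p, 0 <= h p) ->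
  measurable_fun B (fun t => \int[lebesgue_measure]_(y in A) h (y, t)).
Proof.
move=> mh h0.
apply/(measurable_restrictT _ mB); rewrite -fubini_GE.
apply: measurable_fun_fubini_tonelli_G; first exact: measurable_patch.
by move=> p; rewrite patchE; case: ifP.
Qed.

Lemma measurable_fubini_y h : area.-integrable AB h ->
  measurable_fun B (fun t => \int[lebesgue_measure]_(y in A) h (y, t)).
Proof.
move=> ih; apply/(measurable_restrictT _ mB); rewrite -fubini_GE.
apply: measurable_fubini_G.
exact: (@integrable_mkcond _ _ _ area AB h mAB).1 ih.
Qed.

Lemma measurable_section_y h t : measurable_fun AB h -> B t ->
  measurable_fun A (fun y => h (y, t)).
Proof.
move=> mh Bt; apply/(measurable_restrictT _ mA).
have := measurable_patch mh => /measurable_fun_pair1 => /(_ t).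
by rewrite patch_section_y mem_set.
Qed.

Lemma ae_integrable_section_y h : area.-integrable AB h ->
  {ae lebesgue_measure, forall t, B t ->
     lebesgue_measure.-integrable A (fun y => h (y, t))}.
Proof.
move=> ih; have := @ae_integrable2 _ _ _ _ R lebesgue_measure lebesgue_measure
  _ ((@integrable_mkcond _ _ _ area AB h mAB).1 ih).
apply: filterS => t + Bt; rewrite patch_section_y mem_set// => it.
exact: (@integrable_mkcond _ _ _ lebesgue_measure A _ mA).2 it.
Qed.

End fubini_product.

Section smooth_weak_derivative.
Variables (R : realType).
Implicit Types (f g : R * R -> R).

Lemma is_derive_line (V : normedModType R) (f : V -> R) (e p : V) (t : R) :
  differentiable f (t *: e + p) ->
  is_derive t (1 : R) (fun t : R => f (t *: e + p)) ('D_e f (t *: e + p)).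
Proof.
move=> df.
have E : (fun h : R => h^-1 *: (((fun t : R => f (t *: e + p)) \o shift t)
    (h *: (1 : R)) - f (t *: e + p))) =
  (fun h : R => h^-1 *: ((f \o shift (t *: e + p)) (h *: e) - f (t *: e + p))).
  apply/funext => h /=; congr (_ *: (f _ - _)).
  by rewrite [h *: (1 : R)]mulr1 scalerDl addrA.
apply: DeriveDef; first by rewrite /derivable E; exact: diff_derivable.
by rewrite /derive E.
Qed.

Lemma is_derive_section_y f x t : differentiable f (x, t) ->
  is_derive x (1 : R) (fun y => f (y, t)) ('D_((1, 0) : R * R) f (x, t)).
Proof.
have E (y : R) : (y, t) = y *: ((1, 0) : R * R) + (0, t).
  by congr pair => /=; rewrite ?[_ *: _]mulr1 ?[_ *: _]mulr0 ?addr0 ?add0r.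
rewrite E => /is_derive_line.
by under [in X in _ -> X]eq_fun do rewrite E.
Qed.

Lemma is_derive_section_t f x t : differentiable f (x, t) ->
  is_derive t (1 : R) (fun s => f (x, s)) ('D_((0, 1) : R * R) f (x, t)).
Proof.
have E (s : R) : (x, s) = s *: ((0, 1) : R * R) + (x, 0).
  by congr pair => /=; rewrite ?[_ *: _]mulr1 ?[_ *: _]mulr0 ?addr0 ?add0r.
rewrite E => /is_derive_line.
by under [in X in _ -> X]eq_fun do rewrite E.
Qed.

Lemma integral_derivative (f df : R -> R) (a b : R) : a < b ->
  (forall x : R, is_derive x (1 : R) f (df x)) -> continuous df ->
  (\int[lebesgue_measure]_(x in `]a, b[) (df x)%:E = (f b - f a)%:E)%E.
Proof.
move=> ab fdf cdf.
have cf : continuous f.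
  move=> x; apply: differentiable_continuous; apply/derivable1_diffP.
  by case: (fdf x).
rewrite -(@integral_itv_bndoo _ a b _ true false); last first.
  apply/measurable_EFinP; apply: measurable_funTS.
  exact: continuous_measurable_fun.
rewrite (@continuous_FTC2 _ df f)//.
- exact: continuous_subspaceT.
- split.
  + by move=> x _; case: (fdf x).
  + by apply: cvg_at_right_filter; exact: cf.
  + by apply: cvg_at_left_filter; exact: cf.
- by move=> x _; rewrite derive1E; case: (fdf x).
Qed.

Lemma continuous_section_y f t : continuous f -> continuous (fun y => f (y, t)).
Proof.
move=> cf y; apply: (@continuous_comp _ _ _ (fun y => (y, t)) f); last exact: cf.
by apply: (@cvg_pair _ _ _ _ (nbhs y) (nbhs t)); [exact: cvg_id|exact: cvg_cst].
Qed.

Lemma continuous_section_t f y : continuous f -> continuous (fun t => f (y, t)).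
Proof.
move=> cf t; apply: (@continuous_comp _ _ _ (fun t => (y, t)) f); last exact: cf.
by apply: (@cvg_pair _ _ _ _ (nbhs y) (nbhs t)); [exact: cvg_cst|exact: cvg_id].
Qed.

Variables (tmin tmax : R).
Hypothesis ht : tmin < tmax.
Let Om := rect tmin tmax.
Let mOm := @measurable_rect R tmin tmax.
Let Omoo := @area_rect_lty R tmin tmax.

Lemma continuous_integrable_rect f : continuous f ->
  area.-integrable Om (EFin \o f).
Proof.
move=> cf; have [M M0 fM] := continuous_bounded_rect tmin tmax cf.
apply: (le_integrable_real mOm (g := cst M)) => //.
  by apply: measurable_funTS; exact: continuous_measurable_plane.
apply: (measurable_bounded_integrable mOm Omoo); first exact: measurable_cst.
exact: bounded_cst.
Qed.

Lemma integral_derive_y f : (forall p, differentiable f p) ->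
  continuous ('D_((1, 0) : R * R) f) ->
  (forall t, f (0, t) = 0) -> (forall t, f (1, t) = 0) ->
  \int[area]_(p in Om) 'D_((1, 0) : R * R) f p = 0.
Proof.
move=> df cdf f0 f1; rewrite /Rintegral /Om rectE fubini_y//; last first.
  by rewrite -rectE; exact: continuous_integrable_rect.
rewrite integral0_eq// => t _.
have dft (x : R) : is_derive x (1 : R) (fun y => f (y, t))
    ('D_((1, 0) : R * R) f (x, t)) by exact: is_derive_section_y.
have cdft := @continuous_section_y ('D_((1, 0) : R * R) f) t cdf.
by rewrite [LHS](integral_derivative ltr01 dft cdft) f0 f1 subr0.
Qed.

Lemma integral_derive_t f : (forall p, differentiable f p) ->
  continuous ('D_((0, 1) : R * R) f) ->
  (forall y, f (y, tmin) = 0) -> (forall y, f (y, tmax) = 0) ->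
  \int[area]_(p in Om) 'D_((0, 1) : R * R) f p = 0.
Proof.
move=> df cdf f0 f1; rewrite /Rintegral /Om rectE fubini_t//; last first.
  by rewrite -rectE; exact: continuous_integrable_rect.
rewrite integral0_eq// => y _.
have dfy (s : R) : is_derive s (1 : R) (fun t => f (y, t))
    ('D_((0, 1) : R * R) f (y, s)) by exact: is_derive_section_t.
have cdfy := @continuous_section_t ('D_((0, 1) : R * R) f) y cdf.
by rewrite [LHS](integral_derivative ht dfy cdfy) f0 f1 subr0.
Qed.

Lemma continuousM_real f g : continuous f -> continuous g ->
  continuous (fun p => f p * g p).
Proof. by move=> cf cg p; apply: cvgM; [exact: cf|exact: cg]. Qed.

Lemma continuousD_real f g : continuous f -> continuous g ->
  continuous (fun p => f p + g p).
Proof. by move=> cf cg p; apply: cvgD; [exact: cf|exact: cg]. Qed.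

(** Integration by parts: the product with a test function vanishes on the
    boundary, so its derivative has integral 0. *)
Lemma integration_by_parts_rect (e : R * R) f phi : smooth f -> test_fun Om phi ->
  e = (1, 0) \/ e = (0, 1) ->
  \int[area]_(p in Om) (f p * 'D_e phi p) =
  - \int[area]_(p in Om) ('D_e f p * phi p).
Proof.
move=> sf [sphi [K [_ KOm K0]]] eE.
have phi0 p : ~ Om p -> phi p = 0 by move=> nOm; apply: K0 => /KOm.
have cf := smooth_continuous sf; have cphi := smooth_continuous sphi.
have cdf := smooth_continuous (smooth_derive e sf).
have cdphi := smooth_continuous (smooth_derive e sphi).
have dE : 'D_e (fun p => f p * phi p) = (fun p => f p * 'D_e phi p + phi p * 'D_e f p).
  apply/funext => p; apply: (@deriveM _ _ f phi);
    apply: diff_derivable; exact: smooth_differentiable.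
have dfphi p : differentiable (fun p => f p * phi p) p.
  by apply: (@differentiableM _ _ f phi); exact: smooth_differentiable.
have c1 : continuous (fun p => f p * 'D_e phi p) by exact: continuousM_real.
have c2 : continuous (fun p => phi p * 'D_e f p) by exact: continuousM_real.
have cdE : continuous ('D_e (fun p => f p * phi p)).
  by rewrite dE; exact: continuousD_real.
have int0 : \int[area]_(p in Om) 'D_e (fun p => f p * phi p) p = 0.
  have out p : ~ Om p -> f p * phi p = 0 by move=> /phi0 ->; rewrite mulr0.
  case: eE cdE => -> cdE.
  - apply: integral_derive_y => // t; apply: out => -[/= ].
      by rewrite ltxx.
    by rewrite ltxx andbF.
  - apply: integral_derive_t => // y; apply: out => -[/= _].
      by rewrite ltxx.
    by rewrite ltxx andbF.
apply/eqP; rewrite -subr_eq0 opprK; apply/eqP; rewrite -[RHS]int0 dE.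
rewrite (RintegralD mOm); try exact: continuous_integrable_rect.
by congr (_ + _); apply: eq_Rintegral => p _; rewrite mulrC.
Qed.

Definition cderive (e : R * R) (phi : R * R -> R[i]) (p : R * R) : R[i] :=
  'D_e (fun q => complex.Re (phi q)) p +i* 'D_e (fun q => complex.Im (phi q)) p.

Lemma continuous_in_L2 (v : R * R -> R[i]) :
  continuous (fun p => complex.Re (v p)) ->
  continuous (fun p => complex.Im (v p)) -> in_L2 area Om v.
Proof.
move=> cr ci; apply/in_L2P; split.
  by split; apply: measurable_funTS; exact: continuous_measurable_plane.
apply: continuous_integrable_rect.
by apply: continuousD_real; [move=> p; apply: cvgM; exact: cr|
  move=> p; apply: cvgM; exact: ci].
Qed.

Lemma csmooth_cderive_in_L2 e v : csmooth v -> in_L2 area Om (cderive e v).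
Proof.
move=> [sr si]; apply: continuous_in_L2.
- exact: (smooth_continuous (smooth_derive e sr)).
- exact: (smooth_continuous (smooth_derive e si)).
Qed.

Lemma csmooth_in_L2 v : csmooth v -> in_L2 area Om v.
Proof. by move=> [sr si]; apply: continuous_in_L2; exact: smooth_continuous. Qed.

Let by_parts_complex e v phi : csmooth v -> test_fun Om phi ->
  e = (1, 0) \/ e = (0, 1) ->
  cintegral area Om (fun p => v p * ('D_e phi p)%:C) =
  - cintegral area Om (fun p => cderive e v p * (phi p)%:C).
Proof.
move=> [sr si] tphi eE; rewrite -[RHS]/(_ +i* _); congr Complex.
- transitivity (\int[area]_(p in Om) (complex.Re (v p) * 'D_e phi p)).
    by apply: eq_Rintegral => p _; rewrite cReM /= mulr0 subr0.
  rewrite (integration_by_parts_rect sr)//; congr (- _).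
  by apply: eq_Rintegral => p _; rewrite cReM /= mulr0 subr0.
- transitivity (\int[area]_(p in Om) (complex.Im (v p) * 'D_e phi p)).
    by apply: eq_Rintegral => p _; rewrite cImM /= mulr0 add0r.
  rewrite (integration_by_parts_rect si)//; congr (- _).
  by apply: eq_Rintegral => p _; rewrite cImM /= mulr0 add0r.
Qed.

Lemma csmooth_weak_deriv_y v : csmooth v -> is_weak_deriv Om 1 0 v (cderive (1, 0) v).
Proof.
move=> sv; split; first exact: csmooth_cderive_in_L2.
by move=> phi tphi; rewrite /= expr1 mulN1r by_parts_complex//; left.
Qed.

Lemma csmooth_weak_deriv_t v : csmooth v -> is_weak_deriv Om 0 1 v (cderive (0, 1) v).
Proof.
move=> sv; split; first exact: csmooth_cderive_in_L2.
by move=> phi tphi; rewrite /= expr1 mulN1r by_parts_complex//; right.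
Qed.

Lemma csmooth_in_H1 v : csmooth v -> in_H Om 1 v.
Proof.
move=> sv; split; first exact: csmooth_in_L2.
move=> [|[|i]] [|[|j]]//= _.
- by exists v; apply: is_weak_deriv00; exact: csmooth_in_L2.
- by exists (cderive (0, 1) v); exact: csmooth_weak_deriv_t.
- by exists (cderive (1, 0) v); exact: csmooth_weak_deriv_y.
Qed.

End smooth_weak_derivative.

(** * The trace on the side y = 1 *)

Section trace_one.
Variables (R : realType) (tmin tmax : R).
Let Om := rect tmin tmax.
Let I01 : set (measurableTypeR R) := `]0, 1[.
Let J : set (measurableTypeR R) := `]tmin, tmax[.
Implicit Types (u v w : R * R -> R[i]) (a : R[i]).

Let mOm := @measurable_rect R tmin tmax.
Let Omoo := @area_rect_lty R tmin tmax.
Let ae_filter := ae_filter_ringOfSetsType (area : {measure set (plane R) -> \bar R}).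

Let ae_filter1 := ae_filter_ringOfSetsType
  (lebesgue_measure : {measure set (measurableTypeR R) -> \bar R}).

Let mI01 : measurable I01. Proof. exact: measurable_itv. Qed.
Let mJ : measurable J. Proof. exact: measurable_itv. Qed.

Let I01_1 : lebesgue_measure I01 = 1%E.
Proof. by rewrite /I01 lebesgue_measure_itv /= lte_fin ltr01 oppr0 adde0. Qed.

Let I01_oo : (lebesgue_measure I01 < +oo)%E.
Proof. by rewrite I01_1 ltry. Qed.

(** Integrate 2 m f - m^2 <= f^2, where m is the mean of f. *)
Lemma sqr_Rintegral01 (f : R -> R) :
  lebesgue_measure.-integrable I01 (EFin \o f) ->
  lebesgue_measure.-integrable I01 (EFin \o (fun y => f y ^+ 2)) ->
  (\int[lebesgue_measure]_(y in I01) f y) ^+ 2 <=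
  \int[lebesgue_measure]_(y in I01) (f y ^+ 2).
Proof.
move=> If If2; set m := (X in X ^+ 2 <= _).
have Ic (k : R) : lebesgue_measure.-integrable I01 (EFin \o cst k).
  apply: (measurable_bounded_integrable mI01 I01_oo); first exact: measurable_cst.
  exact: bounded_cst.
have -> : m ^+ 2 = \int[lebesgue_measure]_(y in I01) ((2 * m) * f y + - m ^+ 2).
  rewrite (RintegralD mI01 (integrableZ_real mI01 _ If) (Ic _)).
  rewrite (RintegralZl _ mI01 If) (Rintegral_cst _ mI01).
  rewrite (_ : fine (lebesgue_measure I01) = 1); last by rewrite I01_1.
  by rewrite -[RHS]/(2 * m * m + - m ^+ 2 * 1); ring.
apply: (le_Rintegral mI01) => //.
  exact: (integrableD_real mI01 (integrableZ_real mI01 _ If) (Ic _)).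
by move=> y _; have := sqr_ge0 (f y - m); rewrite sqrrB; lra.
Qed.

(** Stated in the extended reals, the bound covers the sections that are not
    square-integrable. *)
Lemma sqmod_cintegral01 (f : R -> R[i]) : cmeasurable I01 f ->
  ((sqmod (cintegral lebesgue_measure I01 f))%:E <=
   \int[lebesgue_measure]_(y in I01) (sqmod (f y))%:E)%E.
Proof.
move=> mf.
have m2 : measurable_fun I01 (fun y => (sqmod (f y))%:E).
  by apply/measurable_EFinP; exact: cmeasurable_sqmod.
have [foo|] := ltP (\int[lebesgue_measure]_(y in I01) (sqmod (f y))%:E)%E +oo%E; last first.
  by rewrite leye_eq => /eqP ->; rewrite leey.
have L2f : in_L2 lebesgue_measure I01 f.
  apply/in_L2P; split => //; apply/integrableP; split => //.
  by under eq_integral do rewrite gee0_abs ?lee_fin ?sqmod_ge0//.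
have [Ir Ii] := in_L2_cintegrable mI01 I01_oo L2f.
have [mr mi If2] := L2f.
have Ir2 : lebesgue_measure.-integrable I01
    (EFin \o (fun y => complex.Re (f y) ^+ 2)).
  apply: (le_integrable_real mI01 _ _ If2); first exact: measurable_funX.
  by move=> y _; rewrite ger0_norm ?sqr_ge0// Re_sqr_le.
have Ii2 : lebesgue_measure.-integrable I01
    (EFin \o (fun y => complex.Im (f y) ^+ 2)).
  apply: (le_integrable_real mI01 _ _ If2); first exact: measurable_funX.
  by move=> y _; rewrite ger0_norm ?sqr_ge0// Im_sqr_le.
rewrite -[leRHS]fineK ?(integrable_fin_num mI01)// lee_fin.
rewrite -[leRHS]/(\int[lebesgue_measure]_(y in I01) sqmod (f y)).
rewrite (RintegralD mI01 Ir2 Ii2); apply: lerD; exact: sqr_Rintegral01.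
Qed.

Definition yint w (t : R) : R[i] :=
  cintegral lebesgue_measure I01 (fun y => w (y, t)).

Let L2_AB w : in_L2 area Om w -> in_L2 area (I01 `*` J) w.
Proof. by rewrite /Om rectE. Qed.

Lemma cmeasurable_section w t : in_L2 area Om w -> J t ->
  cmeasurable I01 (fun y => w (y, t)).
Proof.
move=> /L2_AB[mr mi _] Jt; split; apply/measurable_EFinP.
- apply: (@measurable_section_y R I01 J mI01 mJ
    (fun p => (complex.Re (w p))%:E)) => //; exact/measurable_EFinP.
- apply: (@measurable_section_y R I01 J mI01 mJ
    (fun p => (complex.Im (w p))%:E)) => //; exact/measurable_EFinP.
Qed.

Lemma cmeasurable_yint w : in_L2 area Om w -> cmeasurable J (yint w).
Proof.
move=> L2w; have := in_L2_cintegrable mOm Omoo L2w.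
rewrite /Om rectE => -[Ir Ii]; split.
- apply: (measurableT_comp (fine_measurable measurableT)).
  exact: (measurable_fubini_y mI01 mJ Ir).
- apply: (measurableT_comp (fine_measurable measurableT)).
  exact: (measurable_fubini_y mI01 mJ Ii).
Qed.

(** Integration over y is a contraction of L^2 because the side has
    length 1. *)
Lemma yint_sqmod_le w : in_L2 area Om w ->
  (\int[lebesgue_measure]_(t in J) (sqmod (yint w t))%:E <=
   \int[area]_(p in Om) (sqmod (w p))%:E)%E.
Proof.
move=> L2w; have /L2_AB[mr mi _] := L2w.
have m2 : measurable_fun (I01 `*` J) (fun p => (sqmod (w p))%:E).
  by apply/measurable_EFinP; apply: cmeasurable_sqmod; split.
have w0 p : (0 <= (sqmod (w p))%:E)%E by rewrite lee_fin sqmod_ge0.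
rewrite /Om rectE (tonelli_y mI01 mJ m2 w0).
apply: ge0_le_integral => //.
- by move=> t _; rewrite lee_fin sqmod_ge0.
- by apply/measurable_EFinP; apply: cmeasurable_sqmod; exact: cmeasurable_yint.
- exact: (measurable_tonelli_y mI01 mJ m2 w0).
- by move=> t Jt; apply: sqmod_cintegral01; exact: cmeasurable_section.
Qed.

Lemma yint_in_L2 w : in_L2 area Om w -> in_L2 lebesgue_measure J (yint w).
Proof.
move=> L2w; apply/in_L2P; split; first exact: cmeasurable_yint.
apply/integrableP; split.
  by apply/measurable_EFinP; apply: cmeasurable_sqmod; exact: cmeasurable_yint.
under eq_integral do rewrite gee0_abs ?lee_fin ?sqmod_ge0//.
apply: le_lt_trans (yint_sqmod_le L2w) _.
have [_ _ If2] := L2w; have := integrable_fin_num mOm If2.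
by rewrite ge0_fin_numE// integral_ge0// => p _; rewrite lee_fin sqmod_ge0.
Qed.

Lemma L2norm_yint w : in_L2 area Om w ->
  L2norm lebesgue_measure J (yint w) <= L2norm area Om w.
Proof.
move=> L2w; have [_ _ If2] := L2w; have [_ _ Ig2] := yint_in_L2 L2w.
apply: ler_wsqrtr; apply: fine_le (yint_sqmod_le L2w).
- exact: (integrable_fin_num mJ Ig2).
- exact: (integrable_fin_num mOm If2).
Qed.

Lemma ae_cintegrable_section w : in_L2 area Om w ->
  {ae lebesgue_measure, forall t, J t ->
    cintegrable lebesgue_measure I01 (fun y => w (y, t))}.
Proof.
move=> L2w; have := in_L2_cintegrable mOm Omoo L2w.
rewrite /Om rectE => -[Ir Ii].
have rt := ae_integrable_section_y mI01 mJ Ir.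
have it := ae_integrable_section_y mI01 mJ Ii.
apply: (@filterS2 _ _ ae_filter1) rt it => t rt it Jt.
by split; [exact: rt|exact: it].
Qed.

Lemma yint_lin a u w : in_L2 area Om u -> in_L2 area Om w ->
  {ae lebesgue_measure, forall t, J t ->
    yint (fun p => a * u p + w p) t = a * yint u t + yint w t}.
Proof.
move=> /ae_cintegrable_section iu /ae_cintegrable_section iw.
by apply: (@filterS2 _ _ ae_filter1) iu iw => t iu iw Jt; apply: (cintegral_lin mI01); auto.
Qed.

Lemma yint_ae u w : in_L2 area Om u -> in_L2 area Om w ->
  {ae area, forall p, Om p -> u p = w p} ->
  {ae lebesgue_measure, forall t, J t -> yint u t = yint w t}.
Proof.
move=> L2u L2w uw.
have L2d : in_L2 area Om (fun p => -1 * u p + w p) by exact: (in_L2_lin mOm).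
have d0 : {ae area, forall p, Om p -> -1 * u p + w p = 0}.
  by apply: (@filterS _ _ ae_filter) uw => p + Omp => ->; rewrite ?mulN1r ?addNr.
have : L2norm lebesgue_measure J (yint (fun p => -1 * u p + w p)) = 0.
  apply/eqP; rewrite eq_le L2norm_ge0 andbT.
  apply: le_trans (L2norm_yint L2d) _.
  by rewrite (L2norm_ae L2d (in_L2_0 area mOm) d0) L2norm0.
move/(L2norm_eq0 mJ (yint_in_L2 L2d)).
apply: (@filterS2 _ _ ae_filter1) (yint_lin (-1) L2u L2w) => t lin z Jt.
have := z Jt; rewrite lin// mulN1r addrC => /eqP.
by rewrite subr_eq0 => /eqP.
Qed.

End trace_one.

Lemma csmooth_curve_in_L2 (R : realType) (gam : R -> R * R) (a b : R)
    (phi : R * R -> R[i]) : continuous gam -> csmooth phi ->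
  in_L2 lebesgue_measure (`]a, b[ : set (measurableTypeR R))
    (fun t => phi (gam t)).
Proof.
move=> cgam [sr si]; pose r (t : R) := complex.Re (phi (gam t)).
pose i (t : R) := complex.Im (phi (gam t)).
have cr : continuous r.
  move=> t; apply: (@continuous_comp _ _ _ gam (fun p => complex.Re (phi p))).
    exact: cgam.
  exact: smooth_continuous.
have ci : continuous i.
  move=> t; apply: (@continuous_comp _ _ _ gam (fun p => complex.Im (phi p))).
    exact: cgam.
  exact: smooth_continuous.
have c2 : continuous (fun t : R => r t * r t + i t * i t).
  by move=> t; apply: cvgD; apply: cvgM; [exact: cr|exact: cr|exact: ci|exact: ci].
have mI : measurable (`]a, b[ : set (measurableTypeR R)) by exact: measurable_itv.
have Ioo : (lebesgue_measure (`]a, b[ : set (measurableTypeR R)) < +oo)%E.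
  by rewrite lebesgue_measure_itv /=; case: ifP => _; rewrite ?ltry// -EFinB ltry.
have [M M0 fM] := compact_bounded (segment_compact (a := a) (b := b)) c2.
apply: (in_L2_le mI (g := cst M)).
- by split; apply: measurable_funTS; exact: continuous_measurable_fun.
- move=> t; rewrite /= in_itv /= => /andP[t1 t2].
  apply: le_trans (_ : r t * r t + i t * i t <= _); first by rewrite /sqmod !expr2.
  by apply: le_trans (ler_norm _) (fM t _); rewrite /= in_itv /= !ltW.
- apply: (measurable_bounded_integrable mI Ioo); first exact: measurable_cst.
  exact: bounded_cst.
Qed.

Section trace_operator.
Variables (R : realType) (tmin tmax : R).
Hypothesis ht : tmin < tmax.
Let Om := rect tmin tmax.
Let J : set (measurableTypeR R) := `]tmin, tmax[.
Implicit Types (u v w : R * R -> R[i]) (a : R[i]).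

Let mOm := @measurable_rect R tmin tmax.
Let mJ : measurable J. Proof. exact: measurable_itv. Qed.
Let ae_filter := ae_filter_ringOfSetsType (area : {measure set (plane R) -> \bar R}).
Let ae_filter1 := ae_filter_ringOfSetsType
  (lebesgue_measure : {measure set (measurableTypeR R) -> \bar R}).

Let y_le1 p : Om p -> p.1 ^+ 2 <= 1.
Proof.
by move=> [/andP[y0 y1] _]; rewrite expr_le1// ltW.
Qed.

Let continuous_fst : continuous (fst : R * R -> R).
Proof. by move=> p; exact: cvg_fst. Qed.

Lemma y_mul_in_L2 w : in_L2 area Om w -> in_L2 area Om (fun p => (p.1)%:C * w p).
Proof.
move=> L2w; have := in_L2_mul_continuous continuous_fst L2w.
by congr in_L2; apply/funext => p; rewrite mulrC.
Qed.

Lemma L2norm_y_mul w : in_L2 area Om w ->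
  L2norm area Om (fun p => (p.1)%:C * w p) <= L2norm area Om w.
Proof.
move=> L2w; have [_ _ Iy] := y_mul_in_L2 L2w; have [_ _ Iw] := L2w.
rewrite -ler_sqr ?nnegrE ?L2norm_ge0// !L2norm_sqr.
apply: (le_Rintegral mOm Iy Iw) => p Omp.
by rewrite sqmodM sqmod_real ler_piMl ?sqmod_ge0// y_le1.
Qed.

(** For smooth v, v(1,t) = int_0^1 d/dy (y v(y,t)) dy; the right-hand side is
    defined, linear and L^2-continuous in v on all of H^1. *)
Definition trace_density v p : R[i] := (p.1)%:C * wderiv Om 1 0 v p + v p.

Definition trace_op v : R -> R[i] := yint (trace_density v).

Lemma trace_density_in_L2 v : in_H Om 1 v -> in_L2 area Om (trace_density v).
Proof.
move=> Hv; apply: (in_L2D mOm); last by case: Hv.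
by apply: y_mul_in_L2; exact: wderiv_in_L2 Hv _.
Qed.

Lemma L2norm_trace_density v : in_H Om 1 v ->
  L2norm area Om (trace_density v) <= 4 * Hnorm Om 1 v.
Proof.
move=> Hv; have L2d := wderiv_in_L2 Hv (isT : (1 + 0 <= 1)%N).
have := L2norm_sqrD mOm (y_mul_in_L2 L2d) Hv.1.
move/(sqr_le_quasi (L2norm_ge0 _ _ _) (L2norm_ge0 _ _ _)) => h.
apply: le_trans h _.
have h1 := le_trans (L2norm_y_mul L2d) (L2norm_wderiv_le tmin tmax v (isT : (1 + 0 <= 1)%N)).
have h2 := L2norm_le_Hnorm Hv.
have := lerD h1 h2; lra.
Qed.

Lemma trace_density_lin a u w : in_H Om 1 u -> in_H Om 1 w ->
  {ae area, forall p, Om p ->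
    trace_density (fun q => a * u q + w q) p =
    a * trace_density u p + trace_density w p}.
Proof.
move=> Hu Hw.
have := wderiv_lin a Hu Hw (isT : (1 + 0 <= 1)%N).
apply: (@filterS _ _ ae_filter) => p lin Omp.
by rewrite /trace_density lin//; ring.
Qed.

Lemma trace_op_in_L2 v : in_H Om 1 v -> in_L2 lebesgue_measure J (trace_op v).
Proof. by move=> Hv; apply: yint_in_L2; exact: trace_density_in_L2. Qed.

Lemma trace_op_lin a u w : in_H Om 1 u -> in_H Om 1 w ->
  {ae lebesgue_measure, forall t, J t ->
    trace_op (fun q => a * u q + w q) t = a * trace_op u t + trace_op w t}.
Proof.
move=> Hu Hw; have L2u := trace_density_in_L2 Hu.
have L2w := trace_density_in_L2 Hw.
have L2l := trace_density_in_L2 (in_H_lin a Hu Hw).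
have e1 := yint_ae L2l (in_L2_lin mOm a L2u L2w) (trace_density_lin a Hu Hw).
have e2 := yint_lin a L2u L2w.
by apply: (@filterS2 _ _ ae_filter1) e1 e2 => t e1 e2 Jt; rewrite /trace_op e1// e2.
Qed.

Lemma L2norm_trace_op v : in_H Om 1 v ->
  L2norm lebesgue_measure J (trace_op v) <= 4 * Hnorm Om 1 v.
Proof.
move=> Hv; apply: le_trans (L2norm_trace_density Hv).
exact/L2norm_yint/trace_density_in_L2.
Qed.

Let integral_section (f : R * R -> R) t :
  (forall p, differentiable f p) -> continuous f ->
  continuous ('D_((1, 0) : R * R) f) ->
  \int[lebesgue_measure]_(y in `]0, 1[) (y * 'D_((1, 0) : R * R) f (y, t) + f (y, t))
  = f (1, t).
Proof.
move=> dif cf cdf.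
have dft (x : R) : is_derive x (1 : R) (fun y => y * f (y, t))
    (x * 'D_((1, 0) : R * R) f (x, t) + f (x, t)).
  apply: is_derive_eq (is_deriveM (is_derive_id x (1 : R))
    (is_derive_section_y (dif (x, t)))) _.
  by rewrite /GRing.scale /= mulr1.
have cdft : continuous (fun y : R => y * 'D_((1, 0) : R * R) f (y, t) + f (y, t)).
  move=> y; apply: cvgD; last exact: continuous_section_y.
  apply: cvgM; first exact: cvg_id.
  exact: (@continuous_section_y _ ('D_((1, 0) : R * R) f)).
rewrite /Rintegral (integral_derivative ltr01 dft cdft) /=.
by rewrite mul1r mul0r subr0.
Qed.

(** For smooth functions the weak derivative is the classical one, and the
    formula defining the trace is the fundamental theorem of calculus. *)
Lemma trace_op_smooth phi : csmooth phi ->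
  {ae lebesgue_measure, forall t, J t -> trace_op phi t = phi (1, t)}.
Proof.
move=> sphi; have Hphi := csmooth_in_H1 ht sphi.
have L2d := csmooth_cderive_in_L2 tmin tmax (1, 0) sphi.
have L2phi := csmooth_in_L2 tmin tmax sphi.
pose psi p : R[i] := (p.1)%:C * cderive (1, 0) phi p + phi p.
have L2psi : in_L2 area Om psi.
  by apply: (in_L2D mOm) => //; exact: y_mul_in_L2.
have e : {ae area, forall p, Om p -> trace_density phi p = psi p}.
  have := wderivE Hphi (isT : (1 + 0 <= 1)%N) (csmooth_weak_deriv_y ht sphi).
  by apply: (@filterS _ _ ae_filter) => p + Omp => /(_ Omp); rewrite /trace_density => ->.
have := yint_ae (trace_density_in_L2 Hphi) L2psi e.
apply: (@filterS _ _ ae_filter1) => t + Jt => /(_ Jt).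
rewrite /trace_op => ->; have [sr si] := sphi.
rewrite /yint /cintegral; apply: complex_eqP => /=.
- rewrite -(integral_section t (fun p => smooth_differentiable p sr)
    (smooth_continuous sr) (smooth_continuous (smooth_derive ((1, 0) : R * R) sr))).
  by apply: eq_Rintegral => y _; rewrite cReD cReM /= mul0r subr0.
- rewrite -(integral_section t (fun p => smooth_differentiable p si)
    (smooth_continuous si) (smooth_continuous (smooth_derive ((1, 0) : R * R) si))).
  by apply: eq_Rintegral => y _; rewrite cImD cImM /= mul0r addr0.
Qed.

Lemma csmooth_side_in_L2 (phi : R * R -> R[i]) : csmooth phi ->
  in_L2 lebesgue_measure J (fun t => phi (1, t)).
Proof.
apply: (@csmooth_curve_in_L2 R (fun t => (1, t))) => t.
by apply: (@cvg_pair _ _ _ _ (nbhs (1 : R)) (nbhs t)); [exact: cvg_cst|exact: cvg_id].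
Qed.

Lemma L2norm_trace_error (phi : R * R -> R[i]) v : csmooth phi -> in_H Om 1 v ->
  L2norm lebesgue_measure J (fun t => phi (1, t) - trace_op v t) <=
  4 * Hnorm Om 1 (fun p => phi p - v p).
Proof.
move=> sphi Hv; have Hphi := csmooth_in_H1 ht sphi.
have Hd := in_HB Hphi Hv.
apply: le_trans (L2norm_trace_op Hd).
have E : (fun p => phi p - v p) = (fun p => -1 * v p + phi p).
  by apply/funext => p; rewrite mulN1r addrC.
rewrite le_eqVlt; apply/orP; left; apply/eqP.
apply: (ae_L2norm mJ).
- by have /in_L2P[] := in_L2B mJ (csmooth_side_in_L2 sphi) (trace_op_in_L2 Hv).
- by have /in_L2P[] := trace_op_in_L2 Hd.
- rewrite E; apply: (@filterS2 _ _ ae_filter1) (trace_op_lin (-1) Hv Hphi)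
    (trace_op_smooth sphi) => t e1 e2 Jt.
  by rewrite e1// e2// mulN1r addrC.
Qed.

Lemma eq0_of_le_cvg0 (x : R) (e : nat -> R) : 0 <= x -> (forall n, x <= e n) ->
  e n @[n --> \oo] --> (0 : R) -> x = 0.
Proof.
move=> x0 xe e0.
have h : x @[n --> \oo] --> (0 : R).
  apply: (@squeeze_cvgr _ _ _ _ (cst 0) e) => //; last exact: cvg_cst.
  by apply: nearW => n; rewrite x0 xe.
by rewrite -(cvg_lim (@Rhausdorff R) h) lim_cst.
Qed.

Lemma cvgZ0 (k : R) (e : nat -> R) :
  e n @[n --> \oo] --> (0 : R) -> k * e n @[n --> \oo] --> (0 : R).
Proof.
move=> e0; have : k * e n @[n --> \oo] --> k * 0.
  by apply: cvgM; [exact: cvg_cst|].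
by rewrite mulr0.
Qed.

(** The trace inequality makes phi n (1, .) converge to trace_op v as soon as
    phi n converges to v in H^1. *)
Lemma trace_op_is_trace v (phi : nat -> R * R -> R[i]) : in_H Om 1 v ->
  (forall n, csmooth (phi n)) ->
  Hnorm Om 1 (fun p => phi n p - v p) @[n --> \oo] --> (0 : R) ->
  is_trace Om (fun t => (1, t)) J v (trace_op v).
Proof.
move=> Hv sphi phiv; split => //; first exact: trace_op_in_L2.
exists phi; split => //.
apply: (@squeeze_cvgr _ _ _ _ (cst 0)
  (fun n => 4 * Hnorm Om 1 (fun p => phi n p - v p))).
- by apply: nearW => n; rewrite L2norm_ge0 L2norm_trace_error.
- exact: cvg_cst.
- exact: cvgZ0.
Qed.

(** The restrictions of the approximating functions converge in L^2 both to g
    and to trace_op v. *)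
Lemma trace_unique v g : is_trace Om (fun t => (1, t)) J v g ->
  {ae lebesgue_measure, forall t, J t -> g t = trace_op v t}.
Proof.
move=> [Hv L2g [phi [sphi phiv phig]]].
have L2T := trace_op_in_L2 Hv; have L2d := in_L2B mJ L2g L2T.
suff : L2norm lebesgue_measure J (fun t => g t - trace_op v t) = 0.
  move/(L2norm_eq0 mJ L2d); apply: (@filterS _ _ ae_filter1) => t + Jt.
  by move=> /(_ Jt)/eqP; rewrite subr_eq0 => /eqP.
apply: (@eq0_of_le_cvg0 _ (fun n =>
  2 * (L2norm lebesgue_measure J (fun t => phi n (1, t) - g t) +
       4 * Hnorm Om 1 (fun p => phi n p - v p)))); first exact: L2norm_ge0.
  move=> n; have L2n := csmooth_side_in_L2 (sphi n).
  have L2ng := in_L2B mJ L2n L2g; have L2nT := in_L2B mJ L2n L2T.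
  have L2gn := in_L2Z mJ (-1) L2ng.
  have e1 : L2norm lebesgue_measure J (fun t => -1 * (phi n (1, t) - g t)) =
      L2norm lebesgue_measure J (fun t => phi n (1, t) - g t).
    congr Num.sqrt; apply: eq_Rintegral => t _.
    rewrite sqmodM (_ : sqmod (-1) = 1) ?mul1r//.
    by rewrite /sqmod /= oppr0 expr0n addr0 sqrrN expr1n.
  have := L2norm_sqrD mJ L2gn L2nT.
  move/(sqr_le_quasi (L2norm_ge0 _ _ _) (L2norm_ge0 _ _ _)); rewrite e1.
  have -> : (fun t => -1 * (phi n (1, t) - g t) + (phi n (1, t) - trace_op v t)) =
            (fun t => g t - trace_op v t).
    by apply/funext => t; ring.
  move=> h; apply: le_trans h _; rewrite ler_pM2l// lerD2l.
  exact: L2norm_trace_error.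
apply: cvgZ0; rewrite -[X in _ --> X](addr0 (0 : R)); apply: cvgD => //.
exact: cvgZ0.
Qed.

End trace_operator.

(** * Families of bounded sesquilinear forms, differentiable in a parameter *)

Section form_family.
Variables (R : realType) (V : lmodType R[i]) (H : set V) (N : V -> R) (I : set R).
Hypotheses (sH : subspace H) (qN : quasinorm_on H N).
Implicit Types B Bd : R -> V -> V -> R[i].

(** A single constant serves uniformly in the parameter; in the last clause it
    stands for a bound on the second derivative of B. *)
Definition form_family B Bd : Prop := exists2 M, 0 <= M &
  [/\ forall r, I r -> sesquilinear_on H (B r) /\ bounded_on H N M (B r),
      forall r, I r -> sesquilinear_on H (Bd r) /\ bounded_on H N M (Bd r)
    & forall s r, I s -> I r -> s != r -> bounded_on H N (M * `|s - r|)
        (fun v w => ((s - r)^-1)%:C * (B s v w - B r v w) - Bd r v w)].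

Lemma sesquilinearD (B1 B2 : V -> V -> R[i]) :
  sesquilinear_on H B1 -> sesquilinear_on H B2 ->
  sesquilinear_on H (fun v w => B1 v w + B2 v w).
Proof.
move=> [l1 r1] [l2 r2]; split=> a u v w Hu Hv Hw.
- by rewrite l1// l2//; ring.
- by rewrite r1// r2//; ring.
Qed.

Lemma sesquilinearZ (z : R[i]) (B : V -> V -> R[i]) :
  sesquilinear_on H B -> sesquilinear_on H (fun v w => z * B v w).
Proof.
move=> [l1 r1]; split=> a u v w Hu Hv Hw.
- by rewrite l1//; ring.
- by rewrite r1//; ring.
Qed.

Lemma sesquilinear_ext (B1 B2 : V -> V -> R[i]) :
  (forall v w, H v -> H w -> B1 v w = B2 v w) ->
  sesquilinear_on H B1 -> sesquilinear_on H B2.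
Proof.
move=> E [l1 r1].
have Hl a u v : H u -> H v -> H (a *: u + v) by move=> Hu Hv; apply: sH.2.
by split=> a u v w Hu Hv Hw; rewrite -!E//; [apply: l1|apply: Hl|apply: r1|apply: Hl].
Qed.

Lemma bounded_onD (B1 B2 : V -> V -> R[i]) M1 M2 :
  bounded_on H N M1 B1 -> bounded_on H N M2 B2 ->
  bounded_on H N (M1 + M2) (fun v w => B1 v w + B2 v w).
Proof.
move=> b1 b2 v w Hv Hw; rewrite cReD !mulrDl.
by apply: lerD; [exact: b1|exact: b2].
Qed.

Lemma bounded_onZ (z : R[i]) (B : V -> V -> R[i]) M :
  sesquilinear_on H B -> bounded_on H N M B ->
  bounded_on H N (Num.sqrt (sqmod z) * M) (fun v w => z * B v w).
Proof.
move=> sB bB v w Hv Hw; rewrite -(sesquilinear_onZ z sH sB Hv Hw).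
apply: le_trans (bB _ _ (subspaceZ z sH Hv) Hw) _.
by case: qN => _ -> // _; rewrite mulrCA mulrA.
Qed.

Lemma bounded_on_ext (B1 B2 : V -> V -> R[i]) M :
  (forall v w, H v -> H w -> B1 v w = B2 v w) ->
  bounded_on H N M B1 -> bounded_on H N M B2.
Proof. by move=> E b v w Hv Hw; rewrite -E//; apply: b. Qed.

Lemma form_familyD B1 B1d B2 B2d : form_family B1 B1d -> form_family B2 B2d ->
  form_family (fun r v w => B1 r v w + B2 r v w)
              (fun r v w => B1d r v w + B2d r v w).
Proof.
move=> [M1 M10 [b1 d1 t1]] [M2 M20 [b2 d2 t2]].
exists (M1 + M2); first exact: addr_ge0.
split=> [r Ir|r Ir|s r Is Ir sr].
- have [s1 bd1] := b1 _ Ir; have [s2 bd2] := b2 _ Ir.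
  by split; [exact: sesquilinearD|exact: bounded_onD].
- have [s1 bd1] := d1 _ Ir; have [s2 bd2] := d2 _ Ir.
  by split; [exact: sesquilinearD|exact: bounded_onD].
- rewrite mulrDl; apply: bounded_on_ext (bounded_onD (t1 _ _ Is Ir sr) (t2 _ _ Is Ir sr)).
  by move=> v w _ _ /=; ring.
Qed.

Lemma form_familyZ (z : R[i]) B Bd : form_family B Bd ->
  form_family (fun r v w => z * B r v w) (fun r v w => z * Bd r v w).
Proof.
move=> [M M0 [b d t]]; exists (Num.sqrt (sqmod z) * M).
  by rewrite mulr_ge0// sqrtr_ge0.
split=> [r Ir|r Ir|s r Is Ir sr].
- by have [s1 b1] := b _ Ir; split; [exact: sesquilinearZ|exact: bounded_onZ].
- by have [s1 b1] := d _ Ir; split; [exact: sesquilinearZ|exact: bounded_onZ].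
- have sd : sesquilinear_on H
      (fun v w => ((s - r)^-1)%:C * (B s v w - B r v w) - Bd r v w).
    apply: (@sesquilinear_ext (fun v w => ((s - r)^-1)%:C *
      (B s v w + -1 * B r v w) + -1 * Bd r v w)).
      by move=> v w _ _; rewrite !mulN1r.
    apply: sesquilinearD; last by apply: sesquilinearZ; case: (d _ Ir).
    apply: sesquilinearZ; apply: sesquilinearD; first by case: (b _ Is).
    by apply: sesquilinearZ; case: (b _ Ir).
  rewrite -mulrA; apply: bounded_on_ext (bounded_onZ z sd (t _ _ Is Ir sr)).
  by move=> v w _ _ /=; ring.
Qed.

Lemma form_family_ext B1 B2 Bd :
  (forall r v w, I r -> H v -> H w -> B1 r v w = B2 r v w) ->
  form_family B1 Bd -> form_family B2 Bd.
Proof.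
move=> E [M M0 [b d t]]; exists M => //; split=> [r Ir||s r Is Ir sr] //.
- have [s1 b1] := b _ Ir; split.
    by apply: sesquilinear_ext s1 => v w; exact: E.
  by apply: bounded_on_ext b1 => v w; exact: E.
- by apply: bounded_on_ext (t _ _ Is Ir sr) => v w Hv Hw; rewrite !E.
Qed.

End form_family.

Section weighted_form.
Context d (T : measurableType d) (R : realType).
Variable mu : {measure set T -> \bar R}.
Variables (A : set T) (mA : measurable A).
Variables (V : lmodType R[i]) (H : set V) (N : V -> R).
Hypotheses (sH : subspace H) (qN : quasinorm_on H N).
Let ae_filter := ae_filter_ringOfSetsType mu.

(** Linearity can only be asked almost everywhere: weak derivatives and traces
    are chosen representatives. *)
Definition L2_operator (P : V -> T -> R[i]) : Prop :=
  [/\ forall v, H v -> in_L2 mu A (P v),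
      forall a u v, H u -> H v ->
        {ae mu, forall x, A x -> P (a *: u + v) x = a * P u x + P v x}
    & exists2 K, 0 <= K & forall v, H v -> L2norm mu A (P v) <= K * N v].

Definition weighted_form (P Q : V -> T -> R[i]) (c : T -> R) (v w : V) : R[i] :=
  cintegral mu A (fun x => (c x)%:C * P v x * (Q w x)^*%C).

Variables (P Q : V -> T -> R[i]).
Hypotheses (oP : L2_operator P) (oQ : L2_operator Q).

Definition bounded_weight (k : R) (c : T -> R) : Prop :=
  [/\ 0 <= k, measurable_fun A c & forall x, A x -> `|c x| <= k].

Let weightE k c : bounded_weight k c ->
  [/\ 0 <= k, cmeasurable A (fun x => (c x)%:C)
    & forall x, A x -> sqmod (c x)%:C <= k ^+ 2].
Proof.
move=> [k0 mc ck]; split => // x Ax.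
by rewrite sqmod_real -real_normK ?num_real// ler_pXn2r ?nnegrE// ck.
Qed.

Lemma cintegrable_form k c v w : bounded_weight k c -> H v -> H w ->
  cintegrable mu A (fun x => (c x)%:C * P v x * (Q w x)^*%C).
Proof.
move=> /weightE[k0 mc ck] Hv Hw; case: oP oQ => L2P _ _ [L2Q _ _].
exact: (cintegrable_weighted mA k0 mc ck (L2P _ Hv) (L2Q _ Hw)).
Qed.

Let cmeasurable_form k c (f g : T -> R[i]) : bounded_weight k c ->
  in_L2 mu A f -> in_L2 mu A g ->
  cmeasurable A (fun x => (c x)%:C * f x * (g x)^*%C).
Proof.
move=> /weightE[_ mc _] /in_L2P[mf _] /in_L2P[mg _].
exact: (cmeasurableM (cmeasurableM mc mf) (cmeasurableJ mg)).
Qed.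

Lemma weighted_form_sesquilinear k c : bounded_weight k c ->
  sesquilinear_on H (weighted_form P Q c).
Proof.
move=> wc; have [L2P linP _] := oP; have [L2Q linQ _] := oQ.
split=> a u v w Hu Hv Hw; rewrite /weighted_form.
- have Huv : H (a *: u + v) by exact: sH.2.
  rewrite -(cintegral_lin mA); [|exact: cintegrable_form wc _ _..].
  apply: (ae_cintegral mA).
  + exact: cmeasurable_form wc (L2P _ Huv) (L2Q _ Hw).
  + apply: cmeasurableD; last exact: cmeasurable_form wc (L2P _ Hv) (L2Q _ Hw).
    apply: cmeasurableM; first exact: cmeasurable_cst.
    exact: cmeasurable_form wc (L2P _ Hu) (L2Q _ Hw).
  + apply: (@filterS _ _ ae_filter) (linP a _ _ Hu Hv) => x lin Ax.
    by rewrite lin//; ring.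
- have Huv : H (a *: u + v) by exact: sH.2.
  rewrite -(cintegral_lin mA); [|exact: cintegrable_form wc _ _..].
  apply: (ae_cintegral mA).
  + exact: cmeasurable_form wc (L2P _ Hw) (L2Q _ Huv).
  + apply: cmeasurableD; last exact: cmeasurable_form wc (L2P _ Hw) (L2Q _ Hv).
    apply: cmeasurableM; first exact: cmeasurable_cst.
    exact: cmeasurable_form wc (L2P _ Hw) (L2Q _ Hu).
  + apply: (@filterS _ _ ae_filter) (linQ a _ _ Hu Hv) => x lin Ax.
    by rewrite lin// rmorphD rmorphM /=; ring.
Qed.

Lemma weighted_form_bounded : exists2 K, 0 <= K &
  forall k c, bounded_weight k c -> bounded_on H N (K * k) (weighted_form P Q c).
Proof.
have [L2P _ [K1 K10 bP]] := oP; have [L2Q _ [K2 K20 bQ]] := oQ.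
exists (K1 * K2); first exact: mulr_ge0.
move=> k c wc v w Hv Hw; have [k0 mc ck] := weightE wc.
apply: le_trans (cintegral_weighted_le mA k0 mc ck (L2P _ Hv) (L2Q _ Hw)) _.
have -> : K1 * K2 * k * N v * N w = k * (K1 * N v) * (K2 * N w) by ring.
case: qN => N0 _ _; apply: ler_pM; rewrite ?mulr_ge0 ?L2norm_ge0 ?bQ//.
by rewrite ler_wpM2l// bP.
Qed.

Lemma weighted_form_weight_lin k1 k2 c1 c2 (a : R) v w :
  bounded_weight k1 c1 -> bounded_weight k2 c2 -> H v -> H w ->
  weighted_form P Q (fun x => a * c1 x + c2 x) v w =
  a%:C * weighted_form P Q c1 v w + weighted_form P Q c2 v w.
Proof.
move=> w1 w2 Hv Hw; rewrite /weighted_form.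
rewrite -(cintegral_lin mA); last 2 first.
- exact: cintegrable_form w1 Hv Hw.
- exact: cintegrable_form w2 Hv Hw.
by apply: eq_cintegral => x _; rewrite rmorphD rmorphM /=; ring.
Qed.

Lemma bounded_weight_lin k1 k2 c1 c2 (a : R) :
  bounded_weight k1 c1 -> bounded_weight k2 c2 ->
  bounded_weight (`|a| * k1 + k2) (fun x => a * c1 x + c2 x).
Proof.
move=> [k10 m1 b1] [k20 m2 b2]; split=> [||x Ax].
- by rewrite addr_ge0// mulr_ge0.
- apply: measurable_funD => //; apply: measurable_funM => //; exact: measurable_cst.
- apply: le_trans (ler_normD _ _) _; rewrite normrM.
  by apply: lerD; [rewrite ler_wpM2l// b1|exact: b2].
Qed.

(** The form is linear in its weight, so that its increments in the parameter
    are the forms weighted by the increments of the coefficient. *)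
Lemma weighted_form_family (I : set R) (c cd : R -> T -> R) k :
  (forall r, I r -> bounded_weight k (c r)) ->
  (forall r, I r -> bounded_weight k (cd r)) ->
  (forall s r x, I s -> I r -> s != r -> A x ->
     `|(s - r)^-1 * (c s x - c r x) - cd r x| <= k * `|s - r|) ->
  form_family H N I (fun r => weighted_form P Q (c r))
                    (fun r => weighted_form P Q (cd r)).
Proof.
move=> wc wd tay; have [K K0 bd] := weighted_form_bounded.
have [Iex|Iex] := pselect (exists r, I r); last first.
  by exists 0 => //; split=> [r Ir|r Ir|s r _ Ir]; case: Iex; exists r.
have k0 : 0 <= k by case: Iex => r /wc[].
exists (K * k); first exact: mulr_ge0.
split=> [r Ir|r Ir|s r Is Ir sr].
- by split; [exact: weighted_form_sesquilinear (wc _ Ir)|exact: bd (wc _ Ir)].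
- by split; [exact: weighted_form_sesquilinear (wd _ Ir)|exact: bd (wd _ Ir)].
- pose rho := (s - r)^-1.
  pose dd x := (-2) * cd r x + cd r x.
  pose e1 x := - rho * c r x + dd x.
  pose e x := rho * c s x + e1 x.
  have wdd := bounded_weight_lin (-2) (wd _ Ir) (wd _ Ir).
  have we1 := bounded_weight_lin (- rho) (wc _ Ir) wdd.
  have we : bounded_weight (k * `|s - r|) e.
    have [_ me _] := bounded_weight_lin rho (wc _ Is) we1.
    split => // [|x Ax]; first exact: mulr_ge0.
    have -> : e x = (s - r)^-1 * (c s x - c r x) - cd r x.
      by rewrite /e /e1 /dd /rho; ring.
    exact: tay.
  rewrite -mulrA; apply: bounded_on_ext (bd _ _ we) => v w Hv Hw.
  rewrite (weighted_form_weight_lin rho (wc _ Is) we1)//.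
  rewrite (weighted_form_weight_lin (- rho) (wc _ Ir) wdd)//.
  rewrite (weighted_form_weight_lin (-2) (wd _ Ir) (wd _ Ir))//.
  by rewrite !rmorphN /= rmorph_nat; ring.
Qed.

End weighted_form.

(** * Smooth coefficients *)

Section coefficients.
Variables (R : realType) (W : normedModType R) (X : set W) (rmin rmax : R).
Hypothesis cX : compact X.
Let box : set (R * W) := [set q | rmin <= q.1 <= rmax /\ X q.2].

Let compact_box : compact box.
Proof.
have -> : box = `[rmin, rmax] `*` X.
  by apply/seteqP; split=> -[r x]; rewrite /= in_itv.
by apply: compact_setX => //; exact: segment_compact.
Qed.

Definition param_derive (G : R * W -> R) : R * W -> R := 'D_((1, 0) : R * W) G.

Let is_derive_param (G : R * W -> R) (s : R) x : smooth G ->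
  is_derive s (1 : R) (fun s => G (s, x)) (param_derive G (s, x)).
Proof.
have E (s' : R) : (s', x) = s' *: ((1, 0) : R * W) + (0, x).
  by congr pair => /=; rewrite ?scaler0 ?add0r// [_ *: _]mulr1 addr0.
move=> sG; have := is_derive_line (smooth_differentiable (s *: ((1, 0) : R * W) + (0, x)) sG).
rewrite -E /param_derive; congr (is_derive _ _ _ _).
by apply/funext => s'; rewrite -E.
Qed.

Let mvt (g dg : R -> R) (s r : R) : (forall x : R, is_derive x (1 : R) g (dg x)) ->
  exists x, [/\ Num.min s r <= x <= Num.max s r, `|x - r| <= `|s - r|
    & g s - g r = dg x * (s - r)].
Proof.
move=> gdg.
have cg : continuous g.
  move=> x; apply: differentiable_continuous; apply/derivable1_diffP.
  by case: (gdg x).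
have [sr|rs|->] := ltgtP s r.
- have [|x xI E] := MVT sr (fun x _ => gdg x); first exact: continuous_subspaceT.
  move: xI; rewrite in_itv /= => /andP[sx xr]; exists x; split.
  + by rewrite !ltW.
  + by rewrite distrC (distrC s) !ger0_norm; lra.
  + by rewrite -[LHS]opprB E; ring.
- have [|x xI E] := MVT rs (fun x _ => gdg x); first exact: continuous_subspaceT.
  move: xI; rewrite in_itv /= => /andP[rx xs]; exists x; split.
  + by rewrite !ltW.
  + by rewrite !ger0_norm; lra.
  + by rewrite E.
- by exists r; rewrite !subrr normr0 mulr0 ?minxx ?maxxx lexx.
Qed.

Let in_between (s r x : R) : rmin <= s <= rmax -> rmin <= r <= rmax ->
  Num.min s r <= x <= Num.max s r -> rmin <= x <= rmax.
Proof.
move=> /andP[s1 s2] /andP[r1 r2] /andP[x1 x2]; apply/andP; split.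
- by apply: le_trans x1; rewrite le_min s1.
- by apply: le_trans x2 _; rewrite ge_max s2.
Qed.

(** Taylor's formula, with the second derivative bounded by compactness. *)
Lemma coefficient_bounds (G : R * W -> R) : smooth G ->
  exists2 k, 0 <= k & forall r x, rmin <= r <= rmax -> X x ->
    [/\ `|G (r, x)| <= k, `|param_derive G (r, x)| <= k
      & forall s, rmin <= s <= rmax -> s != r ->
        `|(s - r)^-1 * (G (s, x) - G (r, x)) - param_derive G (r, x)| <=
        k * `|s - r|].
Proof.
move=> sG; have sG1 := smooth_derive ((1, 0) : R * W) sG.
have sG2 := smooth_derive ((1, 0) : R * W) sG1.
have [k0 k00 b0] := compact_bounded compact_box (smooth_continuous sG).
have [k1 k10 b1] := compact_bounded compact_box (smooth_continuous sG1).
have [k2 k20 b2] := compact_bounded compact_box (smooth_continuous sG2).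
exists (k0 + k1 + k2); first by rewrite !addr_ge0.
move=> r x Ir Xx; have bx : box (r, x) by [].
split=> [||s Is sr].
- by apply: le_trans (b0 _ bx) _; lra.
- by apply: le_trans (b1 _ bx) _; lra.
have [y [yI yr E]] := mvt s r (fun s => is_derive_param s x sG).
have [z [zI _ E']] := mvt y r (fun s => is_derive_param s x sG1).
have Iy := in_between Is Ir yI; have Iz := in_between Iy Ir zI.
rewrite E mulrCA mulVf ?subr_eq0// mulr1 [X in `|X|]E' normrM.
apply: ler_pM => //; apply: le_trans (b2 (z, x) _) _; first by [].
by rewrite lerDr addr_ge0.
Qed.

End coefficients.

(** * The energy space *)

Section smooth_combinations.
Variable R : realType.

(** The combinations of two smooth functions are stable under directional
    differentiation. *)
Lemma smooth_lin (V : normedModType R) (f g : V -> R) (a b : R) :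
  smooth f -> smooth g -> smooth (fun x => a * f x + b * g x).
Proof.
move=> sf sg s x.
have [f' [g' [sf' sg' ->]]] : exists f' g', [/\ smooth f', smooth g' &
    foldr (fun e h => 'D_e h) (fun x => a * f x + b * g x) s =
    (fun x => a * f' x + b * g' x)].
  elim: s => [|e s [f' [g' [sf' sg' E]]]]; first by exists f, g.
  exists ('D_e f'), ('D_e g'); split; [exact: smooth_derive|exact: smooth_derive|].
  rewrite /= E; apply/funext => y.
  have df : derivable f' y e by apply: diff_derivable; exact: smooth_differentiable.
  have dg : derivable g' y e by apply: diff_derivable; exact: smooth_differentiable.
  rewrite (@deriveD _ _ _ (a \*: f') (b \*: g')); [|exact: derivableZ|exact: derivableZ].
  by rewrite !deriveZ.
have df : differentiable (a \*: f') x.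
  by apply: differentiableZ; exact: smooth_differentiable.
have dg : differentiable (b \*: g') x.
  by apply: differentiableZ; exact: smooth_differentiable.
exact: (@differentiableD _ _ _ (a \*: f') (b \*: g')).
Qed.

Lemma csmooth_lin (a : R[i]) (u w : R * R -> R[i]) : csmooth u -> csmooth w ->
  csmooth (fun p => a * u p + w p).
Proof.
move=> [ur ui] [wr wi]; split.
- have := smooth_lin 1 1 (smooth_lin (complex.Re a) (- complex.Im a) ur ui) wr.
  by congr smooth; apply/funext => p; rewrite cReD cReM; ring.
- have := smooth_lin 1 1 (smooth_lin (complex.Re a) (complex.Im a) ui ur) wi.
  by congr smooth; apply/funext => p; rewrite cImD cImM; ring.
Qed.

Lemma csmooth0 : csmooth (fun _ : R * R => 0 : R[i]).
Proof. by split; apply: bump_algebra_smooth; exact: Bump_cst. Qed.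

End smooth_combinations.

Section energy_space.
Variables (R : realType) (tmin tmax : R).
Hypothesis ht : tmin < tmax.
Let Om := rect tmin tmax.
Implicit Types (u v w : R * R -> R[i]).
Let ae_filter1 := ae_filter_ringOfSetsType
  (lebesgue_measure : {measure set (measurableTypeR R) -> \bar R}).

Lemma cvg0_quasi (k : R) (e f g : nat -> R) : (forall n, 0 <= e n) ->
  (forall n, e n <= 2 * (k * f n + g n)) ->
  f n @[n --> \oo] --> (0 : R) -> g n @[n --> \oo] --> (0 : R) ->
  e n @[n --> \oo] --> (0 : R).
Proof.
move=> e0 efg f0 g0.
apply: (@squeeze_cvgr _ _ _ _ (cst 0) (fun n => 2 * (k * f n + g n))).
- by apply: nearW => n; rewrite e0 efg.
- exact: cvg_cst.
- apply: cvgZ0; rewrite -[X in _ --> X](addr0 (0 : R)); apply: cvgD => //.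
  exact: cvgZ0.
Qed.

Lemma is_trace_lin (gam : R -> R * R) (c e : R) (a : R[i]) u w g1 g2 :
  continuous gam ->
  is_trace Om gam (`]c, e[ : set (measurableTypeR R)) u g1 ->
  is_trace Om gam (`]c, e[ : set (measurableTypeR R)) w g2 ->
  is_trace Om gam (`]c, e[ : set (measurableTypeR R))
    (fun p => a * u p + w p) (fun t => a * g1 t + g2 t).
Proof.
move=> cgam [Hu L1 [phi [sphi phiu phig]]] [Hw L2 [psi [spsi psiw psig]]].
have mJ : measurable (`]c, e[ : set (measurableTypeR R)) by exact: measurable_itv.
split; [exact: in_H_lin|exact: in_L2_lin|].
exists (fun n p => a * phi n p + psi n p); split.
- by move=> n; exact: csmooth_lin.
- apply: (cvg0_quasi (k := Num.sqrt (sqmod a))) phiu psiw => n.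
    exact: Hnorm_ge0.
  have H1 := in_HB (csmooth_in_H1 ht (sphi n)) Hu.
  have H2 := in_HB (csmooth_in_H1 ht (spsi n)) Hw.
  have -> : (fun p => a * phi n p + psi n p - (a * u p + w p)) =
      (fun p => a * (phi n p - u p) + (psi n p - w p)).
    by apply/funext => p; ring.
  rewrite -(HnormZ a H1); apply: HnormD => //.
  have := in_H_lin a H1 (in_H0 tmin tmax 1).
  by congr in_H; apply/funext => p; rewrite addr0.
- apply: (cvg0_quasi (k := Num.sqrt (sqmod a))) phig psig => n.
    exact: L2norm_ge0.
  have L1n := in_L2B mJ (csmooth_curve_in_L2 c e cgam (sphi n)) L1.
  have L2n := in_L2B mJ (csmooth_curve_in_L2 c e cgam (spsi n)) L2.
  have -> : (fun t => a * phi n (gam t) + psi n (gam t) - (a * g1 t + g2 t)) =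
      (fun t => a * (phi n (gam t) - g1 t) + (psi n (gam t) - g2 t)).
    by apply/funext => t; ring.
  have := L2norm_sqrD mJ (in_L2Z mJ a L1n) L2n.
  move/(sqr_le_quasi (L2norm_ge0 _ _ _) (L2norm_ge0 _ _ _)) => h.
  apply: le_trans h _; rewrite ler_pM2l// lerD2r le_eqVlt; apply/orP; left.
  apply/eqP; apply: sqr_eq_sqrt; rewrite ?sqmod_ge0 ?L2norm_ge0//.
  exact: (L2norm_sqrZ mJ a L1n).
Qed.

Lemma is_trace0 (gam : R -> R * R) (c e : R) :
  is_trace Om gam (`]c, e[ : set (measurableTypeR R)) (fun=> 0) (fun=> 0).
Proof.
have mJ : measurable (`]c, e[ : set (measurableTypeR R)) by exact: measurable_itv.
have H0 := in_H0 tmin tmax 1.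
split; [exact: in_H0|exact: in_L2_0|].
exists (fun _ _ => 0); split; first by move=> _; exact: csmooth0.
- have -> : (fun p : R * R => 0 - 0) = (fun=> 0 : R[i]).
    by apply/funext => p; rewrite subr0.
  apply: cvg_near_cst; apply: nearW => _; apply: Hnorm_null => //.
  by apply: aeW.
- have -> : (fun t : R => 0 - 0) = (fun=> 0 : R[i]).
    by apply/funext => p; rewrite subr0.
  by apply: cvg_near_cst; apply: nearW => _; exact: L2norm0.
Qed.

Lemma in_H10_subspace : @subspace R (R * R -> R[i]) (in_H10 tmin tmax).
Proof.
have cy0 : continuous (fun t : R => (0 : R, t)).
  by move=> t; apply: (@cvg_pair _ _ _ _ (nbhs (0 : R)) (nbhs t));
    [exact: cvg_cst|exact: cvg_id].
have ct (t : R) : continuous (fun y : R => (y, t)).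
  by move=> y; apply: (@cvg_pair _ _ _ _ (nbhs y) (nbhs t));
    [exact: cvg_id|exact: cvg_cst].
split; first by split; [exact: in_H0|exact: is_trace0..].
move=> a u w [Hu u0 u1 u2] [Hw w0 w1 w2].
have E : (fun t : R => a * 0 + 0) = (fun=> 0) by apply/funext => t; rewrite mulr0 addr0.
split; first exact: in_H_lin.
- by have := is_trace_lin a cy0 u0 w0; rewrite E.
- by have := is_trace_lin a (ct tmin) u1 w1; rewrite E.
- by have := is_trace_lin a (ct tmax) u2 w2; rewrite E.
Qed.

Lemma in_H10_H1 v : in_H10 tmin tmax v -> in_H Om 1 v.
Proof. by case. Qed.

Lemma in_H10_quasinorm :
  @quasinorm_on R (R * R -> R[i]) (in_H10 tmin tmax) (Hnorm Om 1).
Proof.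
split.
- by move=> v _; exact: Hnorm_ge0.
- by move=> a v /in_H10_H1 Hv; exact: (HnormZ a Hv).
- by move=> u v /in_H10_H1 Hu /in_H10_H1 Hv; exact: HnormD.
Qed.

Local Notation L2_op mu A P :=
  (@L2_operator _ _ R mu A (R * R -> R[i]) (in_H10 tmin tmax) (Hnorm Om 1) P).

Lemma id_operator : L2_op area Om id.
Proof.
split; first by move=> v /in_H10_H1[].
- by move=> a u v _ _; apply: aeW.
- by exists 1 => // v /in_H10_H1 Hv; rewrite mul1r; exact: L2norm_le_Hnorm.
Qed.

Lemma wderiv_operator i j : (i + j <= 1)%N -> L2_op area Om (wderiv Om i j).
Proof.
move=> ij; split.
- by move=> v /in_H10_H1 Hv; exact: wderiv_in_L2 Hv ij.
- by move=> a u v /in_H10_H1 Hu /in_H10_H1 Hv; exact: (wderiv_lin a Hu Hv ij).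
- by exists 1 => // v Hv; rewrite mul1r; exact: L2norm_wderiv_le.
Qed.

Let J : set (measurableTypeR R) := `]tmin, tmax[.
Let mJ : measurable J. Proof. exact: measurable_itv. Qed.

(** The smooth functions converging to v in H^1 come from the trace condition
    on the side y = 0. *)
Lemma trace1_is_trace v : in_H10 tmin tmax v ->
  is_trace Om (fun t => (1, t)) J v (trace1 tmin tmax v).
Proof.
move=> [Hv [_ _ [phi [sphi phiv _]]] _ _].
apply: (@xgetI _ _ _ (trace_op tmin tmax v)).
exact: (trace_op_is_trace ht Hv sphi phiv).
Qed.

Lemma trace1E v : in_H10 tmin tmax v ->
  {ae lebesgue_measure, forall t, J t -> trace1 tmin tmax v t = trace_op tmin tmax v t}.
Proof. by move=> Hv; apply: (trace_unique ht); exact: trace1_is_trace. Qed.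

Lemma trace1_operator : L2_op lebesgue_measure J (trace1 tmin tmax).
Proof.
have L2t v : in_H10 tmin tmax v -> in_L2 lebesgue_measure J (trace1 tmin tmax v).
  by move=> /trace1_is_trace[].
split; first exact: L2t.
- move=> a u v Hu Hv; have Huv := in_H10_subspace.2 a u v Hu Hv.
  have e1 := trace1E Hu; have e2 := trace1E Hv; have e3 := trace1E Huv.
  have lin := trace_op_lin a (in_H10_H1 Hu) (in_H10_H1 Hv).
  have e12 := @filterI _ _ ae_filter1 _ _ e1 e2.
  have e3l := @filterI _ _ ae_filter1 _ _ e3 lin.
  apply: (@filterS2 _ _ ae_filter1) e12 e3l => t [e1t e2t] [e3t lint] Jt.
  by rewrite e3t// e1t// e2t//; exact: lint.
- exists 4 => // v Hv.
  have /in_L2P[m1 _] := L2t _ Hv.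
  have /in_L2P[m2 _] := trace_op_in_L2 (in_H10_H1 Hv).
  rewrite (ae_L2norm mJ m1 m2 (trace1E Hv)).
  exact: L2norm_trace_op (in_H10_H1 Hv).
Qed.

End energy_space.

(** * The sesquilinear form of the problem as a differentiable family *)

Section problem_form.
Variables (R : realType) (rmin rmax tmin tmax : R).
Hypothesis ht : tmin < tmax.
Let Om := rect tmin tmax.
Let J : set (measurableTypeR R) := `]tmin, tmax[.
Let I : set R := `[rmin, rmax].
Let H := in_H10 tmin tmax.
Let N := Hnorm Om 1.
Let mOm := @measurable_rect R tmin tmax.
Let mJ : measurable J. Proof. exact: measurable_itv. Qed.
Let sH := in_H10_subspace ht.
Let qN := @in_H10_quasinorm R tmin tmax.
Implicit Types (v w : R * R -> R[i]).

Lemma smooth_cst (V : normedModType R) (c : R) : smooth (fun _ : V => c).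
Proof.
move=> s x.
have [c' ->] : exists c', foldr (fun e h => 'D_e h) (fun _ : V => c) s = cst c'.
  elim: s => [|e s [c' E]]; first by exists c.
  by exists 0; rewrite /= E; apply/funext => y; rewrite derive_cst.
exact: differentiable_cst.
Qed.

Let area_form := @weighted_form _ (plane R) R area Om (R * R -> R[i]).
Let side_form := @weighted_form _ (measurableTypeR R) R lebesgue_measure J
  (R * R -> R[i]).
Let area_op := @L2_operator _ (plane R) R area Om (R * R -> R[i]) H N.
Let side_op := @L2_operator _ (measurableTypeR R) R lebesgue_measure J
  (R * R -> R[i]) H N.

Lemma area_form_family P Q (G : R * (R * R) -> R) : smooth G ->
  area_op P -> area_op Q ->
  form_family H N I (fun r => area_form P Q (fun p => G (r, p)))
    (fun r => area_form P Q (fun p => param_derive G (r, p))).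
Proof.
move=> sG oP oQ.
have [k k0 Gk] := coefficient_bounds rmin rmax (compact_crect (tmin:=tmin) (tmax:=tmax)) sG.
have weight (F : R * (R * R) -> R) r : smooth F ->
    measurable_fun (Om : set (plane R)) (fun p => F (r, p)).
  move=> sF; apply: measurable_funTS; apply: continuous_measurable_plane => p.
  apply: (@continuous_comp _ _ _ (fun p => (r, p)) F); last exact: smooth_continuous.
  by apply: (@cvg_pair _ _ _ _ (nbhs r) (nbhs p)); [exact: cvg_cst|exact: cvg_id].
apply: (weighted_form_family mOm sH qN oP oQ (k := k)).
- move=> r Ir; split => //; first exact: (weight G).
  by move=> p /sub_rect_crect Xp; have [] := Gk r p Ir Xp.
- move=> r Ir; split => //; first by apply: (weight (param_derive G)); exact: smooth_derive.
  by move=> p /sub_rect_crect Xp; have [] := Gk r p Ir Xp.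
- move=> s r p Is Ir sr /sub_rect_crect Xp.
  by have [_ _] := Gk r p Ir Xp; apply.
Qed.

Lemma side_form_family P Q (G : R * R -> R) : smooth G ->
  side_op P -> side_op Q ->
  form_family H N I (fun r => side_form P Q (fun t => G (r, t)))
    (fun r => side_form P Q (fun t => param_derive G (r, t))).
Proof.
move=> sG oP oQ.
have [k k0 Gk] := coefficient_bounds rmin rmax
  (segment_compact (a := tmin) (b := tmax)) sG.
have JX t : J t -> `[tmin, tmax]%classic t.
  by rewrite /J /= !in_itv /= => /andP[? ?]; rewrite !ltW.
have weight (F : R * R -> R) r : smooth F ->
    measurable_fun J (fun t => F (r, t)).
  move=> sF; apply: measurable_funTS; apply: continuous_measurable_fun.
  exact: (@continuous_section_t _ F r (smooth_continuous sF)).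
apply: (weighted_form_family mJ sH qN oP oQ (k := k)).
- move=> r Ir; split => //; first exact: (weight G).
  by move=> t /JX Xt; have [] := Gk r t Ir Xt.
- move=> r Ir; split => //; first by apply: (weight (param_derive G)); exact: smooth_derive.
  by move=> t /JX Xt; have [] := Gk r t Ir Xt.
- move=> s r t Is Ir sr /JX Xt.
  by have [_ _] := Gk r t Ir Xt; apply.
Qed.

Lemma hermitian_form2 (A : 'M[R]_2) (x y : 'cV[R[i]]_2) :
  ((map_mx conjc y)^T *m (map_mx (real_complex R) A *m x)) 0 0 =
  ((A 0 0)%:C * x 0 0 * (y 0 0)^*%C + (A 0 1)%:C * x 1 0 * (y 0 0)^*%C) +
  ((A 1 0)%:C * x 0 0 * (y 1 0)^*%C + (A 1 1)%:C * x 1 0 * (y 1 0)^*%C).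
Proof.
rewrite !mxE !big_ord_recl !big_ord0 !mxE !big_ord_recl !big_ord0 !mxE !addr0.
have -> : lift ord0 ord0 = 1 :> 'I_2 by exact: val_inj.
by ring.
Qed.

Variables (D : R -> R * R -> 'M[R]_2) (b1 b2 : R -> R * R -> R)
  (lam : R -> R -> R[i]) (delta : R).
Hypothesis D_smooth : forall i j : 'I_2,
  smooth_on [set q : R * (R * R) | rmin <= q.1 <= rmax /\ crect tmin tmax q.2]
    (fun q => D q.1 q.2 i j).
Hypothesis b1_smooth :
  smooth_on [set q : R * (R * R) | rmin <= q.1 <= rmax /\ crect tmin tmax q.2]
    (fun q => b1 q.1 q.2).
Hypothesis b2_smooth :
  smooth_on [set q : R * (R * R) | rmin <= q.1 <= rmax /\ crect tmin tmax q.2]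
    (fun q => b2 q.1 q.2).
Hypothesis lam_Re_smooth :
  smooth_on [set q : R * R | rmin <= q.1 <= rmax /\ tmin <= q.2 <= tmax]
    (fun q => complex.Re (lam q.1 q.2)).
Hypothesis lam_Im_smooth :
  smooth_on [set q : R * R | rmin <= q.1 <= rmax /\ tmin <= q.2 <= tmax]
    (fun q => complex.Im (lam q.1 q.2)).

Let dy : (R * R -> R[i]) -> R * R -> R[i] := wderiv Om 1 0.
Let dt : (R * R -> R[i]) -> R * R -> R[i] := wderiv Om 0 1.
Let odt : area_op dt   := @wderiv_operator R tmin tmax _ _ (isT : (0 + 1 <= 1)%N).
Let ody : area_op dy   := @wderiv_operator R tmin tmax _ _ (isT : (1 + 0 <= 1)%N).
Let oid : area_op id := @id_operator R tmin tmax.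
Let otr : side_op (trace1 tmin tmax) := trace1_operator ht.

Let area_int P Q (G : R * (R * R) -> R) r v w : smooth G ->
  area_op P -> area_op Q -> H v -> H w ->
  cintegrable area Om (fun p => (G (r, p))%:C * P v p * (Q w p)^*%C).
Proof.
move=> sG oP oQ Hv Hw.
have cG : continuous (fun p => G (r, p)).
  move=> p; apply: (@continuous_comp _ _ _ (fun p => (r, p)) G).
    by apply: (@cvg_pair _ _ _ _ (nbhs r) (nbhs p)); [exact: cvg_cst|exact: cvg_id].
  exact: smooth_continuous.
have [k k0 Gk] := continuous_bounded_rect tmin tmax cG.
apply: (cintegrable_form mOm oP oQ (k := k)) => //; split => //.
by apply: measurable_funTS; exact: continuous_measurable_plane.
Qed.

Let side_int (G : R * R -> R) r v w : smooth G -> H v -> H w ->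
  cintegrable lebesgue_measure J (fun t => (G (r, t))%:C * trace1 tmin tmax v t *
    (trace1 tmin tmax w t)^*%C).
Proof.
move=> sG Hv Hw.
have cG := @continuous_section_t _ G r (smooth_continuous sG).
have [k k0 Gk] := compact_bounded (segment_compact (a := tmin) (b := tmax)) cG.
apply: (cintegrable_form mJ otr otr (k := k)) => //; split => //.
  by apply: measurable_funTS; exact: continuous_measurable_fun.
move=> t Jt; apply: Gk; move: Jt; rewrite /J /= !in_itv /= => /andP[? ?].
by rewrite !ltW.
Qed.

(** Every term of the form is weighted by one smooth real coefficient, after
    lam is split into its real and imaginary parts. *)
Lemma Bform_family : exists Bd,
  form_family H N I (Bform rmin rmax tmin tmax D b1 b2 lam delta) Bd.
Proof.
have [G00 s00 E00] := D_smooth 0 0; have [G01 s01 E01] := D_smooth 0 1.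
have [G10 s10 E10] := D_smooth 1 0; have [G11 s11 E11] := D_smooth 1 1.
have [g1 sg1 Eg1] := b1_smooth; have [g2 sg2 Eg2] := b2_smooth.
have [l1 sl1 El1] := lam_Re_smooth; have [l2 sl2 El2] := lam_Im_smooth.
have s1 : smooth (fun _ : R * (R * R) => 1 : R) by exact: smooth_cst.
have fD := form_familyD
  (form_familyD (area_form_family s00 ody ody) (area_form_family s01 odt ody))
  (form_familyD (area_form_family s10 ody odt) (area_form_family s11 odt odt)).
have flam := form_familyD (form_familyZ sH qN 'i%C (side_form_family sl2 otr otr))
  (side_form_family sl1 otr otr).
have fb := form_familyD (area_form_family sg1 ody oid) (area_form_family sg2 odt oid).
have fsum := form_familyD
  (form_familyZ sH qN (sigma rmin rmax tmin tmax D)%:C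
    (form_familyD fD (form_familyZ sH qN (- 'i%C)
      (form_familyD flam (form_familyZ sH qN (-1) fb)))))
  (form_familyZ sH qN delta%:C (area_form_family s1 oid oid)).
eexists; apply: form_family_ext fsum => // r v w.
rewrite /I /= in_itv /= => Ir Hv Hw; rewrite /Bform.
have box p : Om p -> rmin <= r <= rmax /\ crect tmin tmax p.
  by move/sub_rect_crect.
have -> : ip tmin tmax v w = area_form id id (fun=> 1) v w.
  by apply: eq_cintegral => p _; rewrite mul1r.
have -> : ip tmin tmax (fun p => (b1 r p)%:C * grad tmin tmax v p 0 0 +
      (b2 r p)%:C * grad tmin tmax v p 1 0) w =
    area_form dy id (fun p => g1 (r, p)) v w +
    area_form dt id (fun p => g2 (r, p)) v w.
  rewrite /area_form /weighted_form.
  have i1 := area_int r sg1 ody oid Hv Hw.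
  have i2 := area_int r sg2 odt oid Hv Hw.
  rewrite -(cintegralD mOm i1 i2).
  apply: eq_cintegral => p /box bp.
  by rewrite -(Eg1 (r, p) bp) -(Eg2 (r, p) bp) /= !mxE /= mulrDl.
have -> : cintegral lebesgue_measure J (fun t => lam r t * trace1 tmin tmax v t *
      (trace1 tmin tmax w t)^*%C) =
    'i%C * side_form (trace1 tmin tmax) (trace1 tmin tmax) (fun t => l2 (r, t)) v w +
    side_form (trace1 tmin tmax) (trace1 tmin tmax) (fun t => l1 (r, t)) v w.
  rewrite /side_form /weighted_form.
  have i1 := side_int r sl1 Hv Hw; have i2 := side_int r sl2 Hv Hw.
  rewrite -(cintegral_lin mJ _ i2 i1).
  apply: eq_cintegral => t; rewrite /J /= in_itv /= => /andP[t1 t2].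
  have bt : rmin <= r <= rmax /\ tmin <= t <= tmax by split => //; rewrite !ltW.
  rewrite -(El1 (r, t) bt) -(El2 (r, t) bt) /=.
  by rewrite {1}(complexE (lam r t)); ring.
have -> : cintegral area Om (fun p => ((map_mx conjc (grad tmin tmax w p))^T *m
      (map_mx (real_complex R) (D r p) *m grad tmin tmax v p)) 0 0) =
    (area_form dy dy (fun p => G00 (r, p)) v w +
     area_form dt dy (fun p => G01 (r, p)) v w) +
    (area_form dy dt (fun p => G10 (r, p)) v w +
     area_form dt dt (fun p => G11 (r, p)) v w).
  rewrite /area_form /weighted_form.
  have i00 := area_int r s00 ody ody Hv Hw.
  have i01 := area_int r s01 odt ody Hv Hw.
  have i10 := area_int r s10 ody odt Hv Hw.
  have i11 := area_int r s11 odt odt Hv Hw.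
  have e := cintegralD mOm (cintegrableD mOm i00 i01) (cintegrableD mOm i10 i11).
  have e0 := cintegralD mOm i00 i01; have e1 := cintegralD mOm i10 i11.
  apply: etrans (etrans e (congr2 +%R e0 e1)).
  apply: eq_cintegral => p /box bp.
  rewrite hermitian_form2 -(E00 (r, p) bp) -(E01 (r, p) bp).
  by rewrite -(E10 (r, p) bp) -(E11 (r, p) bp) /= !mxE.
have regroup (a x i y z c t : R[i]) :
  a * (x + - i * (y + -1 * z)) + c * t = a * (x - i * (y - z)) + c * t by ring.
exact: regroup.
Qed.

End problem_form.

(** * Finite element spaces and the main estimate *)

Section finite_elements.
Variables (R : realType) (tmin tmax : R).
Let Om := rect tmin tmax.
Implicit Types (u v w : R * R -> R[i]) (S : set (R * R -> R[i])).

Lemma ae_forall_ord (n : nat) (P : 'I_n -> R * R -> Prop) :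
  (forall k, {ae area, forall p, P k p}) -> {ae area, forall p, forall k, P k p}.
Proof.
move=> aeP.
pose Q (m : nat) p := forall k : 'I_n, val k = m -> P k p.
have aeQ m : {ae area, forall p, Q m p}.
  have [mn|nm] := ltnP m n.
    apply: (@filterS _ _ (ae_filter_ringOfSetsType area)) (aeP (Ordinal mn)).
    by move=> p Pp k km; rewrite (_ : k = Ordinal mn)//; exact: val_inj.
  apply: aeW => p k km; exfalso.
  by move: (ltn_ord k); rewrite -[nat_of_ord k]/(val k) km ltnNge nm.
apply: (@filterS _ _ (ae_filter_ringOfSetsType area)) (ae_foralln aeQ).
by move=> p Qp k; exact: (Qp (val k)).
Qed.

Lemma fe_space_subspace tau h S : is_fe_space tmin tmax tau h S ->
  @subspace R (R * R -> R[i]) S.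
Proof. by case=> _ [S0 SD] _ _; split. Qed.

(** More functions than generators: the coefficient matrix has a nontrivial
    left kernel. *)
Lemma fe_space_findim tau h S : is_fe_space tmin tmax tau h S ->
  @findim_on R (R * R -> R[i]) S (Hnorm Om 1).
Proof.
move=> fe; have sS := fe_space_subspace fe.
have [SH _ [n [e Se]] _] := fe; exists n => u Su.
have [c cE] := choice (fun i => Se (u i) (Su i)).
pose M : 'M[R[i]]_(n.+1, n) := \matrix_(i, k) c i k.
have kerM : kermx M != 0.
  by rewrite kermx_eq0 -row_leq_rank -ltnNge ltnS rank_leq_col.
have /rowV0Pn[x xK x0] := kerM.
have xM : x *m M = 0 by apply/sub_kermxP.
exists (fun i => x 0 i).
  apply: contrapT => nx; move/negP: x0; apply; apply/eqP/rowP => i.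
  by rewrite mxE; apply: contrapT => /eqP xi; apply: nx; exists i.
have Sx : S (\sum_i x 0 i *: u i) by exact: subspace_sum.
apply: Hnorm_null; first by case: (SH _ Sx).
apply: (@filterS _ _ (ae_filter_ringOfSetsType area)) (ae_forall_ord cE).
move=> p up Omp; rewrite fct_sumE.
transitivity (\sum_i \sum_k x 0 i * c i k * e k p).
  apply: eq_bigr => i _; rewrite -[LHS]/(x 0 i * u i p) up// mulr_sumr.
  by apply: eq_bigr => k _; rewrite mulrA.
rewrite exchange_big /= big1// => k _; rewrite -mulr_suml.
have := congr1 (fun A : 'rV_n => A 0 k) xM; rewrite !mxE => xk.
rewrite (_ : \sum_i _ = 0) ?mul0r// -[RHS]xk.
by apply: eq_bigr => i _; rewrite mxE.
Qed.

(** The infimum need not be attained, hence the margin e; the power of h lost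
    here is the weight h of the H^1 norm in the approximation property. *)
Lemma near_best_approximation tau (hstar : R) (S : R -> set (R * R -> R[i])) :
  (forall h, 0 < h <= hstar -> is_fe_space tmin tmax tau h (S h)) ->
  approx_property tmin tmax tau hstar S ->
  exists2 C, 0 <= C & forall h v (e : R), 0 < h <= hstar -> 0 < e ->
    in_H Om tau.+1 v -> in_H10 tmin tmax v ->
    exists2 chi, S h chi & Hnorm Om 1 (fun p => v p - chi p) <=
      C * h ^+ tau * Hnorm Om tau.+1 v + e.
Proof.
move=> fe [C0 C0P]; exists `|C0| => // h v e hh e0 Hv v0.
have /andP[h0 _] := hh.
have := C0P h hh tau (leqnn tau) v Hv v0; set A := [set _ | chi in _] => infA.
have SS := fe_space_subspace (fe _ hh).
have hA : has_inf A.
  split; first by eexists; exists (fun=> 0); [exact: SS.1|reflexivity].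
  exists 0 => _ [chi _ <-]; rewrite addr_ge0 ?L2norm_ge0// mulr_ge0 ?Hnorm_ge0//.
  exact: ltW.
have eh0 : 0 < h * e by rewrite mulr_gt0.
have [_ [chi Schi <-] lt] := inf_adherent eh0 hA.
exists chi => //; rewrite -(ler_pM2l h0).
have h1 := L2norm_ge0 area Om (fun p => v p - chi p).
have h2 : inf A <= `|C0| * h ^+ tau.+1 * Hnorm Om tau.+1 v.
  apply: le_trans infA _; rewrite -!mulrA ler_wpM2r ?ler_norm//.
  by rewrite mulr_ge0 ?Hnorm_ge0// exprn_ge0// ltW.
have -> : h * (`|C0| * h ^+ tau * Hnorm Om tau.+1 v + e) =
    `|C0| * h ^+ tau.+1 * Hnorm Om tau.+1 v + h * e by rewrite exprS; ring.
move: lt h1 h2; move: (L2norm _ _ _) (h * Hnorm _ _ _) (inf A) => x y z.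
move: (_ * _ * _) (h * e) => a b; lra.
Qed.

Lemma galerkin_projP (B : (R * R -> R[i]) -> (R * R -> R[i]) -> R[i]) S v :
  (exists2 u, S u & forall phi, S phi -> B u phi = B v phi) ->
  S (galerkin_proj B S v) /\
  forall phi, S phi -> B (galerkin_proj B S v) phi = B v phi.
Proof.
move=> [u Su uE].
exact: (@xgetI _ (fun=> 0) [set u | S u /\
  forall phi, S phi -> B u phi = B v phi] u (conj Su uE)).
Qed.

End finite_elements.

Lemma combine_bounds (R : realFieldType) (a b k x y e : R) :
  0 <= a -> 0 <= b -> 0 <= k -> 0 <= x -> 0 <= y -> 0 <= e ->
  a * (k * y + e / (a + b + 1)) + b * (k * x + e / (a + b + 1)) <=
  (a + b) * k * (x + y) + e.
Proof.
move=> a0 b0 k0 x0 y0 e0.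
have d0 : 0 < a + b + 1 by lra.
have he : (a + b) * (e / (a + b + 1)) <= e.
  by rewrite mulrA ler_pdivrMr// mulrC ler_wpM2l//; lra.
have p1 := mulr_ge0 (mulr_ge0 a0 k0) x0; have p2 := mulr_ge0 (mulr_ge0 b0 k0) y0.
lra.
Qed.

Theorem proposition2p4 (R : realType) (rmin rmax tmin tmax : R)
    (hr : rmin < rmax) (ht : tmin < tmax)
    (D : R -> R * R -> 'M[R]_2) (b1 b2 : R -> R * R -> R)
    (lam : R -> R -> R[i]) (delta : R)
    (D_smooth : forall i j : 'I_2,
       smooth_on [set q : R * (R * R) | rmin <= q.1 <= rmax /\ crect tmin tmax q.2]
         (fun q => D q.1 q.2 i j))
    (b1_smooth :
       smooth_on [set q : R * (R * R) | rmin <= q.1 <= rmax /\ crect tmin tmax q.2]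
         (fun q => b1 q.1 q.2))
    (b2_smooth :
       smooth_on [set q : R * (R * R) | rmin <= q.1 <= rmax /\ crect tmin tmax q.2]
         (fun q => b2 q.1 q.2))
    (lam_Re_smooth :
       smooth_on [set q : R * R | rmin <= q.1 <= rmax /\ tmin <= q.2 <= tmax]
         (fun q => complex.Re (lam q.1 q.2)))
    (lam_Im_smooth :
       smooth_on [set q : R * R | rmin <= q.1 <= rmax /\ tmin <= q.2 <= tmax]
         (fun q => complex.Im (lam q.1 q.2)))
    (D_sym : forall r p, rmin <= r <= rmax -> crect tmin tmax p ->
       (D r p)^T = D r p)
    (D_det : forall r p, rmin <= r <= rmax -> crect tmin tmax p ->
       0 < \det (D r p))
    (b1_lam : forall r t, rmin <= r <= rmax -> tmin <= t <= tmax ->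
       b1 r (1, t) - 2 * complex.Re (lam r t) <= 0)
    (delta_gt0 : 0 < delta)
    (B_coercive : exists2 C : R, 0 < C &
       forall r v, rmin <= r <= rmax -> in_H10 tmin tmax v ->
         C * Hnorm (rect tmin tmax) 1 v ^+ 2 <=
         complex.Re (Bform rmin rmax tmin tmax D b1 b2 lam delta r v v))
    (tau : nat) (tau_ge1 : (1 <= tau)%N) (hstar : R) (hstar_gt0 : 0 < hstar)
    (S : R -> set (R * R -> R[i]))
    (S_fe : forall h, 0 < h <= hstar -> is_fe_space tmin tmax tau h (S h))
    (S_approx : approx_property tmin tmax tau hstar S)
    (S_inverse : inverse_property tmin tmax hstar S) :
  let Om := rect tmin tmax in
  let Rh h r := galerkin_proj (Bform rmin rmax tmin tmax D b1 b2 lam delta r) (S h) in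
  exists C : R, forall v dv : R -> R * R -> R[i],
    C1_H_H10 tmin tmax tau.+1 `[rmin, rmax] v dv ->
    forall r h, rmin <= r <= rmax -> 0 < h <= hstar ->
    exists2 w : R * R -> R[i],
      has_deriv_H Om 1 `[rmin, rmax] (fun s p => Rh h s (v s) p - v s p) r w &
      Hnorm Om 1 w <=
        C * h ^+ tau * (Hnorm Om tau.+1 (v r) + Hnorm Om tau.+1 (dv r)).
Proof.
move=> Om Rh.
set H := in_H10 tmin tmax; set N := Hnorm Om 1.
set B := Bform rmin rmax tmin tmax D b1 b2 lam delta.
pose I := (`[rmin, rmax]%classic : set R).
have IE r : I r -> rmin <= r <= rmax by rewrite /I /= in_itv.
have EI r : rmin <= r <= rmax -> I r by rewrite /I /= in_itv.
have sH := in_H10_subspace ht.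
have qN := @in_H10_quasinorm R tmin tmax.
have [Bd [M M0 [fB fBd fT]]] := Bform_family ht delta D_smooth b1_smooth b2_smooth
  lam_Re_smooth lam_Im_smooth.
have [c c0 coer] := B_coercive.
have [Ca Ca0 appr] := near_best_approximation S_fe S_approx.
pose alpha := 2 * (M / c + 1); pose beta := 2 * (M * (2 * (M / c + 1)) / c).
have alpha0 : 0 <= alpha by rewrite mulr_ge0// addr_ge0// divr_ge0// ltW.
have beta0 : 0 <= beta by rewrite !mulr_ge0// ?invr_ge0 ?addr_ge0 ?divr_ge0// ltW.
(* alpha and beta are the factors of the approximation errors of dv and of v
   in the bound of the Galerkin derivative *)
exists ((alpha + beta) * Ca) => v dv [vH vd _] r h Ir hh.
have fe := S_fe h hh; have sS := fe_space_subspace fe.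
have SH : S h `<=` H by case: fe.
have fin := fe_space_findim fe.
have vH1 s (Is : I s) : H (v s) := (vH s Is).1.
have cB s u : I s -> H u -> c * N u ^+ 2 <= complex.Re (B s u u).
  by move=> /IE Is Hu; exact: coer.
have proj s : I s -> S h (Rh h s (v s)) /\
    forall phi, S h phi -> B s (Rh h s (v s)) phi = B s (v s) phi.
  move=> Is; apply: galerkin_projP; have [sB bB] := fB _ Is.
  apply: (galerkin_solve (M := M) (MF := M * N (v s)) sH sS SH qN fin sB bB c0).
  - by move=> u /SH Hu; exact: cB.
  - by move=> a u w /SH Hu /SH Hw; exact: (sB.2 a u w (v s) Hu Hw (vH1 _ Is)).
  - by move=> w /SH Hw; exact: (bB _ _ (vH1 _ Is) Hw).
have Iell s : I s -> `|s - r| <= rmax - rmin.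
  by move=> /IE/andP[s1 s2]; move: Ir => /andP[r1 r2]; rewrite ler_norml; lra.
have [dvH _] := vH r (EI _ Ir).
have [wS [SwS [K' K'0 quot] bnd]] := @galerkin_deriv R _ H (S h) N M c sH sS SH qN
  M0 c0 I B (Bd r) M M (rmax - rmin) v (fun s => Rh h s (v s)) (dv r) r
  fin M0 M0 (EI _ Ir) Iell (fun s Is => (fB s Is).1) (fun s Is => (fB s Is).2) cB
  (fBd r (EI _ Ir)).1 (fBd r (EI _ Ir)).2 (fun s Is => fT s r Is (EI _ Ir))
  vH1 (vH r (EI _ Ir)).2 (fun s Is => (proj s Is).1) (fun s Is => (proj s Is).2).
have [vHm dvHm vcvg] := vd r (EI _ Ir).
have H1 u : H u -> in_H Om 1 u by case.
exists (fun p => wS p - dv r p).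
  split.
  - move=> s Is; apply: in_HB; first exact/H1/SH/(proj s Is).1.
    exact/H1/vH1.
  - by apply: in_HB; apply: H1; [exact: SH|exact: (vH r (EI _ Ir)).2].
  - pose dq (s : R) := fun p => ((s - r)^-1)%:C * (v s p - v r p) - dv r p.
    apply: (@squeeze_cvgr _ _ _ _ (cst 0)
      (fun s => K' * (`|s - r| + Hnorm Om tau.+1 (dq s)))).
    + near=> s.
      have Is : I s by near: s; exact: withinT.
      have sr : s != r by near: s; apply: cvg_within (nbhs_dnbhs_neq r).
      rewrite Hnorm_ge0 /=; apply: le_trans (quot s Is sr) _.
      by rewrite ler_wpM2l// lerD2l; exact: Hnorm_le.
    + exact: cvg_cst.
    + have dist0 : `|s - r| @[s --> within I r^'] --> (0 : R).
        apply: cvg_within_filter; apply: cvg_within_filter.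
        have : `|s - r| @[s --> r] --> `|r - r|.
          by apply: cvg_norm; apply: cvgB; [exact: cvg_id|exact: cvg_cst].
        by rewrite subrr normr0.
      have : K' * (`|s - r| + Hnorm Om tau.+1 (dq s)) @[s --> within I r^'] -->
          K' * (0 + 0).
        by apply: cvgM; [exact: cvg_cst|exact: cvgD].
      by rewrite addr0 mulr0.
apply/ler_addgt0Pr => e e0.
pose e1 := e / (alpha + beta + 1).
have e10 : 0 < e1 by rewrite divr_gt0// ltr_wpDl// addr_ge0.
have [chi Schi hchi] := appr h (dv r) e1 hh e10 dvHm (vH r (EI _ Ir)).2.
have [chi' Schi' hchi'] := appr h (v r) e1 hh e10 (vHm _ (EI _ Ir)) (vH1 _ (EI _ Ir)).
apply: le_trans (bnd chi chi' Schi Schi') _.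
apply: le_trans (lerD (ler_wpM2l alpha0 hchi) (ler_wpM2l beta0 hchi')) _.
have /andP[h0 _] := hh.
have k0 : 0 <= Ca * h ^+ tau by rewrite mulr_ge0// exprn_ge0// ltW.
have := combine_bounds alpha0 beta0 k0 (Hnorm_ge0 tmin tmax tau.+1 (v r))
  (Hnorm_ge0 tmin tmax tau.+1 (dv r)) (ltW e0).
by rewrite (mulrA (alpha + beta) Ca (h ^+ tau)).
Unshelve. all: by end_near. Qed.
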